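(* Let $1\le k\le n-1$ and $\mu>k$. A function $f\in C_\mu(\mathbb{R}^n)$ can be recovered from its $k$-plane transform $\varphi=Rf$ by the formula $$f(x)=\lim_{t\to 0}\ \pi^{-k/2}\,\big(\mathcal{D}^{k/2}_{-,2}\,R^*_x\varphi\big)(t),$$ where the limit is uniform on $\mathbb{R}^n$ and the Erdélyi–Kober differentiation operator $\mathcal{D}^{k/2}_{-,2}$ (acting in the variable $t>0$ on $F(t)=(R^*_x\varphi)(t)$) can be computed as follows, with $D=\frac{1}{2t}\frac{d}{dt}$ and $m=[k/2]$ (integer part). (i) If $k$ is even, then $\mathcal{D}^{k/2}_{-,2}F=(-D)^{k/2}F$. (ii) For any $1\le k\le n-1$, $$\mathcal{D}^{k/2}_{-,2}F=t^{2-k+2m}\,(-D)^{m+1}\,t^{k}\,\psi,\qquad \psi=I^{1-k/2+m}_{-,2}\,t^{-2m-2}\,F.$$ Alternatively, $$\mathcal{D}^{k/2}_{-,2}F=2^{-k}\Big(-\frac{d}{dt}\Big)^{k}\,t\,I^{k/2}_{-,2}\,t^{-k-1}\,F.$$ Under the stronger assumption $\mu>2+2[k/2]\ (>k)$, $\mathcal{D}^{k/2}_{-,2}$ can also be computed as $$\mathcal{D}^{k/2}_{-,2}F=(-D)^{m+1}\,I^{1-k/2+m}_{-,2}\,F.$$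
   Context: $C_\mu(\mathbb{R}^n)$ is the space of continuous functions on $\mathbb{R}^n$ of order $O(|x|^{-\mu})$ at infinity. $\Pi_{n,k}$ is the manifold of all non-oriented $k$-planes $\tau$ in $\mathbb{R}^n$, $1\le k\le n-1$; each is written $\tau=(\zeta,u)$ with $\zeta\in G_{n,k}$ (the Grassmannian of $k$-dimensional linear subspaces) and $u\in\zeta^\perp$. The $k$-plane transform is $(Rf)(\tau)\equiv(Rf)(\zeta,u)=\int_\zeta f(u+v)\,dv$. For a function $\varphi$ on $\Pi_{n,k}$, $x\in\mathbb{R}^n$ and $r>0$, the shifted dual Radon transform is $$(R^*_x\varphi)(r)=\int_{SO(n)}\varphi(\gamma\mathbb{R}^k+x+r\gamma e_n)\,d\gamma,$$ where $\mathbb{R}^k=\mathbb{R}e_1\oplus\cdots\oplus\mathbb{R}e_k$, $e_1,\dots,e_n$ are the coordinate unit vectors, and $d\gamma$ is the Haar probability measure; it averages $\varphi$ over all $k$-planes at distance $r$ from $x$. For $\alpha>0$ and functions on $(0,\infty)$, $$(I^\alpha_{-,2}F)(t)=\frac{2}{\Gamma(\alpha)}\int_t^\infty\frac{F(s)\,s\,ds}{(s^2-t^2)^{1-\alpha}}.$$ Powers of $t$ in operator expressions denote multiplication operators. *)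

(* Defs.v *)
From HB Require Import structures.
From mathcomp Require Import all_boot all_order all_algebra.
From mathcomp Require Import all_classical all_reals all_analysis.

Set Implicit Arguments.
Unset Strict Implicit.
Unset Printing Implicit Defensive.

Import Order.TTheory GRing.Theory Num.Theory.
Import numFieldNormedType.Exports.

Local Open Scope classical_set_scope.
Local Open Scope ring_scope.

Section Euclidean.
Context {R : realType} {n : nat}.

Definition dotp (u v : 'cV[R]_n) : R := \sum_(i < n) u i 0 * v i 0.

(* The norm `|x| of the library on matrices is the sup norm. *)
Definition enorm (x : 'cV[R]_n) : R := Num.sqrt (dotp x x).

(* 0-based: the coordinate vectors e_1, ..., e_n are stdvec 0, ..., stdvec n.-1 *)
Definition stdvec (i : nat) : 'cV[R]_n := \col_(j < n) (j == i :> nat)%:R.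

(* R e_1 + ... + R e_k inside R^n *)
Definition coord_space (k : nat) : {vspace 'cV[R]_n} :=
  <<[seq stdvec i | i <- iota 0 k]>>%VS.

Definition C_mu (mu : R) (f : 'cV[R]_n -> R) : Prop :=
  continuous f /\
  exists C A : R, 0 < A /\
    forall x, A <= enorm x -> `|f x| <= C * enorm x `^ (- mu).

End Euclidean.

(* Lebesgue measure on R^k is the iterated product measure on
   R * (R * ( ... * unit)); Rk_vec identifies that type with 'cV[R]_k. *)
Section Lebesgue.

Section product.
Context d1 d2 (T1 : measurableType d1) (T2 : measurableType d2) (R : realType).
Variables (m1 : {sigma_finite_measure set T1 -> \bar R})
          (m2 : {sigma_finite_measure set T2 -> \bar R}).

(* The sigma-finite structure that the library declares on m1 \x m2 is shadowed
   by the one for subprobabilities, whence this alias. *)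
Definition sf_product : set (T1 * T2) -> \bar R := (m1 \x m2)%E.

HB.instance Definition _ := Measure.on sf_product.

Lemma sf_product_sigma_finite : sigma_finite setT sf_product.
Proof.
have /sigma_finiteP[F [TF ndF Foo]] := sigma_finiteT m1.
have /sigma_finiteP[G [TG ndG Goo]] := sigma_finiteT m2.
exists (fun n => F n `*` G n).
  rewrite -setXTT TF TG predeqE => -[x y]; split.
    move=> [/= [n _ Fnx] [k _ Gky]]; exists (maxn n k) => //; split.
    - by move: x Fnx; exact/subsetPset/ndF/leq_maxl.
    - by move: y Gky; exact/subsetPset/ndG/leq_maxr.
  by move=> [n _ []/= ? ?]; split; exists n.
move=> k; have [? ?] := Foo k; have [? ?] := Goo k.
split; first exact: measurableX.
by rewrite /sf_product product_measure1E// lte_mul_pinfty// ge0_fin_numE.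
Qed.

HB.instance Definition _ :=
  Measure_isSigmaFinite.Build _ _ _ sf_product sf_product_sigma_finite.

End product.

Context {R : realType}.

Record measure_space := MeasureSpace {
  ms_display : measure_display;
  ms_carrier : measurableType ms_display;
  ms_measure : {sigma_finite_measure set ms_carrier -> \bar R} }.

Fixpoint Rk_space (k : nat) : measure_space :=
  if k is k'.+1 then
    MeasureSpace (sf_product (@lebesgue_measure R) (ms_measure (Rk_space k')))
  else MeasureSpace (dirac tt).

Fixpoint Rk_vec (k : nat) : ms_carrier (Rk_space k) -> 'cV[R]_k :=
  if k is k'.+1 then
    fun z : R * ms_carrier (Rk_space k') => col_mx z.1%:M (Rk_vec z.2)
  else fun=> 0.

Definition int_Rk (k : nat) (g : 'cV[R]_k -> R) : R :=
  \int[ms_measure (Rk_space k)]_z g (Rk_vec z).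

End Lebesgue.

(* A plane tau = (zeta, u) of Pi_{n,k} is given by zeta : {vspace 'cV[R]_n} with
   \dim zeta = k and u orthogonal to zeta; a function on Pi_{n,k} is a function
   of zeta and u, whose values at other pairs are irrelevant. *)
Section KPlanes.
Context {R : realType} {n : nat}.
Variable k : nat.

(* A matrix whose columns are an orthonormal basis of zeta, if \dim zeta = k. *)
Definition onframe (zeta : {vspace 'cV[R]_n}) : 'M[R]_(n, k) :=
  xget 0 [set B : 'M[R]_(n, k) | B^T *m B = 1%:M /\
            forall v, v \in zeta <-> exists y : 'cV[R]_k, v = B *m y].

(* int_zeta g(v) dv; it does not depend on the choice of the frame. *)
Definition int_subspace (zeta : {vspace 'cV[R]_n}) (g : 'cV[R]_n -> R) : R :=
  int_Rk (fun y => g (onframe zeta *m y)).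

(* The orthogonal projection of w on the complement of zeta, so that
   zeta + w is the plane (zeta, perp zeta w). *)
Definition perp (zeta : {vspace 'cV[R]_n}) (w : 'cV[R]_n) : 'cV[R]_n :=
  w - onframe zeta *m ((onframe zeta)^T *m w).

Definition kplane_transform (f : 'cV[R]_n -> R) :
    {vspace 'cV[R]_n} -> 'cV[R]_n -> R :=
  fun zeta u => int_subspace zeta (fun v => f (u + v)).

Definition SO : set 'M[R]_n := [set g | g *m g^T = 1%:M /\ \det g = 1].

Definition mxBorel := g_sigma_algebraType (@open 'M[R]_n).

(* The Haar probability measure of SO(n), as a Borel measure on 'M[R]_n carried
   by SO(n). *)
Definition is_Haar_SO (P : probability mxBorel R) : Prop :=
  P SO = 1%E /\
  forall (g : 'M[R]_n) (A : set mxBorel),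
    SO g -> measurable A -> P [set g *m a | a in (A : set 'M[R]_n)] = P A.

Definition rot_space (g : 'M[R]_n) : {vspace 'cV[R]_n} :=
  (linfun (mulmx g) @: coord_space k)%VS.

Definition shifted_dual (P : probability mxBorel R)
    (phi : {vspace 'cV[R]_n} -> 'cV[R]_n -> R) (x : 'cV[R]_n) (r : R) : R :=
  \int[P]_(g in (SO : set mxBorel))
    phi (rot_space g) (perp (rot_space g) (x + r *: (g *m stdvec n.-1))).

End KPlanes.

Section ErdelyiKober.
Context {R : realType}.
Implicit Types (F G : R -> R) (alpha t : R).

Local Notation leb := (@lebesgue_measure R).

Definition Gamma alpha : R :=
  \int[leb]_(x in `]0, +oo[) (x `^ (alpha - 1) * expR (- x)).

Definition EK_integrand alpha F t (s : R) : R :=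
  F s * s / (s ^+ 2 - t ^+ 2) `^ (1 - alpha).

Definition EK_integral alpha F t : R :=
  2 / Gamma alpha * \int[leb]_(s in `]t, +oo[) EK_integrand alpha F t s.

Definition EK_converges alpha F : Prop :=
  forall t, 0 < t ->
    leb.-integrable `]t, +oo[ (EFin \o EK_integrand alpha F t).

Definition EK_inverse alpha F G : Prop :=
  [/\ forall t, 0 < t -> {for t, continuous G},
      EK_converges alpha G
    & forall t, 0 < t -> EK_integral alpha G t = F t].

Definition EK_differentiable alpha F : Prop :=
  exists G, EK_inverse alpha F G /\
    forall G', EK_inverse alpha F G' -> forall t, 0 < t -> G' t = G t.

(* The Erdelyi-Kober derivative is the left inverse of EK_integral alpha; its
   values at t <= 0 are irrelevant. *)
Definition EK_derivative alpha F : R -> R :=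
  xget (fun=> 0) [set G | EK_inverse alpha F G].

(* -D, where D = (1 / 2t) d/dt *)
Definition oppD F : R -> R := fun t => - (derive1 F t / (2 * t)).

Definition oppderive F : R -> R := fun t => - derive1 F t.

(* All the derivatives occurring in L^j F exist on ]0, +oo[. *)
Definition iter_derivable (L : (R -> R) -> R -> R) (j : nat) F : Prop :=
  forall i, (i < j)%N -> forall t, 0 < t -> derivable (iter i L F) t 1.

End ErdelyiKober.

(* Main.v *)
(* Let M x s be the mean of f over the sphere of radius s about x. By Fubini and
   polar coordinates in R^k, averaging the k-plane transform of f over SO(n)
   gives R^*_x phi = I^{k/2}_{-,2} (pi^{k/2} M x). Each of the formulas of the theorem
   recovers G from I^{k/2}_{-,2} G for every continuous G for which this
   integral converges: composing two Erdelyi-Kober integrals and exchanging the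
   order of integration leaves a Beta integral, and what remains is a j-fold
   iterated integral that j differentiations undo. In particular G is unique, so
   D^{k/2}_{-,2} R^*_x phi = pi^{k/2} M x, and M x t tends to f x uniformly in x
   because f is uniformly continuous. *)
Require Import Defs.
From HB Require Import structures.
From mathcomp Require Import all_boot all_order all_algebra.
From mathcomp Require Import all_classical all_reals all_analysis.
From mathcomp Require Import measurable_realfun zify ring lra.

Set Implicit Arguments.
Unset Strict Implicit.
Unset Printing Implicit Defensive.

Import Order.TTheory GRing.Theory Num.Theory.
Import numFieldNormedType.Exports.

Local Open Scope classical_set_scope.
Local Open Scope ring_scope.

(** * Change of variables on the line *)

Section OneDim.
Context {R : realType}.
Local Notation leb := (@lebesgue_measure R).
Local Open Scope ereal_scope.

(** The formulas with an extra integral differ in the weight [y^(-p)] put between two Erdelyi-Kober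
    integrals. For [p = 0] the composed kernel is a multiple of [(s^2 - t^2)^m], whose growth calls
    for the stronger decay. For [p = 2(a + b)] it also carries [t^(-2a) s^(-2b)]; the power of [s]
    makes everything converge as soon as [I^a G] does, so this formula also gives uniqueness. For
    [p = 2a + 1] and [b = a] it is a multiple of [(s - t)^(k-1) / (t s)], which suits ordinary
    derivatives. The order [b = 1 - k/2 + m] is the one for which [a + b - 1] is the natural number
    [m]. On the geometric side two invariances must be derived: that of the product measure on R^k
    under rotations, because [onframe] picks an arbitrary orthonormal basis, and that of averages
    over SO(n) under right multiplication, because the Haar measure is given as left invariant.
    Identities are proved for continuous nonnegative functions in the extended reals, where
    convergence is no issue, and reach signed functions through positive and negative parts. *)

Lemma ge0_integral_shift (f : R -> \bar R) (c : R) :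
  measurable_fun [set: R] f -> (forall x, 0 <= f x) ->
  \int[leb]_x f (x + c)%R = \int[leb]_x f x.
Proof.
move=> mf f0.
pose tr (x : measurableTypeR R) : measurableTypeR R := (x + c)%R.
have mtr : measurable_fun [set: measurableTypeR R] tr.
  by apply: measurable_funD => //; exact: measurable_cst.
transitivity (\int[pushforward leb tr]_y f y).
  have := @ge0_integral_pushforward _ _ _ _ R tr mtr leb setT f measurableT mf.
  move=> ->; last by move=> y _; exact: f0.
  by [].
apply: eq_measure_integral => A mA _; apply/esym.
apply: lebesgue_measure_unique => //= _ [[a b]] _ <-.
rewrite /pushforward /tr.
rewrite (_ : _ @^-1` _ = `](a - c)%R, (b - c)%R]%classic); last first.
  by apply/seteqP; split=> x /=; rewrite !in_itv/= => /andP[h1 h2]; apply/andP; split; lra.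
rewrite !lebesgue_measure_itv/= !lte_fin ltrD2r.
by case: ifPn => // _; rewrite -EFinB; congr EFin; ring.
Qed.

Lemma ge0_integral_opp (f : R -> \bar R) (D : set R) : measurable D ->
  measurable_fun D f -> (forall x, D x -> 0 <= f x) ->
  \int[leb]_(x in D) f x = \int[leb]_(x in [set x | D (- x)%R]) f (- x)%R.
Proof.
move=> mD mf f0.
pose nn (x : measurableTypeR R) : measurableTypeR R := (- x)%R.
have mnn : measurable_fun [set: measurableTypeR R] nn by exact: oppr_measurable.
transitivity (\int[pushforward leb nn]_(y in D) f y).
  by apply: eq_measure_integral => A mA AS; exact/esym/lebesgue_measureN.
have := @ge0_integral_pushforward _ _ _ _ R nn mnn leb D f mD mf.
by move=> ->// y; rewrite inE; exact: f0.
Qed.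

Section substitution.
Variables (phi dphi g : R -> R) (U : set R) (a_ b_ : nat -> R).
Hypothesis oU : open U.
Hypothesis ab : forall n, (a_ n <= b_ n)%R.
Hypothesis UE : U = \bigcup_n `[a_ n, b_ n]%classic.
Hypothesis aS : forall n, (a_ n.+1 <= a_ n)%R.
Hypothesis bS : forall n, (b_ n <= b_ n.+1)%R.
Hypothesis phi_der : forall x, U x -> is_derive x 1%R phi (dphi x).
Hypothesis dphi_cont : forall x, U x -> {for x, continuous dphi}.
Hypothesis dphi_gt0 : forall x, U x -> (0 < dphi x)%R.
Hypothesis g_cont : forall x, U x -> {for phi x, continuous g}.
Hypothesis g_ge0 : forall x, U x -> (0 <= g (phi x))%R.

Let I n := `[a_ n, b_ n]%classic.
Let J n := `[phi (a_ n), phi (b_ n)]%classic.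

Let IU n x : I n x -> U x. Proof. by move=> ?; rewrite UE; exists n. Qed.

Let Inda n : I n (a_ n). Proof. by rewrite /I/= in_itv/= lexx ab. Qed.
Let Indb n : I n (b_ n). Proof. by rewrite /I/= in_itv/= lexx ab. Qed.

Let derivable_phi x : U x -> derivable phi x 1.
Proof. by move=> /phi_der[]. Qed.

Let phi'E x : U x -> derive1 phi x = dphi x.
Proof. by move=> /phi_der h; rewrite derive1E derive_val. Qed.

Let phi_cont x : U x -> {for x, continuous phi}.
Proof.
by move=> /derivable_phi ?; apply/differentiable_continuous/derivable1_diffP.
Qed.

Let phi_contI n : {within I n, continuous phi}.
Proof.
by apply: continuous_in_subspaceT => x; rewrite inE => /IU /phi_cont.
Qed.

Let phi'_cont x : U x -> {for x, continuous (derive1 phi)}.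
Proof.
move=> Ux; have Ufil : \near x, dphi x = derive1 phi x.
  by near=> z; rewrite phi'E//; near: z; exact: open_nbhs_nbhs.
rewrite /prop_for /continuous_at phi'E//.
by apply: cvg_trans (dphi_cont Ux); exact: near_eq_cvg.
Unshelve. all: end_near. Qed.

Let phi_lt n : {in `[a_ n, b_ n] &, {homo phi : x y / (x < y)%R}}.
Proof.
have oo z : z \in `]a_ n, b_ n[ -> U z.
  by move=> z_; apply: (@IU n); exact: subset_itv_oo_cc z_.
apply: gtr0_derive1_lt_cc => [z /oo Uz|z /oo Uz|]; last exact: phi_contI.
  exact: derivable_phi.
by rewrite phi'E// dphi_gt0.
Qed.

Let phi_le n : {in `[a_ n, b_ n] &, {homo phi : x y / (x <= y)%R}}.
Proof.
move=> x y xI yI; rewrite le_eqVlt => /predU1P[->//|xy].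
by apply/ltW/(phi_lt xI yI).
Qed.

Let VJ : phi @` U = \bigcup_n J n.
Proof.
apply/seteqP; split=> y.
  move=> [x + <-]; rewrite {1}UE => -[n _ Inx].
  exists n => //; rewrite /J /= in_itv/=.
  have := Inx; rewrite /= in_itv/= => /andP[ax xb].
  by rewrite !(@phi_le n)//; [exact: Indb|exact: Inda].
move=> [n _ Jy].
have [|x xI <-] := @IVT R phi (a_ n) (b_ n) y (ab n) (@phi_contI n).
  move: Jy; rewrite /J/= in_itv/= => /andP[h1 h2].
  by rewrite ge_min h1/= le_max h2 orbT.
by exists x => //; apply: (@IU n); exact: xI.
Qed.

Let ndI : nondecreasing_seq I.
Proof.
apply/nondecreasing_seqP => n; apply/subsetPset => x; rewrite /I/= !in_itv/=.
by move=> /andP[h1 h2]; rewrite (le_trans (aS _))// (le_trans h2).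
Qed.

Let ndJ : nondecreasing_seq J.
Proof.
apply/nondecreasing_seqP => n; apply/subsetPset => x; rewrite /J/= !in_itv/=.
have ISn : I n `<=` I n.+1 by apply/subsetPset; exact: ndI.
move=> /andP[h1 h2]; apply/andP; split.
  by apply: le_trans h1; apply: phi_le (aS _); [exact: Inda|exact/ISn/Inda].
by apply: (le_trans h2); apply: phi_le (bS _); [exact/ISn/Indb|exact: Indb].
Qed.

(** On each compact interval [[a_n, b_n]] this is the classical substitution, and both sides
    increase to their limits by monotone convergence. Thus [g] and [dphi] may blow up at the ends of
    [U], as the kernels below do. *)
Lemma ge0_integral_subst_exhaust :
  \int[leb]_(y in phi @` U) (g y)%:E = \int[leb]_(x in U) (g (phi x) * dphi x)%:E.
Proof.
have JU n y : J n y -> exists2 x, U x & phi x = y.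
  by move=> Jy; have : (phi @` U) y by rewrite VJ; exists n.
have mI n : measurable (I n) by exact: measurable_itv.
have mJ n : measurable (J n) by exact: measurable_itv.
have mcont (f : R -> R) (K : set R) : measurable K ->
    (forall x, K x -> {for x, continuous f}) -> measurable_fun K (EFin \o f).
  move=> mK cf; apply/measurable_EFinP.
  apply: subspace_continuous_measurable_fun => //.
  by apply: continuous_in_subspaceT => x; rewrite inE => /cf.
have cgphi x : U x -> {for x, continuous (fun x => g (phi x) * dphi x)%R}.
  move=> Ux; apply: cvgM; last exact: dphi_cont.
  apply: (@continuous_comp _ _ _ phi g); first exact: phi_cont.
  exact: g_cont.
have hV : \int[leb]_(y in J n) (g y)%:E @[n --> \oo] -->
    \int[leb]_(y in phi @` U) (g y)%:E.
  rewrite VJ; apply: ge0_nondecreasing_set_cvg_integral => //.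
    move=> n; apply: mcont => // y /JU[x Ux <-]; exact: g_cont.
  by move=> n y /JU[x Ux <-]; rewrite lee_fin g_ge0.
have hU : \int[leb]_(x in I n) (g (phi x) * dphi x)%:E @[n --> \oo] -->
    \int[leb]_(x in U) (g (phi x) * dphi x)%:E.
  rewrite [X in integral _ X]UE; apply: ge0_nondecreasing_set_cvg_integral => //.
    by move=> n; apply: mcont => // x /IU; exact: cgphi.
  by move=> n x /IU Ux; rewrite lee_fin mulr_ge0 ?g_ge0// ltW// dphi_gt0.
suff IJ : (fun n => \int[leb]_(y in J n) (g y)%:E) =
    (fun n => \int[leb]_(x in I n) (g (phi x) * dphi x)%:E).
  by move: hV; rewrite IJ => hV; exact: (cvg_unique _ hV hU).
apply/funext => n.
have oo z : z \in `]a_ n, b_ n[ -> U z.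
  by move=> z_; apply: (@IU n); exact: subset_itv_oo_cc z_.
have Ua : U (a_ n) by apply: (@IU n); exact: Inda.
have Ub : U (b_ n) by apply: (@IU n); exact: Indb.
rewrite /J integration_by_substitution_increasing//.
- by apply: eq_integral => x; rewrite inE => /IU Ux; rewrite -(phi'E Ux).
- by move=> x /oo; exact: phi'_cont.
- by apply/cvg_ex; exists (derive1 phi (a_ n)); apply: cvg_at_right_filter; exact: phi'_cont.
- by apply/cvg_ex; exists (derive1 phi (b_ n)); apply: cvg_at_left_filter; exact: phi'_cont.
- split; first by move=> x /oo; exact: derivable_phi.
    by apply: cvg_at_right_filter; exact: phi_cont.
  by apply: cvg_at_left_filter; exact: phi_cont.
- apply: continuous_in_subspaceT => x; rewrite inE => /JU[y Uy <-].
  exact: g_cont.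
Qed.

End substitution.

Let shrink_cvg (e : R) : (0 < e)%R -> (e * n.+2%:R^-1)%R @[n --> \oo] --> (0 : R)%R.
Proof.
move=> e0; rewrite -(mulr0 e); apply: cvgMr.
by have := @cvg_harmonic R; rewrite -cvg_shiftS.
Qed.

Lemma ge0_integral_subst_oo (phi dphi g : R -> R) (a b : R) : (a < b)%R ->
  (forall x, x \in `[a, b] -> is_derive x 1%R phi (dphi x)) ->
  (forall x, x \in `]a, b[ -> {for x, continuous dphi}) ->
  (forall x, x \in `]a, b[ -> (0 < dphi x)%R) ->
  (forall y, y \in `]phi a, phi b[ -> {for y, continuous g}) ->
  (forall y, y \in `]phi a, phi b[ -> (0 <= g y)%R) ->
  \int[leb]_(y in `]phi a, phi b[) (g y)%:E =
  \int[leb]_(x in `]a, b[) (g (phi x) * dphi x)%:E.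
Proof.
move=> ab dphi_der cdphi dphi0 cg g0.
have dphiE x : x \in `]a, b[ -> is_derive x 1%R phi (dphi x).
  by move=> x_; apply: dphi_der; exact: subset_itv_oo_cc x_.
have cphi : {within `[a, b], continuous phi}.
  apply: continuous_in_subspaceT => x; rewrite inE => /dphi_der[h _].
  by apply/differentiable_continuous/derivable1_diffP.
have phi_lt : {in `[a, b] &, {homo phi : x y / (x < y)%R}}.
  apply: gtr0_derive1_lt_cc => // z zab; have hz := dphiE _ zab; first by case: hz.
  by rewrite derive1E derive_val dphi0.
have aab : a \in `[a, b] by rewrite in_itv/= lexx ltW.
have bab : b \in `[a, b] by rewrite in_itv/= lexx ltW.
have phioo x : x \in `]a, b[ -> phi x \in `]phi a, phi b[.
  move=> x_; have x__ := subset_itv_oo_cc x_; move: x_.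
  by rewrite !in_itv/= => /andP[ax xb]; rewrite !phi_lt.
(* The denominator [n.+2] gives [a + d n <= b - d n] already for [n = 0]. *)
pose d (n : nat) := ((b - a) * n.+2%:R^-1)%R.
have d0 n : (0 < d n)%R by rewrite mulr_gt0 ?subr_gt0// invr_gt0.
have dle n : (d n.+1 <= d n)%R.
  by rewrite ler_pM2l ?subr_gt0// lef_pV2 ?posrE// ler_nat.
have d2 n : (d n <= (b - a) / 2)%R.
  by rewrite ler_pM2l ?subr_gt0// lef_pV2 ?posrE// ler_nat.
have imE : phi @` `]a, b[ = `]phi a, phi b[%classic.
  apply/seteqP; split=> [_ [x x_ <-]|y]; first exact: phioo.
  move=> /=; rewrite in_itv/= => /andP[ay yb].
  have [|x x_ xy] := @IVT R phi a b y (ltW ab) cphi.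
    by rewrite ge_min (ltW ay)/= le_max (ltW yb) orbT.
  exists x => //; move: x_; rewrite /= !in_itv/= => /andP[ax xb].
  rewrite !lt_neqAle ax xb !andbT; apply/andP; split; apply/eqP => h.
    by move: ay; rewrite -xy h ltxx.
  by move: yb; rewrite -xy h ltxx.
rewrite -imE.
apply: (@ge0_integral_subst_exhaust phi dphi g _ (fun n => a + d n)%R (fun n => b - d n)%R).
- exact: interval_open.
- by move=> n; have := d2 n; lra.
- apply/seteqP; split=> x.
    rewrite /= in_itv/= => /andP[ax xb].
    have /= := @shrink_cvg (b - a)%R; rewrite subr_gt0 => /(_ ab).
    move=> /cvgrPdist_lt /(_ (Num.min (x - a) (b - x))%R).
    rewrite lt_min !subr_gt0 ax xb => /(_ isT)[n _ /(_ n (leqnn n))].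
    rewrite sub0r normrN gtr0_norm ?d0// lt_min => /andP[h1 h2].
    exists n => //; rewrite /= in_itv/= /d; apply/andP; split.
      by rewrite -lerBrDl ltW.
    by rewrite lerBrDr -lerBrDl ltW.
  move=> [n _]; rewrite /= !in_itv/= => /andP[h1 h2].
  by have := d0 n; move=> ?; apply/andP; split; lra.
- by move=> n; have := dle n; lra.
- by move=> n; have := dle n; lra.
- by move=> x; exact: cdphi.
- by move=> x; exact: dphi0.
- by move=> x /phioo; exact: cg.
- by move=> x /phioo; exact: g0.
Qed.

Lemma ge0_integral_subst_oy (phi dphi g : R -> R) (a : R) :
  (forall x, x \in `[a, +oo[ -> is_derive x 1%R phi (dphi x)) ->
  (forall x, x \in `]a, +oo[ -> {for x, continuous dphi}) ->
  (forall x, x \in `]a, +oo[ -> (0 < dphi x)%R) ->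
  (forall M : R, exists2 x, a < x & M < phi x)%R ->
  (forall y, y \in `]phi a, +oo[ -> {for y, continuous g}) ->
  (forall y, y \in `]phi a, +oo[ -> (0 <= g y)%R) ->
  \int[leb]_(y in `]phi a, +oo[) (g y)%:E =
  \int[leb]_(x in `]a, +oo[) (g (phi x) * dphi x)%:E.
Proof.
move=> dphi_der cdphi dphi0 phioo cg g0.
have sub x : x \in `]a, +oo[ -> x \in `[a, +oo[.
  by rewrite !in_itv/= !andbT; exact: ltW.
have cphi b : {within `[a, b], continuous phi}.
  apply: continuous_in_subspaceT => x; rewrite inE/= in_itv/= => /andP[ax _].
  have [|h _] := dphi_der x; first by rewrite in_itv/= ax.
  by apply/differentiable_continuous/derivable1_diffP.
have phi_lt x y : (a <= x)%R -> (x < y)%R -> (phi x < phi y)%R.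
  move=> ax xy.
  have oo z : z \in `]a, y[ -> z \in `]a, +oo[ by rewrite !in_itv/= => /andP[->].
  apply: (@gtr0_derive1_lt_cc _ phi a y) => //.
  - by move=> z /oo /sub/dphi_der[].
  - by move=> z /oo zo; have h := dphi_der _ (sub _ zo); rewrite derive1E derive_val dphi0.
  - by rewrite in_itv/= ax ltW.
  - by rewrite in_itv/= lexx (le_trans ax)// ltW.
have phioy x : x \in `]a, +oo[ -> phi x \in `]phi a, +oo[.
  by rewrite !in_itv/= !andbT; exact: phi_lt.
have imE : phi @` `]a, +oo[ = `]phi a, +oo[%classic.
  apply/seteqP; split=> [_ [x x_ <-]|y]; first exact: phioy.
  move=> /=; rewrite in_itv/= andbT => ay.
  have [b ab yb] := phioo y.
  have [|x x_ xy] := @IVT R phi a b y (ltW ab) (cphi b).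
    by rewrite ge_min (ltW ay)/= le_max (ltW yb) orbT.
  exists x => //; move: x_; rewrite /= !in_itv/= andbT => /andP[ax xb].
  by rewrite lt_neqAle ax andbT; apply/eqP => h; move: ay; rewrite -xy h ltxx.
rewrite -imE.
have n2 (n : nat) : (0 < n.+2%:R^-1 :> R)%R && (n.+2%:R^-1 <= 1 :> R)%R.
  by rewrite invr_gt0 ltr0n/= invf_le1// ler1n.
have phi_der x : `]a, +oo[%classic x -> is_derive x 1%R phi (dphi x).
  by move=> /sub; exact: dphi_der.
clear dphi_der.
apply: (@ge0_integral_subst_exhaust phi dphi g _ (fun n => a + n.+2%:R^-1)%R (fun n => a + 1 + n%:R)%R).
- exact: interval_open.
- by move=> n; have /andP[_ h2] := n2 n; rewrite -addrA lerD2l (le_trans h2)// lerDl.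
- apply/seteqP; split=> x.
    rewrite /= in_itv/= andbT => ax.
    have /= := @shrink_cvg 1%R ltr01 => /cvgrPdist_lt /(_ (x - a)%R).
    rewrite subr_gt0 ax => /(_ isT)[n _ hn].
    pose N := maxn n (Num.bound (x - a)).
    have /hn : (n <= N)%N by exact: leq_maxl.
    rewrite sub0r normrN mul1r gtr0_norm; last by have /andP[] := n2 N.
    move=> h1; exists N => //; rewrite /= in_itv/=; apply/andP; split.
      by rewrite -lerBrDl ltW.
    rewrite -addrA -lerBlDl (@le_trans _ _ N%:R)%R// ?lerDr//.
    rewrite ltW// (@lt_le_trans _ _ (Num.bound (x - a)%R)%:R)%R//.
      by rewrite archi_boundP// subr_ge0 ltW.
    by rewrite ler_nat leq_maxr.
  move=> [n _]; rewrite /= !in_itv/= andbT => /andP[h1 h2].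
  by have /andP[h _] := n2 n; apply: lt_le_trans h1; rewrite ltrDl.
- by move=> n; rewrite lerD2l lef_pV2 ?posrE// ler_nat.
- by move=> n; rewrite lerD2l ler_nat.
- by move=> x; exact: cdphi.
- by move=> x; exact: dphi0.
- by move=> x /phioy; exact: cg.
- by move=> x /phioy; exact: g0.
Qed.

End OneDim.

(** * Fubini on a triangle *)

Section TwoDim.
Context {R : realType}.
Local Notation leb := (@lebesgue_measure R).
Local Open Scope ereal_scope.

Section fubini_on.
Variables (D : set (measurableTypeR R * measurableTypeR R)).
Variable k : measurableTypeR R * measurableTypeR R -> \bar R.
Hypotheses (mD : measurable D) (mk : measurable_fun D k).

(** Extension by 0 turns integrals over the sections of [D] into integrals over the line, to which
    the theorems on product measures apply. *)
Let k' := k \_ D.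

Let mk' : measurable_fun setT k'.
Proof. by apply/(measurable_restrictT _ _).1. Qed.

Let patch_x (f : \bar R -> \bar R) x : f 0 = 0 ->
  \int[leb]_(y in [set y | D (x, y)]) f (k (x, y)) = \int[leb]_y f (k' (x, y)).
Proof.
move=> f0; rewrite integral_mkcond; apply: eq_integral => y _.
by rewrite /k' /patch; case: ifPn => /=; rewrite ?inE ?notin_setE /= => h;
  [rewrite mem_set|rewrite memNset].
Qed.

Let patch_y (f : \bar R -> \bar R) y : f 0 = 0 ->
  \int[leb]_(x in [set x | D (x, y)]) f (k (x, y)) = \int[leb]_x f (k' (x, y)).
Proof.
move=> f0; rewrite integral_mkcond; apply: eq_integral => x _.
by rewrite /k' /patch; case: ifPn => /=; rewrite ?inE ?notin_setE /= => h;
  [rewrite mem_set|rewrite memNset].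
Qed.

Lemma tonelli_on : (forall p, D p -> 0 <= k p) ->
  \int[leb]_x \int[leb]_(y in [set y | D (x, y)]) k (x, y) =
  \int[leb]_y \int[leb]_(x in [set x | D (x, y)]) k (x, y).
Proof.
move=> k0; under eq_integral do rewrite (patch_x (f := id))//.
under [RHS]eq_integral do rewrite (patch_y (f := id))//.
rewrite (fubini_tonelli k')// => p; apply: erestrict_ge0 => q; exact: k0.
Qed.

Hypothesis ik :
  \int[leb]_y \int[leb]_(x in [set x | D (x, y)]) `|k (x, y)| < +oo.

Let ik' : (leb \x leb).-integrable setT k'.
Proof.
apply/integrable21ltyP => //; apply: le_lt_trans ik.
rewrite le_eqVlt; apply/orP; left; apply/eqP; apply: eq_integral => y _.
by rewrite (patch_y (f := abse))//= normr0.
Qed.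

Lemma integrable_on_x :
  leb.-integrable setT (fun x => \int[leb]_(y in [set y | D (x, y)]) k (x, y)).
Proof.
rewrite (_ : (fun x => _) = (fun x => \int[leb]_y k' (x, y))).
  exact: (integrable_fubini_F ik').
by apply/funext => x; rewrite (patch_x (f := id)).
Qed.

Lemma fubini_on :
  \int[leb]_x \int[leb]_(y in [set y | D (x, y)]) k (x, y) =
  \int[leb]_y \int[leb]_(x in [set x | D (x, y)]) k (x, y).
Proof.
under eq_integral do rewrite (patch_x (f := id))//.
under [RHS]eq_integral do rewrite (patch_y (f := id))//.
exact: (Fubini ik').
Qed.

End fubini_on.

Definition triangle (t : R) : set (measurableTypeR R * measurableTypeR R) :=
  [set p | (t < p.1)%R /\ (p.1 < p.2)%R].

Lemma measurable_triangle t : measurable (triangle t).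
Proof.
rewrite (_ : triangle t = (fst @^-1` `]t, +oo[%classic) `&`
   ((fun p => p.2 - p.1)%R @^-1` `]0%R, +oo[%classic)).
  apply: measurableI; rewrite -[X in measurable X]setTI.
    by apply: measurable_fst => //; exact: measurable_itv.
  have mB : measurable_fun setT (fun p : measurableTypeR R * measurableTypeR R => (p.2 - p.1)%R : measurableTypeR R).
    by apply: measurable_funB; [exact: measurable_snd|exact: measurable_fst].
  by apply: mB => //; exact: measurable_itv.
by apply/seteqP; split => -[x y]; rewrite /triangle/= !in_itv/= !andbT subr_gt0.
Qed.

(** Since [k] is nonnegative, integrating [|k g|] first in [y] gives [K |g|]; integrability of [K g]
    therefore licenses the exchange. The last hypothesis makes the inner integral in [z] finite for
    every [y], so that the real-valued [h] is the true integral everywhere. *)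
Lemma kernel_fubini (t : R) (k : R * R -> R) (K g : R -> R) :
  measurable_fun (triangle t) k ->
  (forall y z, t < y -> y < z -> 0 <= k (y, z))%R ->
  measurable_fun `]t, +oo[ g ->
  (forall z, (t < z)%R ->
    \int[leb]_(y in `]t, z[) (k (y, z))%:E = (K z)%:E) ->
  leb.-integrable `]t, +oo[ (EFin \o (fun z => K z * g z)%R) ->
  (forall y, (t < y)%R ->
    leb.-integrable `]y, +oo[ (EFin \o (fun z => k (y, z) * g z)%R)) ->
  let h y := (\int[leb]_(z in `]y, +oo[) (k (y, z) * g z))%R in
  leb.-integrable `]t, +oo[ (EFin \o h) /\
  (\int[leb]_(y in `]t, +oo[) h y)%R =
  (\int[leb]_(z in `]t, +oo[) (K z * g z))%R.
Proof.
move=> mk k0 mg kK iK ik h.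
pose D := triangle t.
pose f p := (k p * g p.2)%:E.
have mD : measurable D by exact: measurable_triangle.
have mf : measurable_fun D f.
  apply/measurable_EFinP/measurable_funM => //.
  apply: (@measurable_comp _ _ _ _ _ _ `]t, +oo[%classic) => //.
  - by move=> _ [[x y] [/= h1 h2] <-]; rewrite in_itv/= andbT (lt_trans h1).
  - by apply: measurable_funTS; exact: measurable_snd.
have Dx x : (t < x)%R -> [set y | D (x, y)] = `]x, +oo[%classic.
  move=> tx; apply/seteqP; split=> y; rewrite /D /triangle /= in_itv/= andbT //.
  by case.
have Dx0 x : ~ (t < x)%R -> [set y | D (x, y)] = set0.
  by move=> tx; apply/seteqP; split=> // y [].
have Dy y : (t < y)%R -> [set x | D (x, y)] = `]t, y[%classic.
  move=> ty; apply/seteqP; split=> x; rewrite /D /triangle /= in_itv/=.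
    by case=> -> ->.
  by case/andP.
have Dy0 y : ~ (t < y)%R -> [set x | D (x, y)] = set0.
  by move=> ty; apply/seteqP; split=> // x [] /= h1 h2; exact: ty (lt_trans h1 h2).
have mky z : (t < z)%R -> measurable_fun `]t, z[ (fun y : R => k (y, z)).
  move=> tz; apply: (@measurable_comp _ _ _ _ _ _ D) => //.
    by move=> _ [y /= yz <-]; move: yz; rewrite in_itv/= => /andP[].
  by apply: measurable_funTS; exact: pair2_measurable.
have ik0 : forall z, (t < z)%R -> leb.-integrable `]t, z[ (fun y => (k (y, z))%:E).
  move=> z tz; apply/integrableP; split; first by apply/measurable_EFinP; exact: mky.
  under eq_integral => y.
    rewrite inE/= in_itv/= => /andP[ty yz].
    rewrite /= (ger0_norm (k0 _ _ ty yz)).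
    over.
  by rewrite kK// ltry.
have sec (c : R) z : (t < z)%R ->
    \int[leb]_(y in `]t, z[) (k (y, z) * c)%:E = (K z * c)%:E.
  move=> tz; under eq_integral do rewrite EFinM muleC.
  by rewrite integralZl//; [rewrite kK// muleC|exact: ik0].
have K0 z : (t < z)%R -> (0 <= K z)%R.
  move=> tz; rewrite -lee_fin -kK//; apply: integral_ge0 => y.
  by rewrite /= in_itv/= => /andP[ty yz]; rewrite lee_fin k0.
have toD (u : R -> \bar R) (v : R -> \bar R) : (forall z, (t < z)%R -> u z = v z) ->
    (forall z, ~ (t < z)%R -> u z = 0) -> \int[leb]_z u z = \int[leb]_(z in `]t, +oo[) v z.
  move=> uv u0; rewrite [RHS]integral_mkcond; apply: eq_integral => z _.
  rewrite patchE; case: ifPn => [|/negP]; rewrite inE/= in_itv/= andbT => tz.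
    exact: uv.
  exact: u0.
have intf : \int[leb]_y \int[leb]_(x in [set x | D (x, y)]) `|f (x, y)| < +oo.
  rewrite (toD _ (fun z => `|(K z * g z)%:E|)).
  - by case/integrableP : iK.
  - move=> z tz; rewrite Dy//.
    under eq_integral => y.
      rewrite inE/= in_itv/= => /andP[ty yz].
      rewrite /f normrM (ger0_norm (k0 _ _ ty yz)).
      over.
    by rewrite /= sec// normrM (ger0_norm (K0 _ tz)).
  - by move=> z tz; rewrite Dy0// integral_set0.
have hE x : (t < x)%R -> \int[leb]_(y in [set y | D (x, y)]) f (x, y) = (h x)%:E.
  move=> tx; rewrite Dx// /h /Rintegral fineK//.
  by apply: integrable_fin_num => //; exact: ik.
have intx := integrable_on_x mD mf intf.
split.
  have : leb.-integrable `]t, +oo[ (fun x => \int[leb]_(y in [set y | D (x, y)]) f (x, y)).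
    exact: integrableS intx.
  by apply: eq_integrable => // x; rewrite inE/= in_itv/= andbT => /hE.
rewrite /Rintegral; congr fine.
have := fubini_on mD mf intf.
rewrite (toD _ (EFin \o h)); last 2 first.
  - by move=> x tx; rewrite hE.
  - by move=> x tx; rewrite Dx0// integral_set0.
move=> ->; rewrite (toD _ (fun z => (K z * g z)%:E))//.
- by move=> z tz; rewrite Dy//; exact: (sec (g z) z tz).
- by move=> z tz; rewrite Dy0// integral_set0.
Qed.

End TwoDim.

(** * Repeated differentiation of an improper integral *)

Section IteratedIntegral.
Context {R : realType}.
Local Notation leb := (@lebesgue_measure R).

Lemma continuous_measurable_oy (h : R -> R) (t : R) : 0 <= t ->
  (forall x : R, 0 < x -> {for x, continuous h}) -> measurable_fun `]t, +oo[ h.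
Proof.
move=> t0 hc; apply: open_continuous_measurable_fun; first exact: interval_open.
move=> x; rewrite inE/= in_itv/= andbT => tx; apply: hc; exact: le_lt_trans tx.
Qed.

Lemma is_derive_integral_oy (h : R -> R) :
  (forall x : R, 0 < x -> {for x, continuous h}) ->
  (forall t : R, 0 < t -> leb.-integrable `]t, +oo[ (EFin \o h)) ->
  forall t : R, 0 < t ->
    is_derive t 1 (fun t => \int[leb]_(s in `]t, +oo[) h s) (- h t).
Proof.
move=> hc hi t t0.
(* The ray is cut at [t / 2], below every [y] near [t]: the integral from [y] is that from [t / 2]
   minus one over a bounded interval, and only the latter depends on [y]. *)
have c0 : 0 < t / 2 by lra.
pose H y := \int[leb]_(s in [set` Interval (BRight (t / 2)) (BRight y)]) h s.
have iH : leb.-integrable [set` Interval (BRight (t / 2)) (BRight (t + 1))] (EFin \o h).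
  apply: integrableS (hi _ c0) => //.
  by apply: subset_itvl.
have [dH H't] : derivable H t 1 /\ derive1 H t = h t.
  apply: (continuous_FTC1 (u := t + 1)) => //; first by lra.
    have : (BRight (t / 2) < BRight t :> itv_bound R)%O by rewrite bnd_simp; lra.
    exact.
  exact: hc.
have isH : is_derive t 1 (fun y => \int[leb]_(s in `](t / 2), +oo[) h s - H y) (- h t).
  have : is_derive t 1 H (h t) by rewrite -H't derive1E; exact/derivableP.
  move=> ?; rewrite -[- h t]add0r; apply: is_deriveB.
apply: near_eq_is_derive isH; near=> y.
rewrite /H Rintegral_itvB//; first exact: hi.
have : y \in `](t / 2), +oo[.
  by near: y; apply: near_in_itvoy; rewrite in_itv/= andbT; lra.
by rewrite in_itv/= andbT bnd_simp => /ltW.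
Unshelve. all: end_near. Qed.

Lemma integral_oo_FTC (P p : R -> R) (a b : R) : a < b ->
  (forall y : R, is_derive y 1 P (p y)) -> continuous p ->
  (\int[leb]_(y in `]a, b[) (p y)%:E = (P b - P a)%:E)%E.
Proof.
move=> ab dP cp.
have cP : continuous P.
  by move=> x; have [h _] := dP x; apply/differentiable_continuous/derivable1_diffP.
have mp : measurable_fun [set: R] p by exact: continuous_measurable_fun.
rewrite integral_itv_obnd_cbnd; last by apply/measurable_EFinP; exact: measurable_funTS.
rewrite integral_itv_bndo_bndc; last by apply/measurable_EFinP; exact: measurable_funTS.
rewrite (continuous_FTC2 (F := P))//.
- exact: continuous_subspaceT.
- split.
  + by move=> x _; have [] := dP x.
  + by apply: cvg_at_right_filter; exact: cP.
  + by apply: cvg_at_left_filter; exact: cP.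
- by move=> x _; rewrite derive1E derive_val.
Qed.

Variables W w : R -> R.
Hypothesis W_der : forall x : R, is_derive x 1 W (w x).
Hypothesis w_cont : continuous w.
Hypothesis w_gt0 : forall x : R, 0 < x -> 0 < w x.

Let W_cont : continuous W.
Proof.
by move=> x; have [h _] := W_der x; apply/differentiable_continuous/derivable1_diffP.
Qed.

Let W_lt (x y : R) : 0 < x -> x < y -> W x < W y.
Proof.
move=> x0 xy; apply: (@gtr0_derive1_lt_cc _ W x y) => //.
- move=> z; rewrite in_itv/= => /andP[xz _]; rewrite derive1E derive_val w_gt0//.
  exact: lt_trans xz.
- exact: continuous_subspaceT.
- by rewrite in_itv/= lexx ltW.
- by rewrite in_itv/= lexx ltW.
Qed.

Definition iter_int_converges (j : nat) (g : R -> R) := forall t : R, 0 < t ->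
  leb.-integrable `]t, +oo[ (EFin \o (fun s => (W s - W t) ^+ j * (w s * g s))).

(** Cauchy's formula for the [(j+1)]-fold iterated integral with respect to [dW] over a ray.
    [W = s^2] will correspond to [-D], and [W = id] to [-d/dt]. *)
Definition iter_int (j : nat) (g : R -> R) (t : R) :=
  \int[leb]_(s in `]t, +oo[) ((W s - W t) ^+ j / j`!%:R * (w s * g s)).

Definition opp_derive_weight (F : R -> R) (t : R) := - (derive1 F t / w t).

Variable g : R -> R.
Hypothesis g_cont : forall x : R, 0 < x -> {for x, continuous g}.

Let mwg (t : R) : 0 <= t -> measurable_fun `]t, +oo[ (fun s => w s * g s).
Proof.
move=> t0; apply: continuous_measurable_oy => // x x0.
by apply: cvgM; [exact: w_cont|exact: g_cont].
Qed.

Let mWj (t : R) j : measurable_fun [set: R] (fun s => (W s - W t) ^+ j).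
Proof.
apply: measurable_funX; apply: measurable_funB => //.
exact: continuous_measurable_fun.
Qed.

(** Convergence at [t] is deduced from convergence at [t / 2]: for [s > t] the additional factor
    [W s - W (t / 2)] is at least the positive constant [W t - W (t / 2)]. *)
Lemma iter_int_converges_pred j :
  iter_int_converges j.+1 g -> iter_int_converges j g.
Proof.
move=> cg t t0; have t20 : 0 < t / 2 by lra.
have d0 : 0 < W t - W (t / 2) by rewrite subr_gt0 W_lt//; lra.
pose f s := (W t - W (t / 2))^-1 * ((W s - W (t / 2)) ^+ j.+1 * (w s * g s)).
have fi : leb.-integrable `]t, +oo[ (EFin \o f).
  rewrite (_ : EFin \o f = fun s => ((W t - W (t / 2))^-1%:E * ((W s - W (t / 2)) ^+ j.+1 * (w s * g s))%:E)%E)//.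
  apply: integrableZl => //; apply: integrableS (cg _ t20) => //.
  by apply: subset_itvr; rewrite bnd_simp; lra.
apply: le_integrable fi => //.
  apply/measurable_EFinP/measurable_funM; last by apply: mwg; exact: ltW.
  by apply: measurable_funTS; exact: mWj.
move=> s /=; rewrite in_itv/= andbT => ts; rewrite lee_fin /f.
set c := w s * g s; rewrite !normrM [leRHS]mulrA.
rewrite ler_wpM2r//.
have h1 : 0 < W s - W t by rewrite subr_gt0 W_lt.
rewrite normrX (gtr0_norm h1) normfV (gtr0_norm d0) normrX gtr0_norm; last lra.
rewrite ler_pdivlMl// exprS; apply: ler_pM => //.
- exact: ltW.
- by rewrite exprn_ge0// ltW.
- by lra.
- by rewrite lerXn2r// ?nnegrE; lra.
Qed.

(** Fubini on the triangle [t < y < z] with the kernel [w y (W z - W y)^j / j!], whose integral in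
    [y] is [(W z - W t)^(j+1) / (j+1)!]. *)
Lemma iter_int_step j : iter_int_converges j.+1 g -> forall t : R, 0 < t ->
  leb.-integrable `]t, +oo[ (EFin \o (fun y => w y * iter_int j g y)) /\
  iter_int j.+1 g t = \int[leb]_(y in `]t, +oo[) (w y * iter_int j g y).
Proof.
move=> cg t t0; have cg' := iter_int_converges_pred cg.
pose k (p : R * R) := w p.1 * ((W p.2 - W p.1) ^+ j / j`!%:R).
pose K z := (W z - W t) ^+ j.+1 / j.+1`!%:R.
have iZ i (c y : R) : 0 < y -> iter_int_converges i g ->
    leb.-integrable `]y, +oo[ (EFin \o (fun z => c * ((W z - W y) ^+ i * (w z * g z)))).
  move=> y0 ci.
  rewrite (_ : EFin \o _ = fun s => (c%:E * ((W s - W y) ^+ i * (w s * g s))%:E)%E)//.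
  by apply: integrableZl => //; exact: ci.
have [||||||] := @kernel_fubini R t k K (fun s => w s * g s).
- apply: measurable_funTS; apply: measurable_funM.
    by apply: measurableT_comp; [exact: continuous_measurable_fun|exact: measurable_fst].
  apply: measurable_funM => //; apply: measurable_funX; apply: measurable_funB.
    by apply: measurableT_comp; [exact: continuous_measurable_fun|exact: measurable_snd].
  by apply: measurableT_comp; [exact: continuous_measurable_fun|exact: measurable_fst].
- move=> y z ty yz; rewrite /k/= mulr_ge0//.
    by rewrite ltW// w_gt0// (lt_trans t0).
  by rewrite divr_ge0// exprn_ge0// subr_ge0 ltW// W_lt// (lt_trans t0).
- by apply: mwg; exact: ltW.
- move=> z tz; pose P : R -> R := - ((j.+1)`!%:R^-1 \*: ((cst (W z) - W) ^+ j.+1)).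
  have kc : continuous (fun y => k (y, z)).
    move=> y; apply: cvgM; first exact: w_cont.
    apply: cvgMl; apply: (@continuous_comp _ _ _ (fun y => W z - W y) (fun u : R => u ^+ j)).
      by apply: cvgB; [exact: cvg_cst|exact: W_cont].
    exact: exprn_continuous.
  have Pder (y : R) : is_derive y 1 P (k (y, z)).
    rewrite /P; apply: is_derive_eq.
    rewrite /k /= sub0r !scalerN opprK factS natrM invfM.
    rewrite /GRing.scale/=.
    have f0 : j`!%:R != 0 :> R by rewrite pnatr_eq0 -lt0n fact_gt0.
    have j0 : j.+1%:R != 0 :> R by rewrite pnatr_eq0.
    set u := ((cst (W z) - W) y); rewrite -[W z - W y]/u; move: j0 f0.
    by move: (j.+1%:R) (j`!%:R) (u ^+ j) => A B C A0 B0; field; rewrite A0 B0.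
  rewrite (integral_oo_FTC tz Pder)//; congr EFin.
  have PE y : P y = - ((j.+1)`!%:R^-1 * (W z - W y) ^+ j.+1).
    by rewrite /P !fctE.
  by rewrite !PE subrr expr0n mulr0 oppr0 sub0r opprK mulrC.
- rewrite (_ : EFin \o _ = EFin \o (fun z => (j.+1)`!%:R^-1 * ((W z - W t) ^+ j.+1 * (w z * g z)))).
    exact: iZ.
  by apply/funext => s; congr EFin; rewrite /K [RHS]mulrA [in RHS](mulrC (_^-1)).
- move=> y ty.
  rewrite (_ : EFin \o _ = EFin \o (fun z => (w y / j`!%:R) * ((W z - W y) ^+ j * (w z * g z)))).
    by apply: iZ => //; exact: lt_trans ty.
  by apply/funext => s; rewrite /= /k/=; congr EFin; ring.
have hE (y : R) : t < y -> \int[leb]_(z in `]y, +oo[) (k (y, z) * (w z * g z)) = w y * iter_int j g y.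
  move=> ty; rewrite /iter_int -RintegralZl//.
    by apply: eq_Rintegral => z _; rewrite /k/= -mulrA.
  rewrite (_ : EFin \o _ = EFin \o (fun z => (j`!%:R^-1) * ((W z - W y) ^+ j * (w z * g z)))).
    by apply: iZ => //; exact: lt_trans ty.
  by apply/funext => s; rewrite /=; congr EFin; ring.
move=> int_h Eh; split.
  apply: eq_integrable int_h => // y; rewrite inE/= in_itv/= andbT => ty.
  by rewrite /= hE.
rewrite [LHS](_ : _ = \int[leb]_(z in `]t, +oo[) (K z * (w z * g z)))// -Eh.
by apply: eq_Rintegral => y; rewrite inE/= in_itv/= andbT => ty; rewrite hE.
Qed.

Lemma is_derive_iter_int0 : iter_int_converges 0 g -> forall t : R, 0 < t ->
  is_derive t 1 (iter_int 0 g) (- (w t * g t)).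
Proof.
move=> cg.
have -> : iter_int 0 g = fun t => \int[leb]_(s in `]t, +oo[) (w s * g s).
  apply/funext => t; apply: eq_Rintegral => s _.
  by rewrite expr0 fact0 divr1 mul1r.
apply: is_derive_integral_oy => [x x0|t t0].
  by apply: cvgM; [exact: w_cont|exact: g_cont].
have := cg _ t0; congr (integrable _ _ _).
by apply/funext => s /=; rewrite expr0 mul1r.
Qed.

(** [iter_int j.+1] is the integral over a ray of [w] times [iter_int j]. Differentiating it needs
    continuity of [iter_int j], which is inherited from its differentiability, the induction
    hypothesis. *)
Lemma is_derive_iter_intS j : iter_int_converges j.+1 g -> forall t : R, 0 < t ->
  is_derive t 1 (iter_int j.+1 g) (- (w t * iter_int j g t)).
Proof.
elim: j => [|j ih] cg t t0; have cg' := iter_int_converges_pred cg.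
  have cT (x : R) : 0 < x -> {for x, continuous (iter_int 0 g)}.
    move=> x0; have [h _] := is_derive_iter_int0 cg' x0.
    exact/differentiable_continuous/derivable1_diffP.
  apply: (near_eq_is_derive _ (is_derive_integral_oy (h := fun y => w y * iter_int 0 g y) _ _ t0)).
  - near=> y; have [|_ ->//] := iter_int_step cg (t := y).
    by near: y; exact: lt_nbhsr.
  - by move=> x x0; apply: cvgM; [exact: w_cont|exact: cT].
  - by move=> x x0; have [] := iter_int_step cg x0.
have cT (x : R) : 0 < x -> {for x, continuous (iter_int j.+1 g)}.
  move=> x0; have [h _] := ih cg' _ x0.
  exact/differentiable_continuous/derivable1_diffP.
apply: (near_eq_is_derive _ (is_derive_integral_oy (h := fun y => w y * iter_int j.+1 g y) _ _ t0)).
- near=> y; have [|_ ->//] := iter_int_step cg (t := y).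
  by near: y; exact: lt_nbhsr.
- by move=> x x0; apply: cvgM; [exact: w_cont|exact: cT].
- by move=> x x0; have [] := iter_int_step cg x0.
Unshelve. all: end_near. Qed.

Lemma iter_opp_derive_weight j (F : R -> R) : iter_int_converges j g ->
  (forall t : R, 0 < t -> F t = iter_int j g t) ->
  iter_derivable opp_derive_weight j.+1 F /\
  forall t : R, 0 < t -> iter j.+1 opp_derive_weight F t = g t.
Proof.
have near_pos (t : R) (A B : R -> R) : 0 < t ->
    (forall t : R, 0 < t -> A t = B t) ->
    \near t, B t = A t.
  by move=> t0 AB; near=> y; rewrite AB//; near: y; exact: lt_nbhsr.
have LE (t : R) (A : R -> R) (a : R) : 0 < t -> is_derive t 1 A (- (w t * a)) ->
    opp_derive_weight A t = a.
  move=> t0 [h1 h2]; rewrite /opp_derive_weight derive1E h2 mulNr opprK mulrC mulKf//.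
  by rewrite gt_eqF// w_gt0.
elim: j F => [|j ih] F cg FE.
  have dF (t : R) : 0 < t -> is_derive t 1 F (- (w t * g t)).
    by move=> t0; apply: near_eq_is_derive (is_derive_iter_int0 cg t0); exact: near_pos.
  split=> [[|//] _ t t0/=|t t0]; first by have [] := dF _ t0.
  exact/LE/dF.
have dF (t : R) : 0 < t -> is_derive t 1 F (- (w t * iter_int j g t)).
  by move=> t0; apply: near_eq_is_derive (is_derive_iter_intS cg t0); exact: near_pos.
have [|h1 h2] := ih (opp_derive_weight F) (iter_int_converges_pred cg).
  by move=> t t0; apply: LE => //; exact: dF.
split=> [[_|i ij] t t0|t t0].
- by have [] := dF _ t0.
- by rewrite iterSr; apply: h1.
- by rewrite iterSr; apply: h2.
Unshelve. all: end_near. Qed.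

End IteratedIntegral.

(** * Gamma and Beta integrals *)

Section GammaBeta.
Context {R : realType}.
Local Notation leb := (@lebesgue_measure R).
Local Open Scope ereal_scope.

Lemma ge0_integral_shift_oy (f : R -> \bar R) (x : R) :
  measurable_fun [set: R] f -> (forall y, 0 <= f y) ->
  \int[leb]_(y in `]0%R, +oo[) f y = \int[leb]_(w in `]x, +oo[) f (w - x)%R.
Proof.
move=> mf f0; pose f' := f \_ `]0%R, +oo[.
have mf' : measurable_fun [set: R] f'.
  by apply/(measurable_restrictT _ _).1 => //; exact: measurable_funTS.
rewrite integral_mkcond -(ge0_integral_shift (- x)%R mf'); last first.
  by move=> y; apply: erestrict_ge0.
rewrite [RHS]integral_mkcond; apply: eq_integral => y _.
rewrite /f' !patchE; congr (if _ then _ else _).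
by rewrite !mem_setE !in_itv/= !andbT subr_gt0.
Qed.

Lemma integral_gt0_pos (D : set R) (f : R -> R) (a b : R) : (a < b)%R ->
  measurable D -> `]a, b[ `<=` D -> measurable_fun D f ->
  (forall x, D x -> (0 < f x)%R) -> 0 < \int[leb]_(x in D) (f x)%:E.
Proof.
move=> ab mD abD mf f0; rewrite lt0e; apply/andP; split; last first.
  by apply: integral_ge0 => x Dx; rewrite lee_fin ltW// f0.
apply/eqP => int0.
have : ae_eq leb D (EFin \o f) (cst 0).
  apply/(ae_eq_integral_abs leb mD); first exact/measurable_EFinP.
  rewrite -int0; apply: eq_integral => x; rewrite inE => Dx.
  by rewrite /= ger0_norm// ltW// f0.
move=> [N [mN N0 DN]].
have : leb `]a, b[ <= leb N.
  apply: le_measure; rewrite ?inE//.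
  move=> x /abD Dx; apply: DN => /= /(_ Dx) [fx0].
  by have := f0 _ Dx; rewrite fx0 ltxx.
by rewrite N0 lebesgue_measure_itv/= lte_fin ab -EFinD lee_fin subr_le0 leNgt ab.
Qed.

(* Defs.Gamma is 0 when its integral diverges; the extended-real versions keep
   track of convergence. *)
Definition GammaE (a : R) := \int[leb]_(x in `]0%R, +oo[) (x `^ (a - 1) * expR (- x))%:E.

Definition BetaE (a b : R) :=
  \int[leb]_(u in `]0%R, 1%R[) (u `^ (a - 1) * (1 - u) `^ (b - 1))%:E.

Let mpow (c : R) : measurable_fun [set: R] (fun x => x `^ c)%R.
Proof. exact: measurable_powR. Qed.

Let mexpN : measurable_fun [set: R] (fun x : R => expR (- x)).
Proof. by apply: measurableT_comp => //; exact: measurable_expR. Qed.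

Lemma GammaE_gt0 a : 0 < GammaE a.
Proof.
apply: (@integral_gt0_pos _ _ 0%R 1%R) => //.
- by apply: subset_itvl; rewrite bnd_simp.
- by apply: measurable_funTS; exact: measurable_funM.
- by move=> x /=; rewrite in_itv/= andbT => x0; rewrite mulr_gt0 ?powR_gt0 ?expR_gt0.
Qed.

Let mbeta (a b w : R) :
  measurable_fun [set: R] (fun u => u `^ (a - 1) * (w - u) `^ (b - 1))%R.
Proof.
apply: measurable_funM; first exact: mpow.
have mB : measurable_fun [set: R] (fun u : R => w - u)%R.
  by apply: measurable_funB; [exact: measurable_cst|exact: measurable_id].
exact: (measurableT_comp (mpow (b - 1)%R) mB).
Qed.

Lemma BetaE_gt0 a b : 0 < BetaE a b.
Proof.
apply: (@integral_gt0_pos _ _ 0%R 1%R) => //.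
- by apply: measurable_funTS; exact: mbeta.
- move=> x /=; rewrite in_itv/= => /andP[x0 x1].
  by rewrite mulr_gt0 ?powR_gt0// subr_gt0.
Qed.

Lemma powR_cont (c x : R) : (0 < x)%R -> {for x, continuous (fun x => x `^ c)%R}.
Proof.
by move=> x0; apply/differentiable_continuous/derivable1_diffP; have [] := is_derive1_powR c x0.
Qed.

Lemma BetaE_scale (a b w : R) : (0 < w)%R ->
  \int[leb]_(x in `]0%R, w[) (x `^ (a - 1) * (w - x) `^ (b - 1))%:E =
  (w `^ (a + b - 1))%:E * BetaE a b.
Proof.
move=> w0; pose phi (u : R) := (w * u)%R.
have phi0 : phi 0%R = 0%R by rewrite /phi mulr0.
have phi1 : phi 1%R = w by rewrite /phi mulr1.
have wE : (w `^ (a + b - 1) = w `^ (a - 1) * w `^ (b - 1) * w)%R.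
  rewrite -[X in (_ * X)%R](powRr1 (ltW w0)) -!powRD ?(gt_eqF w0) ?implybT//.
  by congr (_ `^ _)%R; ring.
have der (x : R) : x \in `[0%R, 1%R] -> is_derive x 1%R phi (cst w x).
  move=> _; rewrite (_ : phi = w \*: id)%R//; apply: is_derive_eq.
  by rewrite /GRing.scale/= mulr1.
have := @ge0_integral_subst_oo R phi (cst w) (fun x => x `^ (a - 1) * (w - x) `^ (b - 1))%R 0%R 1%R ltr01 der.
rewrite phi0 phi1 => ->.
- rewrite /BetaE -ge0_integralZl//; last 3 first.
  + by apply/measurable_EFinP; apply: measurable_funTS; exact: mbeta.
  + by move=> x _; rewrite lee_fin mulr_ge0// powR_ge0.
  + by rewrite lee_fin powR_ge0.
  apply: eq_integral => u; rewrite inE/= in_itv/= => /andP[u0 u1].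
  rewrite -EFinM /phi; congr EFin => /=.
  rewrite -{2}(mulr1 w) -mulrBr !powRM ?(ltW w0, ltW u0)//; last by rewrite subr_ge0 ltW.
  rewrite wE; ring.
- by move=> x _; exact: cst_continuous.
- by [].
- move=> y; rewrite in_itv/= => /andP[y0 yw]; apply: cvgM; first exact: powR_cont.
  apply: (@continuous_comp _ _ _ (fun y => w - y)%R (fun u : R => u `^ (b - 1))%R).
    by apply: cvgB; [exact: cvg_cst|exact: cvg_id].
  by apply: powR_cont; rewrite subr_gt0.
- by move=> y _; rewrite mulr_ge0// powR_ge0.
Qed.

(** Tonelli for [x^(a-1) (y - x)^(b-1) e^(-y)] on [0 < x < y]. In the extended reals this holds for
    all [a] and [b], so that finiteness can afterwards be read off from it. *)
Lemma GammaE_BetaE a b : GammaE a * GammaE b = GammaE (a + b) * BetaE a b.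
Proof.
pose k (p : R * R) := (p.1 `^ (a - 1) * (p.2 - p.1) `^ (b - 1) * expR (- p.2))%:E.
pose D := @triangle R 0%R.
have mk : measurable_fun D k.
  apply: measurable_funTS; apply/measurable_EFinP; apply: measurable_funM.
    apply: measurable_funM.
      exact: (measurableT_comp (mpow (a - 1)%R) measurable_fst).
    have mB : measurable_fun setT (fun p : measurableTypeR R * measurableTypeR R => p.2 - p.1)%R.
      by apply: measurable_funB; [exact: measurable_snd|exact: measurable_fst].
    exact: (measurableT_comp (mpow (b - 1)%R) mB).
  exact: (measurableT_comp mexpN measurable_snd).
have := tonelli_on (measurable_triangle 0%R) mk.
have k0 p : 0 <= k p by rewrite lee_fin !mulr_ge0 ?powR_ge0 ?expR_ge0.
move=> /(_ (fun p _ => k0 p)).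
have toD (u v : R -> \bar R) : (forall z, (0 < z)%R -> u z = v z) ->
    (forall z, ~ (0 < z)%R -> u z = 0) -> \int[leb]_z u z = \int[leb]_(z in `]0%R, +oo[) v z.
  move=> uv u0; rewrite [RHS]integral_mkcond; apply: eq_integral => z _.
  rewrite patchE; case: ifPn => [|/negP]; rewrite inE/= in_itv/= andbT => tz.
    exact: uv.
  exact: u0.
have Dx x : (0 < x)%R -> [set y | D (x, y)] = `]x, +oo[%classic.
  move=> tx; apply/seteqP; split=> y; rewrite /D /triangle /= in_itv/= andbT //.
  by case.
have Dx0 x : ~ (0 < x)%R -> [set y | D (x, y)] = set0.
  by move=> tx; apply/seteqP; split=> // y [].
have Dy y : (0 < y)%R -> [set x | D (x, y)] = `]0%R, y[%classic.
  move=> ty; apply/seteqP; split=> x; rewrite /D /triangle /= in_itv/=.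
    by case=> -> ->.
  by case/andP.
have Dy0 y : ~ (0 < y)%R -> [set x | D (x, y)] = set0.
  by move=> ty; apply/seteqP; split=> // x [] /= h1 h2; exact: ty (lt_trans h1 h2).
rewrite (toD _ (fun x => (x `^ (a - 1) * expR (- x))%:E * GammaE b)); last 2 first.
- move=> x x0; rewrite Dx// /GammaE.
  have mf : measurable_fun [set: R] (fun y : R => (y `^ (b - 1) * expR (- y))%:E).
    by apply/measurable_EFinP; apply: measurable_funM; [exact: mpow|exact: mexpN].
  rewrite (ge0_integral_shift_oy x mf); last first.
    by move=> y; rewrite lee_fin mulr_ge0 ?powR_ge0 ?expR_ge0.
  rewrite -ge0_integralZl//.
  + apply: eq_integral => y _; rewrite /k/= -EFinM; congr EFin.
    have -> : expR (- y) = (expR (- x) * expR (- (y - x)))%R.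
      by rewrite -expRD; congr expR; ring.
    by ring.
  + have mB : measurable_fun `]x, +oo[ (fun y : R => y - x)%R.
      by apply: measurable_funTS; apply: measurable_funB; [exact: measurable_id|exact: measurable_cst].
    exact: (measurableT_comp mf mB).
  + by move=> y _; rewrite lee_fin mulr_ge0 ?powR_ge0 ?expR_ge0.
  + by rewrite lee_fin mulr_ge0 ?powR_ge0 ?expR_ge0.
- by move=> x x0; rewrite Dx0// integral_set0.
rewrite (toD _ (fun y => (y `^ (a + b - 1) * expR (- y))%:E * BetaE a b)); last 2 first.
- move=> y y0; rewrite Dy//.
  rewrite EFinM -muleA [X in _ * X]muleC muleA -BetaE_scale// muleC -ge0_integralZl//.
  + by apply: eq_integral => x _; rewrite -EFinM /k/= mulrC.
  + by apply/measurable_EFinP; apply: measurable_funTS; exact: mbeta.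
  + by move=> x _; rewrite lee_fin mulr_ge0// powR_ge0.
- by move=> x x0; rewrite Dy0// integral_set0.
have ZZ (c : R) (B : \bar R) : 0 <= B ->
    \int[leb]_(x in `]0%R, +oo[) ((x `^ (c - 1) * expR (- x))%:E * B) = GammaE c * B.
  move=> B0; rewrite ge0_integralZr//.
    by apply/measurable_EFinP; apply: measurable_funTS; apply: measurable_funM; [exact: mpow|exact: mexpN].
  by move=> x _; rewrite lee_fin mulr_ge0 ?powR_ge0 ?expR_ge0.
by rewrite !ZZ// ltW ?GammaE_gt0 ?BetaE_gt0.
Qed.

Lemma GammaE1 : GammaE 1 = 1.
Proof.
have -> : GammaE 1 = \int[leb]_(x in `]0%R, +oo[) (expR (- x))%:E.
  by apply: eq_integral => x _; rewrite subrr powRr0 mul1r.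
rewrite integral_itv_obnd_cbnd; last by apply/measurable_EFinP; exact: measurable_funTS.
pose P (x : R) := (- expR (- x))%R.
have PE : P = (- (expR \o -%R))%R by apply/funext => x; rewrite /P !fctE.
have der (x : R) : is_derive x 1%R P (expR (- x)).
  by rewrite PE; apply: is_derive_eq; rewrite mulrN1 opprK.
have cP : continuous P.
  by move=> x; have [h _] := der x; apply/differentiable_continuous/derivable1_diffP.
rewrite (@ge0_continuous_FTC2y R (fun x : R => expR (- x)) P 0%R 0%R).
- by rewrite /P oppr0 expR0 -EFinB sub0r opprK.
- by move=> x _; exact: expR_ge0.
- apply: continuous_subspaceT => x.
  apply: (@continuous_comp _ _ _ -%R expR); first exact: opp_continuous.
  exact: continuous_expR.
- by rewrite -oppr0; apply: cvgN; exact: cvgr_expR.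
- by move=> x _; have [] := der x.
- by apply: cvg_at_right_filter; exact: cP.
- by move=> x _; rewrite derive1E derive_val.
Qed.

(** The substitution [x = y^2] turns this into the Gaussian integral over a half-line. *)
Lemma GammaE_half : GammaE 2^-1 = (Num.sqrt pi)%:E.
Proof.
pose g (x : R) := (x `^ (2^-1 - 1) * expR (- x))%R.
have der (x : R) : x \in `[0%R, +oo[ -> is_derive x 1%R (fun y => y ^+ 2)%R (x *+ 2)%R.
  move=> _; rewrite (_ : (fun y => y ^+ 2)%R = id ^+ 2)%R//; apply: is_derive_eq.
  by rewrite expr1 /GRing.scale/= mulr1 mulr_natl.
have := @ge0_integral_subst_oy R (fun y => y ^+ 2)%R (fun y => y *+ 2)%R g 0%R der.
rewrite expr0n/= -[GammaE _]/(\int[leb]_(y in `]0%R, +oo[) (g y)%:E) => ->.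
- transitivity (\int[leb]_(y in `]0%R, +oo[) (2%:E * (gauss_fun y)%:E)).
    apply: eq_integral => y; rewrite inE/= in_itv/= andbT => y0.
    rewrite /g -EFinM /gauss_fun; congr EFin.
    rewrite (_ : 2^-1 - 1 = - 2^-1)%R; last by field.
    rewrite powRN powR12_sqrt ?sqr_ge0// sqrtr_sqr gtr0_norm// -mulr_natl.
    by field; rewrite gt_eqF.
  rewrite ge0_integralZl//; last 2 first.
  + by apply/measurable_EFinP; apply: measurable_funTS; exact: measurable_gauss_fun.
  + by move=> x _; rewrite lee_fin gauss_fun_ge0.
  rewrite integral_itv_obnd_cbnd; last first.
    by apply/measurable_EFinP; apply: measurable_funTS; exact: measurable_gauss_fun.
  by rewrite integral0y_gauss -EFinM mulrCA divff// mulr1.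
- by move=> x _; apply: cvgMn; exact: cvg_id.
- by move=> x; rewrite in_itv/= andbT => x0; rewrite mulrn_wgt0.
- move=> M; exists (`|M| + 1)%R; first by rewrite ltr_wpDl.
  have := ler_norm M; have := normr_ge0 M; nra.
- move=> y; rewrite in_itv/= andbT => y0; apply: cvgM; first exact: powR_cont.
  apply: (@continuous_comp _ _ _ -%R expR); first exact: opp_continuous.
  exact: continuous_expR.
- by move=> y _; rewrite mulr_ge0 ?powR_ge0 ?expR_ge0.
Qed.

Lemma BetaEn1 m : BetaE m.+1%:R 1 = (m.+1%:R^-1)%:E.
Proof.
have -> : BetaE m.+1%:R 1 = \int[leb]_(x in `]0%R, 1%R[) (x ^+ m)%:E.
  apply: eq_integral => x; rewrite inE/= in_itv/= => /andP[x0 x1].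
  rewrite subrr powRr0 mulr1 -natr1 addrK powR_mulrn//; exact: ltW.
pose P (x : R) := (m.+1%:R^-1 * x ^+ m.+1)%R.
have der (y : R) : is_derive y 1%R P (y ^+ m)%R.
  rewrite (_ : P = m.+1%:R^-1 \*: (id ^+ m.+1))%R; last first.
    by apply/funext => x; rewrite /P !fctE.
  apply: is_derive_eq.
  by rewrite /GRing.scale/= mulr1 mulrA mulVf// mul1r.
rewrite (integral_oo_FTC ltr01 der); last exact: exprn_continuous.
by rewrite /P expr1n expr0n/= mulr0 subr0 mulr1.
Qed.

Definition Gamma_convergent (a : R) := GammaE a = (Gamma a)%:E /\ (0 < Gamma a)%R.

Lemma Gamma_convergentP a : GammaE a < +oo -> Gamma_convergent a.
Proof.
move=> h; have e : GammaE a = (Gamma a)%:E.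
  by rewrite [Gamma a]/(fine (GammaE a)) fineK// ge0_fin_numE// ltW// GammaE_gt0.
by split => //; rewrite -lte_fin -e GammaE_gt0.
Qed.

(** [GammaE (a + b) * BetaE a b] is a product of two positive factors equal to a finite number, so
    neither factor is infinite. Starting from [1/2], this gives convergence at all positive
    half-integers without estimating any integral. *)
Lemma Gamma_convergentD a b : Gamma_convergent a -> Gamma_convergent b ->
  Gamma_convergent (a + b) /\ BetaE a b = (Gamma a * Gamma b / Gamma (a + b))%:E.
Proof.
move=> [ea a0] [eb b0]; have := GammaE_BetaE a b.
rewrite ea eb -EFinM.
have G0 := GammaE_gt0 (a + b); have B0 := BetaE_gt0 a b.
have ok : Gamma_convergent (a + b) -> (Gamma a * Gamma b)%:E = GammaE (a + b) * BetaE a b ->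
    BetaE a b = (Gamma a * Gamma b / Gamma (a + b))%:E.
  move=> [-> g0]; case: (BetaE a b) B0 => [r r0|_|//].
    by move=> [e]; congr EFin; rewrite e mulrAC divff ?mul1r// gt_eqF.
  by rewrite gt0_muley.
move=> h; suff hh : Gamma_convergent (a + b) by split=> //; exact: ok.
apply: Gamma_convergentP; case: (GammaE (a + b)) G0 h => [r _ _|_|//]; first exact: ltry.
by rewrite gt0_mulye.
Qed.

Lemma Gamma_convergent_half k : Gamma_convergent (k.+1%:R / 2).
Proof.
have h : Gamma_convergent (2^-1) by apply: Gamma_convergentP; rewrite GammaE_half ltry.
elim: k => [|k ih]; first by rewrite mul1r.
by rewrite -natr1 mulrDl mul1r; apply: (Gamma_convergentD ih h).1.
Qed.

(** The recursion comes from [B(m+1, 1) = 1/(m+1)] and the relation between Gamma and Beta, in place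
    of an integration by parts. *)
Lemma Gamma_nat m : Gamma m.+1%:R = m`!%:R :> R.
Proof.
have ok i : Gamma_convergent i.+1%:R.
  rewrite (_ : i.+1%:R = (i.*2.+1).+1%:R / 2)%R; last first.
    by rewrite -doubleS -mul2n natrM; field.
  exact: Gamma_convergent_half.
elim: m => [|m ih]; first by have [+ _] := ok 0%N; rewrite GammaE1 => -[].
have [_] := Gamma_convergentD (ok m) (ok 0%N).
rewrite BetaEn1 natr1; have := (ok 0%N).1; rewrite GammaE1 => -[<-].
rewrite mulr1 ih => -[e]; have [_ g0] := ok m.+1.
rewrite factS natrM; move: e g0; have : m.+1%:R != 0%R :> R by [].
move: (m.+1%:R : R)%R (Gamma _) (m`!%:R : R)%R => A G B A0 e G0.
by rewrite -[LHS]mul1r -(mulfV A0) e; field; rewrite gt_eqF.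
Qed.

End GammaBeta.

(** * Kernels of composed Erdelyi-Kober integrals *)

Section Kernels.
Context {R : realType}.
Local Notation leb := (@lebesgue_measure R).
Implicit Types (t s y u a b p : R).

Lemma powR_expR (x r : R) : 0 < x -> x `^ r = expR (r * ln x).
Proof. by move=> x0; rewrite /powR gt_eqF. Qed.

(** The kernel of [I^b y^(-p) I^a] up to the Gamma factors, with [q = (y, s)] and [y] the
    intermediate variable. The power [1 - p] combines the weight with the [y] of [y dy]; the factor
    [s] of [s ds] stays with [G]. *)
Definition EK_kernel (a b p t : R) (q : R * R) : R :=
  (q.1 ^+ 2 - t ^+ 2) `^ (b - 1) * q.1 `^ (1 - p) * (q.2 ^+ 2 - q.1 ^+ 2) `^ (a - 1).

Lemma measurable_EK_kernel (a b p t : R) :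
  measurable_fun setT (EK_kernel a b p t : measurableTypeR R * measurableTypeR R -> R).
Proof.
have mpow (c : R) (f : measurableTypeR R * measurableTypeR R -> R) :
    measurable_fun setT f -> measurable_fun setT (fun q => f q `^ c).
  by move=> mf; exact: (measurableT_comp (@measurable_powR R c) mf).
have m1 : measurable_fun setT (fst : measurableTypeR R * measurableTypeR R -> R) by exact: measurable_fst.
have m2 : measurable_fun setT (snd : measurableTypeR R * measurableTypeR R -> R) by exact: measurable_snd.
apply: measurable_funM; [apply: measurable_funM|]; apply: mpow => //.
- by apply: measurable_funB; [exact: measurable_funX|exact: measurable_cst].
- by apply: measurable_funB; exact: measurable_funX.
Qed.

Lemma measurable_EK_kernel1 (a b p t s : R) (D : set R) : measurable D ->
  measurable_fun D (fun y : R => EK_kernel a b p t (y, s)).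
Proof.
move=> mD; apply: measurable_funTS.
exact: (measurableT_comp (measurable_EK_kernel a b p t) (pair2_measurable s)).
Qed.

Lemma EK_kernel_ge0 a b p t q : 0 <= EK_kernel a b p t q.
Proof. by rewrite !mulr_ge0 ?powR_ge0. Qed.

(** The evaluations of kernels below reduce through this to a pointwise identity between the kernel
    and the pullback of a Beta integrand under an increasing map of [[t, s]] onto [[0, 1]]. *)
Lemma BetaE_subst (phi dphi k : R -> R) (a b t s c : R) : t < s -> 0 < c ->
  (forall y, y \in `[t, s] -> is_derive y 1 phi (dphi y)) ->
  (forall y, y \in `]t, s[ -> {for y, continuous dphi}) ->
  (forall y, y \in `]t, s[ -> 0 < dphi y) ->
  phi t = 0 -> phi s = 1 ->
  measurable_fun `]t, s[ k ->
  (forall y, t < y -> y < s ->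
    k y = c * (phi y `^ (b - 1) * (1 - phi y) `^ (a - 1) * dphi y)) ->
  (\int[leb]_(y in `]t, s[) (k y)%:E = c%:E * BetaE b a)%E.
Proof.
move=> ts c0 dphiE cdphi dphi0 pt ps mk kE.
have := @ge0_integral_subst_oo R phi dphi (fun u => u `^ (b - 1) * (1 - u) `^ (a - 1)) t s ts dphiE cdphi dphi0.
rewrite pt ps -/(BetaE b a) => ->.
- have k0 y : y \in `]t, s[ -> 0 <= k y.
    move=> /[dup] /dphi0 d0; rewrite in_itv/= => /andP[ty ys].
    by rewrite kE// !mulr_ge0 ?powR_ge0 ?(ltW c0) ?(ltW d0).
  transitivity (\int[leb]_(y in `]t, s[) (c%:E * (c^-1 * k y)%:E))%E.
    by apply: eq_integral => y _; rewrite -EFinM mulrA mulfV ?gt_eqF// mul1r.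
  rewrite ge0_integralZl//.
  + congr (_ * _)%E; apply: eq_integral => y; rewrite inE/= in_itv/= => /andP[ty ys].
    by rewrite kE// mulKf ?gt_eqF.
  + by apply/measurable_EFinP; apply: measurable_funM => //; exact: measurable_cst.
  + by move=> y /k0 ky; rewrite lee_fin mulr_ge0// invr_ge0 ltW.
  + by rewrite lee_fin ltW.
- move=> y; rewrite in_itv/= => /andP[y0 y1].
  apply: cvgM; first exact: powR_cont.
  apply: (@continuous_comp _ _ _ (fun y => 1 - y) (fun u : R => u `^ (a - 1))).
    by apply: cvgB; [exact: cvg_cst|exact: cvg_id].
  by apply: powR_cont; rewrite subr_gt0.
- by move=> y _; rewrite mulr_ge0// powR_ge0.
Qed.

Lemma EK_kernel_integral0 (a b t s : R) : 0 < t -> t < s ->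
  (\int[leb]_(y in `]t, s[) (EK_kernel a b 0 t (y, s))%:E =
   (2^-1 * (s ^+ 2 - t ^+ 2) `^ (a + b - 1))%:E * BetaE b a)%E.
Proof.
move=> t0 ts.
have d0 : 0 < s ^+ 2 - t ^+ 2 by nra.
pose c := (s ^+ 2 - t ^+ 2)^-1.
pose phi (y : R) := c * (y ^+ 2 - t ^+ 2).
pose dphi (y : R) := c * (2 * y).
have c0 : 0 < c by rewrite invr_gt0.
have der (y : R) : y \in `[t, s] -> is_derive y 1 phi (dphi y).
  move=> _; rewrite (_ : phi = c \*: ((id ^+ 2) - cst (t ^+ 2)))//.
  apply: is_derive_eq.
  by rewrite /dphi /GRing.scale/= subr0 expr1 mulr1.
apply: (BetaE_subst ts _ der).
- by rewrite mulr_gt0// powR_gt0.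
- by move=> y _; apply: cvgM; [exact: cvg_cst|apply: cvgM; [exact: cvg_cst|exact: cvg_id]].
- move=> y; rewrite in_itv/= => /andP[ty _].
  by rewrite /dphi !mulr_gt0// (lt_trans t0).
- by rewrite /phi subrr mulr0.
- by rewrite /phi mulVf// gt_eqF.
- exact: measurable_EK_kernel1.
move=> y ty ys.
have y0 : 0 < y by exact: lt_trans ty.
have e1 : 0 < y ^+ 2 - t ^+ 2 by nra.
have e2 : 0 < s ^+ 2 - y ^+ 2 by nra.
have -> : 1 - phi y = c * (s ^+ 2 - y ^+ 2).
  by rewrite /phi /c; field; rewrite gt_eqF.
rewrite /EK_kernel /= subr0 powRr1 ?(ltW y0)//.
(* Real powers are written as exponentials of logarithms; once the exponents are collected, the
   identity is polynomial in the logarithms and [ring] decides it. The other kernels are treated in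
   the same way. *)
rewrite /phi /dphi !powR_expR ?mulr_gt0//.
rewrite !lnM ?posrE//.
have -> : ln (s ^+ 2 - t ^+ 2) = - ln c by rewrite lnV ?posrE// opprK.
rewrite -[in c * (2 * y)](@lnK _ c) ?posrE//; move: (ln c) => L.
set A := ln _; set B := ln _.
have -> : expR ((b - 1) * A) * y * expR ((a - 1) * B) =
  (expR ((a + b - 1) * - L) * expR ((b - 1) * (L + A)) * expR ((a - 1) * (L + B)) * expR L) * y.
  by rewrite -!expRD mulrAC -expRD; congr (expR _ * _); ring.
by field.
Qed.

(* u = s^2 (y^2 - t^2) / (y^2 (s^2 - t^2)) turns this into a Beta integral. *)
Lemma EK_kernel_integral1 (a b t s : R) : 0 < t -> t < s ->
  (\int[leb]_(y in `]t, s[) (EK_kernel a b (2 * (a + b)) t (y, s))%:E =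
   (2^-1 * (s ^+ 2 - t ^+ 2) `^ (a + b - 1) * t `^ (- 2 * a) * s `^ (- 2 * b))%:E * BetaE b a)%E.
Proof.
move=> t0 ts; have s0 : 0 < s by exact: lt_trans ts.
have d0 : 0 < s ^+ 2 - t ^+ 2 by nra.
pose c := (s ^+ 2 - t ^+ 2)^-1.
pose phi (y : R) := c * s ^+ 2 * (1 - t ^+ 2 * y ^- 2).
pose dphi (y : R) := c * s ^+ 2 * t ^+ 2 * (2 * y ^- 3).
have c0 : 0 < c by rewrite invr_gt0.
have der (y : R) : y \in `[t, s] -> is_derive y 1 phi (dphi y).
  rewrite in_itv/= => /andP[ty _].
  have y0 : 0 < y by exact: lt_le_trans ty.
  have dV : is_derive y 1 (fun y : R => y^-1) (- y ^- 2).
    have h := @is_deriveV R id y 1 1 (lt0r_neq0 y0) (is_derive_id _ _).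
    by apply: is_derive_eq; rewrite /GRing.scale/= mulr1.
  rewrite (_ : phi = (c * s ^+ 2) \*: (cst 1 - t ^+ 2 \*: ((fun y : R => y^-1) ^+ 2))); last first.
    by apply/funext => x; rewrite /phi !fctE /= exprVn.
  apply: is_derive_eq.
  rewrite /dphi /GRing.scale/= sub0r expr1 -!exprVn.
  by ring.
apply: (BetaE_subst ts _ der).
- by rewrite !mulr_gt0// powR_gt0.
- move=> y; rewrite in_itv/= => /andP[ty _].
  apply: cvgM; first exact: cvg_cst.
  apply: cvgM; first exact: cvg_cst.
  apply: cvgV; first by rewrite expf_neq0// gt_eqF// (lt_trans t0).
  exact: exprn_continuous.
- move=> y; rewrite in_itv/= => /andP[ty _].
  by rewrite /dphi !mulr_gt0 ?invr_gt0 ?exprn_gt0// (lt_trans t0).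
- by rewrite /phi mulfV ?subrr ?mulr0// gt_eqF// exprn_gt0.
- by rewrite /phi /c; field; rewrite !gt_eqF.
- exact: measurable_EK_kernel1.
move=> y ty ys.
have y0 : 0 < y by exact: lt_trans ty.
have e1 : 0 < y ^+ 2 - t ^+ 2 by nra.
have e2 : 0 < s ^+ 2 - y ^+ 2 by nra.
have -> : 1 - phi y = c * (t ^+ 2 * (y ^- 2 * (s ^+ 2 - y ^+ 2))).
  by rewrite /phi /c; field; rewrite !gt_eqF.
have -> : phi y = c * (s ^+ 2 * (y ^- 2 * (y ^+ 2 - t ^+ 2))).
  by rewrite /phi /c; field; rewrite !gt_eqF.
(* The weight [p = 2(a + b)] is forced here: [phi], [1 - phi] and [dphi] contribute [y] to the power
   [-2(b-1) - 2(a-1) - 3], which is [1 - p]. *)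
rewrite /EK_kernel /= /dphi.
have -> : c * s ^+ 2 * t ^+ 2 * (2 * y ^- 3) =
    2 * expR (ln c + (ln s + ln s) + (ln t + ln t) - (ln y + ln y + ln y)).
  by rewrite !expRD expRN !expRD !lnK ?posrE//; field; rewrite gt_eqF.
rewrite !powR_expR ?mulr_gt0 ?invr_gt0 ?exprn_gt0//.
rewrite !lnM ?posrE ?mulr_gt0 ?invr_gt0 ?exprn_gt0//.
rewrite !lnV ?posrE ?exprn_gt0// !lnXn// ?posrE//.
have -> : ln (s ^+ 2 - t ^+ 2) = - ln c by rewrite lnV ?posrE// opprK.
move: (ln c) (ln s) (ln t) (ln y) => L S T Y.
set A := ln _; set B := ln _; rewrite !mulr2n.
have halves (x1 x2 x3 x4 x5 x6 : R) : 2^-1 * x1 * x2 * x3 * (x4 * x5 * (2 * x6)) = x1 * x2 * x3 * x4 * x5 * x6.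
  by field.
rewrite halves.
by rewrite -!expRD; congr expR; ring.
Qed.

(* Invariance under y -> t s / y. *)
Lemma ge0_integral_EK_kernel_symm (a t s : R) : 0 < t -> t < s ->
  (\int[leb]_(y in `]t, s[) (EK_kernel a a (2 * a + 1) t (y, s) * y ^+ 2)%:E =
   (t * s)%:E * \int[leb]_(y in `]t, s[) (EK_kernel a a (2 * a + 1) t (y, s))%:E)%E.
Proof.
move=> t0 ts; have s0 : 0 < s by exact: lt_trans ts.
pose h (y : R) := EK_kernel a a (2 * a + 1) t (y, s).
have mh2 : measurable_fun `]t, s[ (EFin \o (fun y => h y * y ^+ 2)).
  apply/measurable_EFinP; apply: measurable_funM; first exact: measurable_EK_kernel1.
  by apply: measurable_funTS; exact: measurable_funX.
have h0 y : 0 <= h y by exact: EK_kernel_ge0.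
(* The map [y -> t s / y] is decreasing; a reflection first makes the substitution increasing. *)
rewrite (@ge0_integral_opp _ (fun y => (h y * y ^+ 2)%:E))//; last first.
  by move=> x _; rewrite lee_fin mulr_ge0// sqr_ge0.
rewrite (_ : [set x | `]t, s[%classic (- x)] = `](- s), (- t)[%classic); last first.
  by apply/seteqP; split=> x; rewrite /= !in_itv/= => /andP[? ?]; apply/andP; split; lra.
pose phi (v : R) := - (t * s) * v^-1.
pose dphi (v : R) := t * s * (v^-1 * v^-1).
have der (y : R) : y \in `[t, s] -> is_derive y 1 phi (dphi y).
  rewrite in_itv/= => /andP[ty _].
  have y0 : 0 < y by exact: lt_le_trans ty.
  have hV := @is_deriveV R id y 1 1 (lt0r_neq0 y0) (is_derive_id _ _).
  rewrite (_ : phi = (- (t * s)) \*: (fun y : R => y^-1))//.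
  apply: is_derive_eq; rewrite /dphi /GRing.scale/= mulr1 -exprVn expr2; ring.
have cV (y : R) : t < y -> {for y, continuous (fun y : R => y^-1)}.
  by move=> ty; apply: cvgV; [rewrite gt_eqF// (lt_trans t0)|exact: cvg_id].
have cdphi (y : R) : y \in `]t, s[ -> {for y, continuous dphi}.
  rewrite in_itv/= => /andP[ty _].
  by apply: cvgM; [exact: cvg_cst|apply: cvgM; exact: cV].
have dphi0 (y : R) : y \in `]t, s[ -> 0 < dphi y.
  rewrite in_itv/= => /andP[ty _].
  have y0 : 0 < y by exact: lt_trans ty.
  by rewrite /dphi !mulr_gt0 ?invr_gt0.
have := @ge0_integral_subst_oo R phi dphi (fun y => h (- y) * (- y) ^+ 2) t s ts der cdphi dphi0.
have -> : phi t = - s by rewrite /phi; field; rewrite gt_eqF.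
have -> : phi s = - t by rewrite /phi; field; rewrite gt_eqF.
move=> ->.
- rewrite -ge0_integralZl//; last 3 first.
  + by apply/measurable_EFinP; exact: measurable_EK_kernel1.
  + by move=> y _; rewrite lee_fin EK_kernel_ge0.
  + by rewrite lee_fin mulr_ge0// ltW.
  apply: eq_integral => y; rewrite inE/= in_itv/= => /andP[ty ys].
  have y0 : 0 < y by exact: lt_trans ty.
  have e1 : 0 < y ^+ 2 - t ^+ 2 by nra.
  have e2 : 0 < s ^+ 2 - y ^+ 2 by nra.
  rewrite -EFinM; congr EFin; rewrite /h /EK_kernel /= /dphi /phi.
  have -> : (- (- (t * s) / y)) ^+ 2 - t ^+ 2 = t ^+ 2 * (y ^- 2 * (s ^+ 2 - y ^+ 2)).
    by field; rewrite gt_eqF.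
  have -> : s ^+ 2 - (- (- (t * s) / y)) ^+ 2 = s ^+ 2 * (y ^- 2 * (y ^+ 2 - t ^+ 2)).
    by field; rewrite gt_eqF.
  have -> : - (- (t * s) / y) = t * (s * y^-1) by field; rewrite gt_eqF.
  rewrite -mulrA.
  have -> : (t * (s / y)) ^+ 2 * (t * s * (y^-1 * y^-1)) =
    t * s * expR ((ln t + ln t) + (ln s + ln s) - (ln y + ln y + ln y + ln y)).
    by rewrite !expRD expRN !expRD !lnK ?posrE//; field; rewrite gt_eqF.
  rewrite !powR_expR ?mulr_gt0 ?invr_gt0 ?exprn_gt0//.
  rewrite !lnM ?posrE ?mulr_gt0 ?invr_gt0 ?exprn_gt0//.
  rewrite !lnV ?posrE ?exprn_gt0// !lnXn// ?posrE//.
  move: (ln s) (ln t) (ln y) => S T Y.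
  set A := ln _; set B := ln _; rewrite !mulr2n.
  rewrite mulrCA; congr (_ * _).
  by rewrite -!expRD; congr expR; ring.
- move=> y; rewrite in_itv/= => /andP[sy yt].
  have cN : {for y, continuous (fun y : R => - y)} by exact: opp_continuous.
  apply: cvgM; last first.
    apply: (@continuous_comp _ _ _ (fun y : R => - y) (fun y : R => y ^+ 2)) => //.
    exact: exprn_continuous.
  apply: (@continuous_comp _ _ _ (fun y : R => - y) h) => //.
  have y0 : 0 < - y by lra.
  have cpow (f : R -> R) (z c : R) : {for z, continuous f} -> 0 < f z ->
      {for z, continuous (fun z => f z `^ c)}.
    move=> cf fz; apply: (@continuous_comp _ _ _ f (fun u : R => u `^ c)) => //.
    exact: powR_cont.
  have h1 := cpow (fun z => z ^+ 2 - t ^+ 2) (- y) (a - 1)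
    (cvgB (@exprn_continuous R 2 (- y)) (cvg_cst _)).
  have h2 := cpow id (- y) (1 - (2 * a + 1)) cvg_id y0.
  have h3 := cpow (fun z => s ^+ 2 - z ^+ 2) (- y) (a - 1)
    (cvgB (cvg_cst _) (@exprn_continuous R 2 (- y))).
  have {}h1 : {for - y, continuous (fun z : R => (z ^+ 2 - t ^+ 2) `^ (a - 1))} by apply: h1 => /=; nra.
  have {}h3 : {for - y, continuous (fun z : R => (s ^+ 2 - z ^+ 2) `^ (a - 1))} by apply: h3 => /=; nra.
  by apply: cvgM; [apply: cvgM; [exact: h1|exact: h2]|exact: h3].
- by move=> y _; rewrite mulr_ge0// sqr_ge0.
Qed.

(* With w = y - t s / y one has (y^2 - t^2) (s^2 - y^2) / y^2 = (s - t)^2 - w^2;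
   the factor 1 + t s / y^2 of dw is produced by the symmetry y -> t s / y. *)
Lemma EK_kernel_integral_self (a t s : R) : 0 < t -> t < s ->
  (\int[leb]_(y in `]t, s[) (EK_kernel a a (2 * a + 1) t (y, s))%:E =
   ((2 * t * s)^-1 * (2 * (s - t)) `^ (2 * a - 1))%:E * BetaE a a)%E.
Proof.
move=> t0 ts; have s0 : 0 < s by exact: lt_trans ts.
have d0 : 0 < s - t by lra.
pose h (y : R) := EK_kernel a a (2 * a + 1) t (y, s).
pose c := (2 * (s - t))^-1.
have d20 : 0 < 2 * (s - t) by rewrite mulr_gt0.
have c0 : 0 < c by rewrite invr_gt0.
have mh : measurable_fun `]t, s[ h by exact: measurable_EK_kernel1.
have mh2 : measurable_fun `]t, s[ (fun y => h y * y ^+ 2).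
  by apply: measurable_funM => //; apply: measurable_funTS; exact: measurable_funX.
have h0 y : 0 <= h y by exact: EK_kernel_ge0.
(* As [y] runs over [[t, s]], [w = y - t s / y] runs from [-(s - t)] to [s - t]; [phi] is [w]
   rescaled to [[0, 1]], whence the length [2 (s - t)]. *)
pose phi (y : R) := c * (y - t * s * y^-1 + (s - t)).
pose dphi (y : R) := c * (1 + t * s * (y^-1 * y^-1)).
have der (y : R) : y \in `[t, s] -> is_derive y 1 phi (dphi y).
  rewrite in_itv/= => /andP[ty _].
  have y0 : 0 < y by exact: lt_le_trans ty.
  have hV := @is_deriveV R id y 1 1 (lt0r_neq0 y0) (is_derive_id _ _).
  rewrite (_ : phi = c \*: (id - (t * s) \*: (fun y : R => y^-1) + cst (s - t)))//.
  apply: is_derive_eq; rewrite /dphi /GRing.scale/= mulr1 -exprVn expr2; ring.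
have cV (y : R) : t < y -> {for y, continuous (fun y : R => y^-1)}.
  by move=> ty; apply: cvgV; [rewrite gt_eqF// (lt_trans t0)|exact: cvg_id].
have key : (\int[leb]_(y in `]t, s[) (h y * y ^+ 2 + t * s * h y)%:E =
    ((2 * (s - t)) `^ (2 * a - 1))%:E * BetaE a a)%E.
  apply: (BetaE_subst ts _ der).
  - by rewrite powR_gt0// mulr_gt0.
  - move=> y; rewrite in_itv/= => /andP[ty _].
    apply: cvgM; first exact: cvg_cst.
    apply: cvgD; first exact: cvg_cst.
    by apply: cvgM; [exact: cvg_cst|apply: cvgM; exact: cV].
  - move=> y; rewrite in_itv/= => /andP[ty _].
    have y0 : 0 < y by exact: lt_trans ty.
    by rewrite mulr_gt0// addr_gt0// !mulr_gt0 ?invr_gt0.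
  - by rewrite /phi; field; rewrite gt_eqF.
  - by rewrite /phi /c; field; rewrite !gt_eqF.
  - apply: measurable_funD => //.
    by apply: measurable_funM => //; exact: measurable_cst.
  move=> y ty ys.
  have y0 : 0 < y by exact: lt_trans ty.
  have e1 : 0 < y ^+ 2 - t ^+ 2 by nra.
  have e2 : 0 < s ^+ 2 - y ^+ 2 by nra.
  have p0 : 0 < phi y.
    rewrite mulr_gt0//.
    have -> : y - t * s / y + (s - t) = (y - t) * (y + s) / y by field; rewrite gt_eqF.
    by rewrite !mulr_gt0 ?invr_gt0; lra.
  have p1 : 0 < 1 - phi y.
    have -> : 1 - phi y = c * ((s - y) * (y + t) / y) by rewrite /phi /c; field; rewrite !gt_eqF.
    by rewrite !mulr_gt0 ?invr_gt0//; lra.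
  rewrite -powRM ?(ltW p0) ?(ltW p1)//.
  have -> : phi y * (1 - phi y) = c * (c * (y ^- 2 * ((y ^+ 2 - t ^+ 2) * (s ^+ 2 - y ^+ 2)))).
    by rewrite /phi /c; field; rewrite !gt_eqF.
  have -> : dphi y = c * (y ^- 2) * (y ^+ 2 + t * s) by rewrite /dphi; field; rewrite gt_eqF.
  have -> : h y * y ^+ 2 + t * s * h y = h y * (y ^+ 2 + t * s) by ring.
  rewrite [in RHS](mulrA (_ `^ (a - 1))) [in RHS]mulrA; congr (_ * _); rewrite /h /EK_kernel /=.
  have -> : c * y ^- 2 = 2^-1 * 2 * expR (ln c - (ln y + ln y)).
    by rewrite expRD expRN expRD !lnK ?posrE//; field; rewrite gt_eqF.
  have -> : ((2 * (s - t)) `^ (2 * a - 1)) = expR ((2 * a - 1) * - ln c).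
    by rewrite powR_expR ?mulr_gt0// /c lnV ?posrE ?mulr_gt0// opprK.
  rewrite !powR_expR ?mulr_gt0 ?invr_gt0 ?exprn_gt0//.
  have lnyE : ln (y ^- 2) = - (ln y + ln y).
    by rewrite lnV ?posrE ?exprn_gt0// lnXn// mulr2n.
  rewrite !lnM ?posrE ?mulr_gt0 ?invr_gt0 ?exprn_gt0// lnyE.
  move: (ln c) (ln y) (ln (y ^+ 2 - t ^+ 2)) (ln (s ^+ 2 - y ^+ 2)) => L Y A B.
  rewrite mulVf// mul1r -!expRD; congr expR; ring.
have I2 := ge0_integral_EK_kernel_symm a t0 ts.
have splitI : (\int[leb]_(y in `]t, s[) (h y * y ^+ 2 + t * s * h y)%:E =
  \int[leb]_(y in `]t, s[) (h y * y ^+ 2)%:E + (t * s)%:E * \int[leb]_(y in `]t, s[) (h y)%:E)%E.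
  rewrite -ge0_integralZl//; last 3 first.
  - exact/measurable_EFinP.
  - by move=> y _; rewrite lee_fin.
  - by rewrite lee_fin mulr_ge0// ltW.
  rewrite -ge0_integralD//.
  - by move=> y _; rewrite lee_fin mulr_ge0// sqr_ge0.
  - exact/measurable_EFinP.
  - by move=> y _; rewrite -EFinM lee_fin mulr_ge0// mulr_ge0// ltW.
  - apply/measurable_EFinP; apply: measurable_funM => //; exact: measurable_cst.
(* By the symmetry both summands of [key] are [t s] times the integral sought. As that integral
   might still be infinite, [2 t s] is removed by multiplying with its inverse in the extended
   reals. *)
have dbl (x : \bar R) : (0 <= x -> ((2 * t * s)^-1)%:E * ((t * s)%:E * x + (t * s)%:E * x) = x)%E.
  move=> x0; rewrite -mule2n -mule_natl !muleA -!EFinM.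
  have -> : (2 * t * s)^-1 * 2 * (t * s) = 1 by field; rewrite !gt_eqF.
  by rewrite mul1e.
rewrite EFinM -muleA -key splitI I2 dbl//.
by apply: integral_ge0 => y _; rewrite lee_fin EK_kernel_ge0.
Qed.

End Kernels.

(** * Inversion of Erdelyi-Kober integrals *)

Section EKComposition.
Context {R : realType}.
Local Notation leb := (@lebesgue_measure R).
Implicit Types (t s y a b p : R) (F G : R -> R).

Lemma EK_integrandE a F t s :
  EK_integrand a F t s = (s ^+ 2 - t ^+ 2) `^ (a - 1) * (s * F s).
Proof. by rewrite /EK_integrand -powRN opprB mulrC (mulrC (F s)). Qed.

Lemma dominated_integrable (D : set R) (f g : R -> R) (c : R) : measurable D ->
  leb.-integrable D (EFin \o g) -> measurable_fun D f ->
  (forall s, D s -> `|f s| <= c * `|g s|) -> leb.-integrable D (EFin \o f).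
Proof.
move=> mD ig mf fg.
have icg : leb.-integrable D (EFin \o (fun s => c * g s)).
  by rewrite (_ : EFin \o _ = fun s => (c%:E * (g s)%:E)%E)//; exact: integrableZl.
apply: le_integrable icg => //; first exact/measurable_EFinP.
move=> s Ds /=; rewrite lee_fin normrM; apply: (le_trans (fg _ Ds)).
by rewrite ler_wpM2r// ler_norm.
Qed.

(** Integrability of [K s G] at the single point [t] carries the argument. It also yields the
    convergence of the outer integral at [t], which the inversion formulas assert along with their
    values. *)
Lemma EK_integral_EK_integral a b p G F (K : R -> R) t : 0 < t ->
  Gamma_convergent a -> (forall x : R, 0 < x -> {for x, continuous G}) ->
  EK_converges a G ->
  (forall y, 0 < y -> F y = y `^ (- p) * EK_integral a G y) ->
  (forall s, t < s ->
    (\int[leb]_(y in `]t, s[) (EK_kernel a b p t (y, s))%:E = (K s)%:E)%E) ->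
  leb.-integrable `]t, +oo[ (EFin \o (fun s => K s * (s * G s))) ->
  leb.-integrable `]t, +oo[ (EFin \o EK_integrand b F t) /\
  EK_integral b F t = 4 / (Gamma b * Gamma a) *
    \int[leb]_(s in `]t, +oo[) (K s * (s * G s)).
Proof.
move=> t0 [_ a0] cG convG FE KE iK.
have ikG y : t < y -> leb.-integrable `]y, +oo[
    (EFin \o (fun z => EK_kernel a b p t (y, z) * (z * G z))).
  move=> ty; have y0 : 0 < y by exact: lt_trans ty.
  rewrite (_ : EFin \o _ = fun z => (((y ^+ 2 - t ^+ 2) `^ (b - 1) * y `^ (1 - p))%:E *
      (EK_integrand a G y z)%:E)%E).
    by apply: integrableZl => //; exact: convG.
  by apply/funext => z; rewrite EK_integrandE /= -EFinM /EK_kernel /=; congr EFin; ring.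
have [|||ih ihE] := @kernel_fubini R t (EK_kernel a b p t) K (fun s => s * G s) _ _ _ KE iK ikG.
- by apply: measurable_funTS; exact: measurable_EK_kernel.
- by move=> y z _ _; exact: EK_kernel_ge0.
- apply: continuous_measurable_oy => [|x x0]; first exact: ltW.
  by apply: cvgM; [exact: cvg_id|exact: cG].
have hE y : t < y -> EK_integrand b F t y =
    2 / Gamma a * \int[leb]_(z in `]y, +oo[) (EK_kernel a b p t (y, z) * (z * G z)).
  move=> ty; have y0 : 0 < y by exact: lt_trans ty.
  rewrite EK_integrandE FE// /EK_integral.
  rewrite (_ : \int[leb]_(z in _) (EK_kernel _ _ _ _ _ * _) =
    (y ^+ 2 - t ^+ 2) `^ (b - 1) * y `^ (1 - p) *
    \int[leb]_(z in `]y, +oo[) EK_integrand a G y z); last first.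
    rewrite -RintegralZl//; last exact: convG.
    by apply: eq_Rintegral => z _; rewrite EK_integrandE /EK_kernel /=; ring.
  have -> : y `^ (1 - p) = y * y `^ (- p).
    by rewrite powRD ?(lt0r_neq0 y0) ?implybT// powRr1// ltW.
  by ring.
have iE : leb.-integrable `]t, +oo[ (EFin \o EK_integrand b F t).
  have : leb.-integrable `]t, +oo[ (fun y => (2 / Gamma a)%:E *
    (\int[leb]_(z in `]y, +oo[) (EK_kernel a b p t (y, z) * (z * G z)))%:E)%E.
    by apply: integrableZl.
  by apply: eq_integrable => // y; rewrite inE/= in_itv/= andbT => ty; rewrite hE// EFinM.
split=> //.
rewrite -ihE /EK_integral.
rewrite (_ : 4 / _ * _ = 2 / Gamma b * (2 / Gamma a * \int[leb]_(y in `]t, +oo[) (\int[leb]_(z in `]y, +oo[) (EK_kernel a b p t (y, z) * (z * G z))))); last first.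
  move: (\int[leb]_(y in `]t, +oo[) _) => I.
  (* If [Gamma b] is 0, both sides vanish because the inverse of 0 is 0. *)
  have [->|b0] := eqVneq (Gamma b) 0; first by rewrite mul0r invr0 !mulr0 !mul0r.
  by field; rewrite b0 gt_eqF.
congr (_ * _); rewrite -RintegralZl//.
by apply: eq_Rintegral => y; rewrite inE/= in_itv/= andbT => /hE.
Qed.

End EKComposition.

(** * Left inverses of the integral of order k/2 *)

Section EKInversion.
Context {R : realType}.
Local Notation leb := (@lebesgue_measure R).
Implicit Types (t s y b p : R).

Let sqr_der (x : R) : is_derive x 1 (fun x => x ^+ 2) (2 * x).
Proof.
rewrite (_ : (fun x => x ^+ 2) = id ^+ 2)//; apply: is_derive_eq.
by rewrite expr1 /GRing.scale/= mulr1.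
Qed.

Let sqr_der_cont : continuous (fun x : R => 2 * x).
Proof. by move=> x; apply: cvgM; [exact: cvg_cst|exact: cvg_id]. Qed.

Let sqr_der_gt0 (x : R) : 0 < x -> 0 < 2 * x.
Proof. by move=> x0; rewrite mulr_gt0. Qed.

Let sqr : R -> R := fun x => x ^+ 2.
Let dbl : R -> R := fun x => 2 * x.

Lemma iter_oppD j (g F : R -> R) : (forall x : R, 0 < x -> {for x, continuous g}) ->
  iter_int_converges sqr dbl j g -> (forall t : R, 0 < t -> F t = iter_int sqr dbl j g t) ->
  iter_derivable oppD j.+1 F /\ forall t : R, 0 < t -> iter j.+1 oppD F t = g t.
Proof.
move=> cg ig FE.
exact: (@iter_opp_derive_weight R sqr dbl sqr_der sqr_der_cont sqr_der_gt0 g cg j F).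
Qed.

Lemma iter_oppderive j (g F : R -> R) : (forall x : R, 0 < x -> {for x, continuous g}) ->
  iter_int_converges id (cst 1) j g -> (forall t : R, 0 < t -> F t = iter_int id (cst 1) j g t) ->
  iter_derivable oppderive j.+1 F /\ forall t : R, 0 < t -> iter j.+1 oppderive F t = g t.
Proof.
move=> cg ig FE.
have -> : oppderive = opp_derive_weight (cst 1) :> ((R -> R) -> R -> R).
  by apply/funext => h; apply/funext => t; rewrite /oppderive /opp_derive_weight divr1.
apply: (@iter_opp_derive_weight R id (cst 1) _ _ _ g cg j F) => //.
by move=> x; exact: cst_continuous.
Qed.

Variable k : nat.
Hypothesis k0 : (0 < k)%N.
Let m := k./2.
Let a : R := k%:R / 2.
(** The complementary order: [a + b - 1 = m], so composing with [I^b] leaves an integral power of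
    [s^2 - t^2]. It is [1/2] for odd [k] and [1] for even [k]. *)
Let b : R := 1 - a + m%:R.

Let okk : Gamma_convergent a.
Proof. by rewrite /a -(prednK k0); exact: Gamma_convergent_half. Qed.

Let bE : b = (2 - odd k)%N%:R / 2.
Proof.
rewrite /b /a -{1}(odd_double_half k) -/m natrD -mul2n natrM natrB; last by case: (odd k).
by field.
Qed.

Let b0 : 0 < b.
Proof. by rewrite bE divr_gt0// ltr0n; case: (odd k). Qed.

Let okb : Gamma_convergent b.
Proof.
by rewrite bE (_ : 2 - odd k = (2 - odd k).-1.+1)%N; [exact: Gamma_convergent_half|case: (odd k)].
Qed.

Let abE : a + b - 1 = m%:R.
Proof. by rewrite /b; ring. Qed.

Let GabE : Gamma (a + b) = m`!%:R.
Proof.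
rewrite (_ : a + b = m.+1%:R); first exact: Gamma_nat.
by rewrite -natr1 -abE; ring.
Qed.

Let betaE : BetaE b a = (Gamma b * Gamma a / m`!%:R)%:E.
Proof. by have [_ ->] := Gamma_convergentD okb okk; rewrite addrC GabE. Qed.

Let fact0 : m`!%:R != 0 :> R.
Proof. by rewrite pnatr_eq0 -lt0n fact_gt0. Qed.

Variables F G : R -> R.
Hypothesis cG : forall x : R, 0 < x -> {for x, continuous G}.
Hypothesis convG : EK_converges a G.
Hypothesis FE : forall t : R, 0 < t -> F t = EK_integral a G t.

Let g s := s `^ (- 2 * b) * G s.

Let cg (x : R) : 0 < x -> {for x, continuous g}.
Proof. by move=> x0; apply: cvgM; [exact: powR_cont|exact: cG]. Qed.

Let D_gt0 t s : 0 < t -> t < s -> 0 < s ^+ 2 - t ^+ 2.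
Proof. by move=> t0 ts; nra. Qed.

Let mweight (h : R -> R) j t : 0 < t -> (forall x : R, 0 < x -> {for x, continuous h}) ->
  measurable_fun `]t, +oo[ (fun s => (s ^+ 2 - t ^+ 2) ^+ j * (2 * s * h s)).
Proof.
move=> t0 ch; apply: continuous_measurable_oy => [|x x0]; first exact: ltW.
apply: cvgM; last by apply: cvgM; [exact: sqr_der_cont|exact: ch].
apply: (@continuous_comp _ _ _ (fun x : R => x ^+ 2 - t ^+ 2) (fun u : R => u ^+ j)).
  by apply: cvgB; [exact: exprn_continuous|exact: cvg_cst].
exact: exprn_continuous.
Qed.

(** With [m = (a - 1) + b] and [(s^2 - t^2)^b <= s^(2b)], the weight [s^(-2b)] in [g] bounds the
    integrand by twice that of [I^a G]. *)
Lemma iter_int_converges_conj : iter_int_converges sqr dbl m g.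
Proof.
move=> t t0; apply: (@dominated_integrable _ _ _ (EK_integrand a G t) 2) => //.
- exact: convG.
- exact: mweight.
move=> s; rewrite /= in_itv/= andbT => ts; have D0 := D_gt0 t0 ts.
have s0 : 0 < s by exact: lt_trans ts.
rewrite EK_integrandE /g /sqr /dbl !normrM normrX.
rewrite (gtr0_norm D0) (gtr0_norm s0) !(ger0_norm (powR_ge0 _ _)) normr_nat.
rewrite [leRHS](_ : _ = (2 * s * `|G s|) * ((s ^+ 2 - t ^+ 2) `^ (a - 1))); last by ring.
rewrite [leLHS](_ : _ = (2 * s * `|G s|) * ((s ^+ 2 - t ^+ 2) ^+ m * s `^ (- 2 * b))); last by ring.
rewrite ler_wpM2l//; first by rewrite !mulr_ge0// ltW.
rewrite -powR_mulrn ?(ltW D0)// -abE (_ : a + b - 1 = (a - 1) + b); last by ring.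
rewrite powRD ?(lt0r_neq0 D0) ?implybT// -mulrA ler_piMr ?powR_ge0//.
rewrite mulNr powRN ler_pdivrMr ?powR_gt0// mul1r powRrM.
rewrite -[s `^ 2]/(s `^ 2%:R) powR_mulrn ?(ltW s0)//.
apply: ge0_ler_powR; rewrite ?nnegrE; [exact: ltW|exact: ltW|exact: sqr_ge0|nra].
Qed.

Lemma EK_formula_conj :
  let G1 s := s ^- (2 * m + 2) * F s in
  let H t := t ^+ k * EK_integral b G1 t in
  [/\ EK_converges b G1, iter_derivable oppD m.+1 H
    & forall t, 0 < t -> G t = t ^ (2 - k%:Z + 2 * m%:Z) * iter m.+1 oppD H t].
Proof.
move=> G1 H.
pose c := Gamma b * Gamma a / m`!%:R.
pose K t s := (2^-1 * (s ^+ 2 - t ^+ 2) `^ (a + b - 1) * t `^ (- 2 * a) * s `^ (- 2 * b)) * c.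
have KE t s : 0 < t -> t < s ->
    (\int[leb]_(y in `]t, s[) (EK_kernel a b (2 * (a + b)) t (y, s))%:E = (K t s)%:E)%E.
  by move=> t0 ts; rewrite EK_kernel_integral1// betaE -EFinM.
have KgE t s : 0 < t -> t < s -> K t s * (s * G s) =
    (4^-1 * c * t `^ (- 2 * a)) * ((s ^+ 2 - t ^+ 2) ^+ m * (2 * s * g s)).
  move=> t0 ts; rewrite /K abE powR_mulrn ?(ltW (D_gt0 t0 ts))// /g.
  by field.
have iconj := iter_int_converges_conj.
have iK t : 0 < t -> leb.-integrable `]t, +oo[ (EFin \o (fun s => K t s * (s * G s))).
  move=> t0.
  have : leb.-integrable `]t, +oo[ (fun s => (4^-1 * c * t `^ (- 2 * a))%:E *
      ((s ^+ 2 - t ^+ 2) ^+ m * (2 * s * g s))%:E)%E.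
    by apply: integrableZl => //; exact: iconj.
  apply: eq_integrable => // s; rewrite inE/= in_itv/= andbT => ts.
  by rewrite KgE// EFinM.
have G1E y : 0 < y -> G1 y = y `^ (- (2 * (a + b))) * EK_integral a G y.
  move=> y0; rewrite /G1 FE//; congr (_ * _).
  rewrite powRN (_ : 2 * (a + b) = (2 * m + 2)%N%:R) ?powR_mulrn ?(ltW y0)//.
  by rewrite natrD natrM -abE; ring.
have EKt t : 0 < t -> leb.-integrable `]t, +oo[ (EFin \o EK_integrand b G1 t) /\
  EK_integral b G1 t = 4 / (Gamma b * Gamma a) *
    \int[leb]_(s in `]t, +oo[) (K t s * (s * G s)).
  move=> t0; apply: (EK_integral_EK_integral t0 okk cG convG G1E _ (iK t t0)).
  by move=> s ts; exact: KE.
(* The factor [t^k] in [H] cancels the [t^(-2a)] of the kernel, and the Gamma and Beta constants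
   combine to [1 / m!]. *)
have HE t : 0 < t -> H t = iter_int sqr dbl m g t.
  move=> t0; rewrite /H (EKt _ t0).2 /iter_int.
  have -> : \int[leb]_(s in `]t, +oo[) (K t s * (s * G s)) =
      (4^-1 * c * t `^ (- 2 * a)) *
      \int[leb]_(s in `]t, +oo[) ((s ^+ 2 - t ^+ 2) ^+ m * (2 * s * g s)).
    rewrite -RintegralZl//; last exact: iconj.
    by apply: eq_Rintegral => s; rewrite inE/= in_itv/= andbT => ts; exact: KgE.
  have -> : \int[leb]_(s in `]t, +oo[) ((sqr s - sqr t) ^+ m / m`!%:R * (dbl s * g s)) =
      m`!%:R^-1 * \int[leb]_(s in `]t, +oo[) ((s ^+ 2 - t ^+ 2) ^+ m * (2 * s * g s)).
    rewrite -RintegralZl//; last exact: iconj.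
    by apply: eq_Rintegral => s _; rewrite /sqr /dbl; ring.
  have -> : t `^ (- 2 * a) = (t ^+ k)^-1.
    by rewrite -powR_mulrn ?(ltW t0)// -powRN; congr (_ `^ _); rewrite /a; field.
  rewrite /c; move: (\int[leb]_(s in `]t, +oo[) _) => I; field.
  by rewrite fact0 expf_neq0 ?gt_eqF// (okk.2, okb.2).
have [dH iH] := iter_oppD cg iconj HE.
split=> // [t t0|t t0]; first by have [] := EKt _ t0.
rewrite iH// /g mulrA (_ : _ * _ `^ _ = 1) ?mul1r//.
(* The exponent is [2b], so the outer power of [t] undoes the weight [s^(-2b)] in [g]; it is 1 or 2
   according to the parity of [k]. *)
have -> : (2 - k%:Z + 2 * m%:Z) = (2 - odd k)%N.
  rewrite -{1}(odd_double_half k) -/m; case: (odd k) => /=; lia.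
rewrite -exprnP -powR_mulrn ?(ltW t0)// -powRD ?(lt0r_neq0 t0) ?implybT//.
by rewrite bE (_ : _ + _ = 0) ?powRr0//; field.
Qed.

(** For even [k] the exponent [a - 1] is the natural number [m - 1], and [I^a G] is itself the
    [m]-fold iterated integral of [G]. *)
Lemma EK_formula_even : ~~ odd k ->
  iter_derivable oppD m F /\ forall t, 0 < t -> G t = iter m oppD F t.
Proof.
move=> evk; have km : k = m.*2 by rewrite -[LHS]odd_double_half (negbTE evk).
have m0 : (0 < m)%N by move: k0; rewrite km double_gt0.
have am : a = m.-1.+1%:R by rewrite /a km -mul2n natrM (prednK m0); field.
have a1 : a - 1 = m.-1%:R by rewrite am -natr1; ring.
have intE t s : 0 < t -> t < s -> (s ^+ 2 - t ^+ 2) ^+ m.-1 * (2 * s * G s) = 2 * EK_integrand a G t s.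
  move=> t0 ts; rewrite EK_integrandE a1 powR_mulrn ?(ltW (D_gt0 t0 ts))//; ring.
have conv : iter_int_converges sqr dbl m.-1 G.
  move=> t t0.
  have : leb.-integrable `]t, +oo[ (fun s => 2%:E * (EK_integrand a G t s)%:E)%E.
    by apply: integrableZl => //; exact: convG.
  apply: eq_integrable => // s; rewrite inE/= in_itv/= andbT => ts.
  by rewrite /sqr /dbl intE// EFinM.
have FT t : 0 < t -> F t = iter_int sqr dbl m.-1 G t.
  move=> t0; rewrite FE// /EK_integral am Gamma_nat /iter_int -am -RintegralZl//; last exact: convG.
  apply: eq_Rintegral => s; rewrite inE/= in_itv/= andbT => ts.
  by rewrite [in RHS]mulrAC /sqr /dbl intE//; ring.
have [dF iF] := iter_oppD cG conv FT.
by move: dF iF; rewrite (prednK m0) => dF iF; split=> // t t0; rewrite iF.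
Qed.

Lemma EK_formula_alt :
  let G1 s := s ^- (k + 1) * F s in
  let H t := t * EK_integral a G1 t in
  [/\ EK_converges a G1, iter_derivable oppderive k H
    & forall t, 0 < t -> G t = 2 ^- k * iter k oppderive H t].
Proof.
(* In [2 ^+ k], the power [k - 1] comes from the kernel [(2 (s - t))^(k-1)]; the remaining 2 is the
   4 of the two integrals divided by the 2 of [2 t s]. *)
move=> G1 H; pose h s := 2 ^+ k * G s.
have ch (x : R) : 0 < x -> {for x, continuous h}.
  by move=> x0; apply: cvgM; [exact: cvg_cst|exact: cG].
have a2 : 2 * a - 1 = k.-1%:R by rewrite /a -{1}(prednK k0) -natr1; field.
have conv : iter_int_converges id (cst 1) k.-1 h.
  move=> t t0; apply: (@dominated_integrable _ _ _ (EK_integrand a G t) (2 * 2 ^+ k)) => //.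
  - exact: convG.
  - apply: continuous_measurable_oy => [|x x0]; first exact: ltW.
    apply: cvgM; last by apply: cvgM; [exact: cvg_cst|exact: ch].
    apply: (@continuous_comp _ _ _ (fun x : R => x - t) (fun u : R => u ^+ k.-1)).
      by apply: cvgB; [exact: cvg_id|exact: cvg_cst].
    exact: exprn_continuous.
  move=> s; rewrite /= in_itv/= andbT => ts; have D0 := D_gt0 t0 ts.
  have s0 : 0 < s by exact: lt_trans ts.
  have d0 : 0 < s - t by lra.
  have p0 : 0 < s + t by lra.
  rewrite EK_integrandE /h mul1r !normrM !normrX normr_nat.
  rewrite (gtr0_norm d0) (gtr0_norm s0) (ger0_norm (powR_ge0 _ _)).
  rewrite [leLHS](_ : _ = (2 ^+ k * `|G s|) * (s - t) ^+ k.-1); last by ring.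
  rewrite [leRHS](_ : _ = (2 ^+ k * `|G s|) * ((s ^+ 2 - t ^+ 2) `^ (a - 1) * (2 * s))); last by ring.
  rewrite ler_wpM2l//.
  (* The chain is [(s-t)^(k-1) = (s-t)^(a-1) (s-t)^a <= (s-t)^(a-1) (s+t)^a = (s^2-t^2)^(a-1)
     (s+t)], and [s + t <= 2 s]. *)
  rewrite -powR_mulrn ?(ltW d0)// -a2 (_ : s ^+ 2 - t ^+ 2 = (s - t) * (s + t)); last by ring.
  rewrite powRM ?(ltW d0) ?(ltW p0)// (_ : 2 * a - 1 = (a - 1) + a); last by ring.
  rewrite powRD ?(lt0r_neq0 d0) ?implybT// -mulrA ler_wpM2l ?powR_ge0//.
  apply: (@le_trans _ _ ((s + t) `^ a)).
    apply: ge0_ler_powR; rewrite ?nnegrE; [|exact: ltW|exact: ltW|lra].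
    by rewrite /a divr_ge0.
  have -> : (s + t) `^ a = (s + t) `^ (a - 1) * (s + t).
    by rewrite -[X in _ * X]powRr1 ?(ltW p0)// -powRD ?subrK// (lt0r_neq0 p0) implybT.
  by rewrite ler_wpM2l ?powR_ge0//; lra.
pose c := Gamma a * Gamma a / (k.-1)`!%:R.
pose K t s := ((2 * t * s)^-1 * (2 * (s - t)) `^ (2 * a - 1)) * c.
have betaa : BetaE a a = c%:E.
  have [_ ->] := Gamma_convergentD okk okk; rewrite /c.
  by rewrite (_ : a + a = k.-1.+1%:R) ?Gamma_nat// (prednK k0) /a; field.
have KE t s : 0 < t -> t < s ->
    (\int[leb]_(y in `]t, s[) (EK_kernel a a (2 * a + 1) t (y, s))%:E = (K t s)%:E)%E.
  by move=> t0 ts; rewrite EK_kernel_integral_self// betaa -EFinM.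
have KgE t s : 0 < t -> t < s -> K t s * (s * G s) =
    ((4 * t)^-1 * c) * ((s - t) ^+ k.-1 * (1 * h s)).
  move=> t0 ts; have s0 : 0 < s by exact: lt_trans ts.
  rewrite /K a2 powR_mulrn; last by rewrite mulr_ge0//; lra.
  have e2 : 2 ^+ k = 2 * 2 ^+ k.-1 :> R by rewrite -exprS prednK.
  by rewrite exprMn /h e2; field; rewrite !gt_eqF.
have iK t : 0 < t -> leb.-integrable `]t, +oo[ (EFin \o (fun s => K t s * (s * G s))).
  move=> t0.
  have : leb.-integrable `]t, +oo[ (fun s => ((4 * t)^-1 * c)%:E *
      ((s - t) ^+ k.-1 * (1 * h s))%:E)%E.
    by apply: integrableZl => //; exact: conv.
  apply: eq_integrable => // s; rewrite inE/= in_itv/= andbT => ts.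
  by rewrite KgE// EFinM.
have G1E y : 0 < y -> G1 y = y `^ (- (2 * a + 1)) * EK_integral a G y.
  move=> y0; rewrite /G1 FE//; congr (_ * _).
  rewrite powRN (_ : 2 * a + 1 = (k + 1)%N%:R) ?powR_mulrn ?(ltW y0)//.
  by rewrite natrD /a; field.
have EKt t : 0 < t -> leb.-integrable `]t, +oo[ (EFin \o EK_integrand a G1 t) /\
  EK_integral a G1 t = 4 / (Gamma a * Gamma a) *
    \int[leb]_(s in `]t, +oo[) (K t s * (s * G s)).
  move=> t0; apply: (EK_integral_EK_integral t0 okk cG convG G1E _ (iK t t0)).
  by move=> s ts; exact: KE.
have f0 : (k.-1)`!%:R != 0 :> R by rewrite pnatr_eq0 -lt0n fact_gt0.
have HE t : 0 < t -> H t = iter_int id (cst 1) k.-1 h t.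
  move=> t0; rewrite /H (EKt _ t0).2 /iter_int.
  have -> : \int[leb]_(s in `]t, +oo[) (K t s * (s * G s)) =
      ((4 * t)^-1 * c) *
      \int[leb]_(s in `]t, +oo[) ((s - t) ^+ k.-1 * (1 * h s)).
    rewrite -RintegralZl//; last exact: conv.
    by apply: eq_Rintegral => s; rewrite inE/= in_itv/= andbT => ts; exact: KgE.
  have -> : \int[leb]_(s in `]t, +oo[) ((id s - id t) ^+ k.-1 / (k.-1)`!%:R * (cst 1 s * h s)) =
      (k.-1)`!%:R^-1 * \int[leb]_(s in `]t, +oo[) ((s - t) ^+ k.-1 * (1 * h s)).
    rewrite -RintegralZl//; last exact: conv.
    by apply: eq_Rintegral => s _ /=; ring.
  by rewrite /c; move: (\int[leb]_(s in `]t, +oo[) _) => I; field; rewrite f0 !gt_eqF// okk.2.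
have [dH iH] := iter_oppderive ch conv HE.
split=> [t t0||t t0]; first by have [] := EKt _ t0.
  by move: dH; rewrite (prednK k0).
by move: (iH t t0); rewrite (prednK k0) => ->; rewrite /h mulKf// expf_neq0.
Qed.

(** Without a weight the composed kernel grows like [s^(2m)], faster than [s^(2a-2)] since
    [m - (a - 1) = b] is positive. Convergence of [I^a G] no longer controls it and becomes a
    hypothesis on [G]. *)
Lemma EK_formula_decay : iter_int_converges sqr dbl m G ->
  let H := EK_integral b F in
  [/\ EK_converges b F, iter_derivable oppD m.+1 H
    & forall t, 0 < t -> G t = iter m.+1 oppD H t].
Proof.
move=> conv H.
pose c := Gamma b * Gamma a / m`!%:R.
pose K t s := (2^-1 * (s ^+ 2 - t ^+ 2) `^ (a + b - 1)) * c.
have KE t s : 0 < t -> t < s ->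
    (\int[leb]_(y in `]t, s[) (EK_kernel a b 0 t (y, s))%:E = (K t s)%:E)%E.
  by move=> t0 ts; rewrite EK_kernel_integral0// betaE -EFinM.
have KgE t s : 0 < t -> t < s -> K t s * (s * G s) =
    (4^-1 * c) * ((s ^+ 2 - t ^+ 2) ^+ m * (2 * s * G s)).
  move=> t0 ts; rewrite /K abE powR_mulrn ?(ltW (D_gt0 t0 ts))//.
  by field.
have iK t : 0 < t -> leb.-integrable `]t, +oo[ (EFin \o (fun s => K t s * (s * G s))).
  move=> t0.
  have : leb.-integrable `]t, +oo[ (fun s => (4^-1 * c)%:E *
      ((s ^+ 2 - t ^+ 2) ^+ m * (2 * s * G s))%:E)%E.
    by apply: integrableZl => //; exact: conv.
  apply: eq_integrable => // s; rewrite inE/= in_itv/= andbT => ts.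
  by rewrite KgE// EFinM.
have F0E y : 0 < y -> F y = y `^ (- 0) * EK_integral a G y.
  by move=> y0; rewrite FE// oppr0 powRr0 mul1r.
have EKt t : 0 < t -> leb.-integrable `]t, +oo[ (EFin \o EK_integrand b F t) /\
  EK_integral b F t = 4 / (Gamma b * Gamma a) *
    \int[leb]_(s in `]t, +oo[) (K t s * (s * G s)).
  move=> t0; apply: (EK_integral_EK_integral t0 okk cG convG F0E _ (iK t t0)).
  by move=> s ts; exact: KE.
have HE t : 0 < t -> H t = iter_int sqr dbl m G t.
  move=> t0; rewrite /H (EKt _ t0).2 /iter_int.
  have -> : \int[leb]_(s in `]t, +oo[) (K t s * (s * G s)) =
      (4^-1 * c) *
      \int[leb]_(s in `]t, +oo[) ((s ^+ 2 - t ^+ 2) ^+ m * (2 * s * G s)).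
    rewrite -RintegralZl//; last exact: conv.
    by apply: eq_Rintegral => s; rewrite inE/= in_itv/= andbT => ts; exact: KgE.
  have -> : \int[leb]_(s in `]t, +oo[) ((sqr s - sqr t) ^+ m / m`!%:R * (dbl s * G s)) =
      m`!%:R^-1 * \int[leb]_(s in `]t, +oo[) ((s ^+ 2 - t ^+ 2) ^+ m * (2 * s * G s)).
    rewrite -RintegralZl//; last exact: conv.
    by apply: eq_Rintegral => s _; rewrite /sqr /dbl; ring.
  by rewrite /c; move: (\int[leb]_(s in `]t, +oo[) _) => I; field; rewrite fact0 !gt_eqF// (okk.2, okb.2).
have [dH iH] := iter_oppD cG conv HE.
by split=> // t t0; [have [] := EKt _ t0|rewrite iH].
Qed.

End EKInversion.

Lemma EK_inverse_unique {R : realType} (k : nat) (F G G' : R -> R) : (0 < k)%N ->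
  EK_inverse (k%:R / 2) F G -> EK_inverse (k%:R / 2) F G' ->
  forall t : R, 0 < t -> G' t = G t.
Proof.
move=> k0 [cG vG eG] [cG' vG' eG'] t t0.
have [_ _ ->//] := @EK_formula_conj R k k0 F G cG vG (fun t h => esym (eG t h)).
by have [_ _ ->//] := @EK_formula_conj R k k0 F G' cG' vG' (fun t h => esym (eG' t h)).
Qed.

(** * Borel measurability of matrix-valued maps *)

Section MatrixMeasurability.
Context {R : realType}.

(** These boxes form a countable base of the topology, being balls of the sup norm. Through them,
    measurability of a matrix-valued map reduces to that of its entries. *)
Definition rat_box (p q : nat) (c : 'M[rat]_(p, q)) (e : nat) : set 'M[R]_(p, q) :=
  [set x | forall i j, `|x i j - ratr (c i j)| < e.+1%:R^-1].

Lemma open_bigcup_rat_box p q (U : set 'M[R]_(p, q)) : open U ->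
  U = \bigcup_(ce in [set ce : 'M[rat]_(p, q) * nat | rat_box ce.1 ce.2 `<=` U])
        rat_box ce.1 ce.2.
Proof.
move=> oU; apply/seteqP; split=> [x Ux|x [ce/= ceU]]; last exact: ceU.
have /nbhs_ballP[e /= e0 xeU] : nbhs x U by exact: open_nbhs_nbhs.
have e20 : 0 < e / 2 by lra.
have [N Ne] : exists N : nat, N.+1%:R^-1 < e / 2.
  have := @cvg_harmonic R => /cvgrPdist_lt /(_ _ e20)[N _ /(_ N (leqnn N))].
  by rewrite sub0r normrN /= gtr0_norm ?invr_gt0// => h; exists N.
have d0 : 0 < (N.+1%:R^-1 : R) by rewrite invr_gt0.
have [d dE] : exists d : R, d = N.+1%:R^-1 by eexists.
rewrite -dE in Ne d0.
have approx i j : exists r : rat, `|x i j - ratr r| < d.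
  have [r] : exists r : rat, ratr r \in `](x i j - d), (x i j + d)[.
    by apply: rat_in_itvoo; lra.
  rewrite in_itv/= => /andP[h1 h2]; exists r; rewrite ltr_norml.
  by apply/andP; split; lra.
pose c : 'M[rat]_(p, q) := \matrix_(i, j) projT1 (cid (approx i j)).
have xc : rat_box c N x by move=> i j; rewrite mxE -dE; exact: projT2 (cid (approx i j)).
exists (c, N) => //= y yc; apply: xeU; split => // i j.
rewrite /ball/= (le_lt_trans (ler_distD (ratr (c i j)) _ _))//.
have := xc i j; have := yc i j; rewrite -dE [`|y i j - _|]distrC => h1 h2; lra.
Qed.

Section compose.
Context d (T : measurableType d).

Lemma measurable_preimage_open p q (h : T -> 'M[R]_(p, q)) (U : set 'M[R]_(p, q)) :
  (forall i j, measurable_fun setT (fun t => h t i j)) -> open U ->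
  measurable (h @^-1` U).
Proof.
move=> mh oU; rewrite (open_bigcup_rat_box oU) preimage_bigcup.
rewrite bigcup_mkcond; apply: countable_bigcupT_measurable; first exact: countableP.
move=> [c e]; case: ifPn => // _ /=.
rewrite (_ : _ @^-1` _ = \bigcap_(ij in [set: 'I_p * 'I_q])
    [set t | `|h t ij.1 ij.2 - ratr (c ij.1 ij.2)| < e.+1%:R^-1]); last first.
  by apply/seteqP; split=> [t ht ij _|t ht i j]; [exact: ht|exact: (ht (i, j))].
apply: fin_bigcap_measurable => //.
move=> [i j] _ /=.
have mB : measurable_fun setT (fun t => `|h t i j - ratr (c i j)|).
  by apply: measurableT_comp => //; apply: measurable_funB => //; exact: measurable_cst.
rewrite (_ : [set t | _] = (fun t => `|h t i j - ratr (c i j)|) @^-1` `]-oo, e.+1%:R^-1[).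
  by rewrite -[X in measurable X]setTI; apply: mB => //; exact: measurable_itv.
by apply/seteqP; split=> t /=; rewrite in_itv.
Qed.

Lemma measurable_continuous_mx p q (h : T -> 'M[R]_(p, q)) (g : 'M[R]_(p, q) -> R) :
  (forall i j, measurable_fun setT (fun t => h t i j)) -> continuous g ->
  measurable_fun setT (fun t => g (h t)).
Proof.
move=> mh cg; apply: (measurability _ (RGenOpens.measurableE R)) => //.
move=> _ [_ [a [b ->] <-]]; rewrite setTI.
rewrite (_ : _ @^-1` _ = h @^-1` (g @^-1` `]a, b[))//.
apply: measurable_preimage_open => //.
by move/continuousP : cg; apply; exact: interval_open.
Qed.

Lemma measurable_mxBorel p (h : T -> 'M[R]_p) :
  (forall i j, measurable_fun setT (fun t => h t i j)) ->
  measurable_fun setT (h : T -> @mxBorel R p).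
Proof.
move=> mh; apply: (@measurability _ _ T (@mxBorel R p) setT h (@open 'M[R]_p)) => //.
move=> _ [U oU <-]; rewrite setTI; exact: measurable_preimage_open.
Qed.

Lemma measurable_mulmx p q r (A : T -> 'M[R]_(p, q)) (B : T -> 'M[R]_(q, r)) :
  (forall i j, measurable_fun setT (fun t => A t i j)) ->
  (forall i j, measurable_fun setT (fun t => B t i j)) ->
  forall i j, measurable_fun setT (fun t => (A t *m B t) i j).
Proof.
move=> mA mB i j; under eq_fun do rewrite mxE.
by apply: measurable_sum => l; apply: measurable_funM.
Qed.

Lemma measurable_addmx p q (A B : T -> 'M[R]_(p, q)) :
  (forall i j, measurable_fun setT (fun t => A t i j)) ->
  (forall i j, measurable_fun setT (fun t => B t i j)) ->
  forall i j, measurable_fun setT (fun t => (A t + B t) i j).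
Proof.
by move=> mA mB i j; under eq_fun do rewrite mxE; apply: measurable_funD.
Qed.

End compose.

Lemma measurable_mxBorel_coord p (i j : 'I_p) :
  measurable_fun setT (fun g : @mxBorel R p => (g : 'M[R]_p) i j).
Proof.
apply: (measurability _ (RGenOpens.measurableE R)) => //.
move=> _ [_ [a [b ->] <-]]; rewrite setTI.
apply: sub_sigma_algebra.
have := @coord_continuous R p p i j => /continuousP; apply; exact: interval_open.
Qed.

End MatrixMeasurability.

(** * Integration on R^k *)

Section EuclideanNorm.
Context {R : realType}.

Lemma dotp_mulmx n (u v : 'cV[R]_n) : dotp u v = (u^T *m v) 0 0.
Proof. by rewrite mxE; apply: eq_bigr => i _; rewrite mxE. Qed.

Lemma dotp_ge0 n (u : 'cV[R]_n) : 0 <= dotp u u.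
Proof. by apply: sumr_ge0 => i _; rewrite -expr2 sqr_ge0. Qed.

Lemma dotp_orthogonal n k (Q : 'M[R]_(n, k)) (u v : 'cV[R]_k) : Q^T *m Q = 1%:M ->
  dotp (Q *m u) (Q *m v) = dotp u v.
Proof.
by move=> QQ; rewrite !dotp_mulmx trmx_mul -mulmxA (mulmxA Q^T) QQ mul1mx.
Qed.

Lemma dotp_col_mx k (x : R) (v : 'cV[R]_k) :
  dotp (col_mx (x%:M : 'M[R]_1) v) (col_mx (x%:M : 'M[R]_1) v) = x ^+ 2 + dotp v v.
Proof.
rewrite /dotp big_split_ord big_ord1 !col_mxEu !mxE eqxx mulr1n expr2.
by congr (_ + _); apply: eq_bigr => i _; rewrite !col_mxEd.
Qed.

Lemma sum_continuous (T : topologicalType) (I : Type) (r : seq I) (h : I -> T -> R) :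
  (forall i, continuous (h i)) -> continuous (fun t => \sum_(i <- r) h i t).
Proof.
move=> ch; elim: r => [|i r ih].
  rewrite (_ : (fun t => _) = cst 0); first by move=> t; exact: cvg_cst.
  by apply/funext => t; rewrite big_nil.
rewrite (_ : (fun t => _) = h i \+ (fun t => \sum_(i <- r) h i t)).
  by move=> t; apply: cvgD; [exact: ch|exact: ih].
by apply/funext => t; rewrite big_cons.
Qed.

Lemma dotp_continuous n : continuous (fun v : 'cV[R]_n => dotp v v).
Proof.
apply: sum_continuous => i v.
by have c := @coord_continuous R n 1 i 0 v; apply: (cvgM c c).
Qed.

Lemma mx_continuous (T : topologicalType) p q (h : T -> 'M[R]_(p, q)) :
  (forall i j, continuous (fun t => h t i j)) -> continuous h.
Proof.
move=> ch t A [P Pn PA].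
have hP (ij : 'I_p * 'I_q) : \forall s \near t, P ij.1 ij.2 (h s ij.1 ij.2).
  exact: (ch _ _ _ _ (Pn ij.1 ij.2)).
have hQ : nbhs t [set s | forall ij : 'I_p * 'I_q, P ij.1 ij.2 (h s ij.1 ij.2)].
  exact: filter_forall.
have H : nbhs t (h @^-1` A); last exact: H.
by apply: filterS hQ => s Ps; apply: PA => i j; exact: (Ps (i, j)).
Qed.

Lemma mulmx_continuous p q r (B : 'M[R]_(p, q)) :
  continuous (fun v : 'M[R]_(q, r) => B *m v).
Proof.
apply: mx_continuous => i j; under eq_fun do rewrite mxE.
apply: sum_continuous => l v; have c := @coord_continuous R q r l j v.
exact: (cvgM (cvg_cst _) c).
Qed.

Lemma col_mx_continuous k (B : 'cV[R]_1) :
  continuous (fun v : 'cV[R]_k => col_mx B v).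
Proof.
apply: mx_continuous => i j; case: (splitP i) => l il.
  rewrite (_ : i = lshift k l); last exact/val_inj.
  by under eq_fun do rewrite col_mxEu; exact: cst_continuous.
rewrite (_ : i = rshift 1 l); last exact/val_inj.
by under eq_fun do rewrite col_mxEd; exact: coord_continuous.
Qed.

End EuclideanNorm.

Section RkIntegral.
Context {R : realType}.
Local Notation leb := (@lebesgue_measure R).
Local Notation Rk k := (ms_carrier (@Rk_space R k)).
Local Notation mRk k := (ms_measure (@Rk_space R k)).

Lemma measurable_Rk_vec k i j :
  measurable_fun setT (fun z : Rk k => Rk_vec z i j).
Proof.
elim: k i => [[//]|k ih i] /=.
case: (@splitP 1 k i) => l il.
  rewrite (_ : i = lshift k l); last exact/val_inj.
  rewrite (_ : (fun z => _) = fst); first exact: measurable_fst.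
  apply/funext => z; rewrite (@col_mxEu R 1 k 1 z.1%:M (Rk_vec z.2)) mxE.
  by rewrite !ord1 eqxx mulr1n.
rewrite (_ : i = rshift 1 l); last exact/val_inj.
rewrite (_ : (fun z => _) = (fun z => Rk_vec z l j) \o snd).
  exact: (measurableT_comp (ih l) measurable_snd).
by apply/funext => z; rewrite (@col_mxEd R 1 k 1 z.1%:M (Rk_vec z.2)).
Qed.

Lemma ge0_integral_RkS k (f : Rk k.+1 -> \bar R) : measurable_fun setT f ->
  (forall z, 0 <= f z)%E ->
  (\int[mRk k.+1]_z f z = \int[leb]_x \int[mRk k]_z f (x, z))%E.
Proof. by move=> mf f0; exact: (@fubini_tonelli1 _ _ _ _ R leb (mRk k) f mf f0). Qed.

Lemma measurable_fun_RkS k (f : Rk k.+1 -> \bar R) : measurable_fun setT f ->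
  (forall z, 0 <= f z)%E ->
  measurable_fun setT (fun x : measurableTypeR R => \int[mRk k]_z f (x, z))%E.
Proof. by move=> mf f0; exact: (@measurable_fun_fubini_tonelli_F _ _ _ _ R (mRk k) f mf f0). Qed.

Lemma measurable_cont_Rk k (g : 'cV[R]_k -> R) : continuous g ->
  measurable_fun setT (fun z : Rk k => g (Rk_vec z)).
Proof. by apply: measurable_continuous_mx => i j; exact: measurable_Rk_vec. Qed.

Lemma addmx_continuous p q (c : 'M[R]_(p, q)) : continuous (fun v : 'M[R]_(p, q) => v + c).
Proof. by move=> v; exact: (cvgD cvg_id (cvg_cst c)). Qed.

Lemma ge0_integral_Rk_shift k (g : 'cV[R]_k -> R) (c : 'cV[R]_k) :
  continuous g -> (forall v, 0 <= g v) ->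
  (\int[mRk k]_z (g (Rk_vec z + c))%:E = \int[mRk k]_z (g (Rk_vec z))%:E)%E.
Proof.
elim: k g c => [|k ih] g c cg g0.
  by apply: eq_integral => z _; congr (EFin (g _)); apply/matrixP => -[].
pose c1 := (usubmx (c : 'cV[R]_(1 + k))) 0 0.
pose c2 := dsubmx (c : 'cV[R]_(1 + k)).
have cE : c = col_mx c1%:M c2 :> 'cV[R]_(1 + k).
  by rewrite -[LHS](@vsubmxK R 1 k 1 c); congr col_mx; apply/matrixP => i j; rewrite !ord1 [RHS]mxE eqxx mulr1n /c1.
have ccol (x : R) : continuous (fun v : 'cV[R]_k => g (col_mx (x%:M : 'M[R]_1) v)).
  by move=> v; apply: (continuous_comp (@col_mx_continuous R k x%:M v)); exact: cg.
have mg (h : 'cV[R]_k.+1 -> R) : continuous h ->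
    measurable_fun setT (fun z : Rk k.+1 => (h (Rk_vec z))%:E).
  by move=> ch; apply/measurable_EFinP; exact: measurable_cont_Rk.
have cgc : continuous (fun v : 'cV[R]_k.+1 => g (v + c)).
  by move=> v; apply: (continuous_comp (@addmx_continuous _ _ c v)); exact: cg.
rewrite (ge0_integral_RkS (mg _ cgc)); last by move=> z; rewrite lee_fin.
rewrite (ge0_integral_RkS (mg _ cg)); last by move=> z; rewrite lee_fin.
transitivity (\int[leb]_x \int[mRk k]_z (g (col_mx ((x + c1)%R%:M : 'M[R]_1) (Rk_vec z)))%:E)%E.
  apply: eq_integral => x _.
  rewrite -(ih (fun v => g (col_mx ((x + c1)%:M : 'M[R]_1) v)) c2) //.
  apply: eq_integral => z _ /=; congr (EFin (g _)).
  by rewrite cE (add_col_mx (x%:M : 'M[R]_1)) raddfD.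
have := @ge0_integral_shift R (fun x : R => \int[mRk k]_z (g (col_mx (x%:M : 'M[R]_1) (Rk_vec z)))%:E)%E c1.
apply; last by move=> x; apply: integral_ge0 => z _; rewrite lee_fin.
apply: (measurable_fun_RkS (mg _ cg)) => z; by rewrite lee_fin.
Qed.

End RkIntegral.

(** * Rotation invariance of Lebesgue measure on R^k *)

Section RkRotation.
Context {R : realType}.
Local Notation leb := (@lebesgue_measure R).
Local Notation Rk k := (ms_carrier (@Rk_space R k)).
Local Notation mRk k := (ms_measure (@Rk_space R k)).

Lemma integral_Rk0 (f : Rk 0 -> \bar R) : (\int[mRk 0]_z f z = f tt)%E.
Proof.
have mf : measurable_fun [set: unit] f by [].
by have := @integral_dirac _ unit tt R setT measurableT f mf; rewrite diracT mul1e.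
Qed.

Lemma gauss_dotp_continuous k : continuous (fun v : 'cV[R]_k => expR (- dotp v v)).
Proof.
move=> v; apply: (@continuous_comp _ _ _ (fun v : 'cV[R]_k => - dotp v v) expR).
  exact: (cvgN (@dotp_continuous R k v)).
exact: continuous_expR.
Qed.

Lemma integral_Rk_gauss k :
  (\int[mRk k]_z (expR (- dotp (Rk_vec z) (Rk_vec z)))%:E = (Num.sqrt pi ^+ k)%:E)%E.
Proof.
elim: k => [|k ih]; first by rewrite integral_Rk0 /dotp big_ord0 oppr0 expR0.
rewrite ge0_integral_RkS; last 2 first.
- by apply/measurable_EFinP; exact: (measurable_cont_Rk (@gauss_dotp_continuous k.+1)).
- by move=> z; rewrite lee_fin expR_ge0.
transitivity (\int[leb]_x ((gauss_fun x)%:E * (Num.sqrt pi ^+ k)%:E))%E.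
  apply: eq_integral => x _; rewrite -ih -ge0_integralZl//.
  - apply: eq_integral => z _; rewrite -EFinM dotp_col_mx; congr EFin.
    by rewrite opprD expRD.
  - by apply/measurable_EFinP; exact: (measurable_cont_Rk (@gauss_dotp_continuous k)).
  - by rewrite lee_fin gauss_fun_ge0.
rewrite ge0_integralZr//.
- by rewrite integralT_gauss -EFinM exprS.
- by apply/measurable_EFinP; exact: measurable_gauss_fun.
- by move=> x _; rewrite lee_fin gauss_fun_ge0.
Qed.

(* Translation invariance suffices: for h a Gaussian, the integral over x and y
   of g (Q x) h(y) is invariant under translating x by Q^T y, then y by - Q x,
   then x by Q^T y, which exchanges the roles of Q x and y. *)
Lemma ge0_integral_Rk_rot k (g : 'cV[R]_k -> R) (Q : 'M[R]_k) : Q^T *m Q = 1%:M ->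
  continuous g -> (forall v, 0 <= g v) ->
  (\int[mRk k]_z (g (Q *m Rk_vec z))%:E = \int[mRk k]_z (g (Rk_vec z))%:E)%E.
Proof.
move=> QQ cg g0; have QQ' : Q *m Q^T = 1%:M by exact: mulmx1C.
pose h (v : 'cV[R]_k) := expR (- dotp v v).
have h0 v : 0 <= h v by exact: expR_ge0.
have ch : continuous h by exact: gauss_dotp_continuous.
have hN v : h (- v) = h v.
  by rewrite /h /dotp; congr (expR (- _)); apply: eq_bigr => i _; rewrite !mxE mulrNN.
have hQ v : h (- (Q *m v)) = h v by rewrite hN /h dotp_orthogonal.
pose I := (\int[mRk k]_z (h (Rk_vec z))%:E)%E.
have IE : I = (Num.sqrt pi ^+ k)%:E by exact: integral_Rk_gauss.
have i0 : 0 < Num.sqrt pi ^+ k :> R by rewrite exprn_gt0// sqrtr_gt0 pi_gt0.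
have mv1 i j : measurable_fun setT (fun p : Rk k * Rk k => Rk_vec p.1 i j).
  exact: (measurableT_comp (measurable_Rk_vec i j) measurable_fst).
have mv2 i j : measurable_fun setT (fun p : Rk k * Rk k => Rk_vec p.2 i j).
  exact: (measurableT_comp (measurable_Rk_vec i j) measurable_snd).
have mcst (A : 'M[R]_k) i j : measurable_fun setT (fun p : Rk k * Rk k => A i j).
  exact: measurable_cst.
have mQ1 (A : 'M[R]_k) i j : measurable_fun setT (fun p : Rk k * Rk k => (A *m Rk_vec p.1) i j).
  exact: measurable_mulmx.
have swap (u w : Rk k -> Rk k -> 'cV[R]_k) :
    (forall i j, measurable_fun setT (fun p => u p.1 p.2 i j)) ->
    (forall i j, measurable_fun setT (fun p => w p.1 p.2 i j)) ->
    (\int[mRk k]_x \int[mRk k]_y (g (u x y) * h (w x y))%:E =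
     \int[mRk k]_y \int[mRk k]_x (g (u x y) * h (w x y))%:E)%E.
  move=> mu mw.
  apply: (fubini_tonelli (fun p : Rk k * Rk k => (g (u p.1 p.2) * h (w p.1 p.2))%:E)).
    apply/measurable_EFinP; apply: measurable_funM; exact: measurable_continuous_mx.
  by move=> p; rewrite lee_fin mulr_ge0.
have cshift (u : 'cV[R]_k -> 'cV[R]_k) (w : 'cV[R]_k -> 'cV[R]_k) : continuous u -> continuous w ->
    continuous (fun v => g (u v) * h (w v)).
  move=> cu cw v.
  have h1 := @continuous_comp _ _ _ u g v (cu v) (cg (u v)).
  have h2 := @continuous_comp _ _ _ w h v (cw v) (ch (w v)).
  exact: (cvgM h1 h2).
have caff (A : 'M[R]_k) (c : 'cV[R]_k) : continuous (fun v => A *m v + c).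
  by move=> v; exact: (cvgD (@mulmx_continuous _ _ _ _ A v) (cvg_cst c)).
have gh0 (u v : 'cV[R]_k) : 0 <= g u * h v by rewrite mulr_ge0.
have shift (u w : 'cV[R]_k -> 'cV[R]_k) (c : 'cV[R]_k) : continuous u -> continuous w ->
   (\int[mRk k]_z (g (u (Rk_vec z)) * h (w (Rk_vec z)))%:E =
    \int[mRk k]_z (g (u (Rk_vec z + c)%R) * h (w (Rk_vec z + c)%R))%:E)%E.
  move=> cu cw; rewrite (ge0_integral_Rk_shift c (cshift u w cu cw))//.
have e : ((\int[mRk k]_z (g (Q *m Rk_vec z))%:E) * I = (\int[mRk k]_z (g (Rk_vec z))%:E) * I)%E.
  have prodI (u : Rk k -> 'cV[R]_k) : (forall i j, measurable_fun setT (fun p => u p i j)) ->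
      ((\int[mRk k]_z (g (u z))%:E) * I = \int[mRk k]_x \int[mRk k]_y (g (u x) * h (Rk_vec y))%:E)%E.
    move=> mu; rewrite -ge0_integralZr//; last 3 first.
    - by apply/measurable_EFinP; exact: measurable_continuous_mx.
    - by move=> z _; rewrite lee_fin.
    - by rewrite IE lee_fin ltW.
    apply: eq_integral => x _; rewrite /I -ge0_integralZl//.
    - by apply/measurable_EFinP; exact: measurable_cont_Rk.
    - by move=> z _; rewrite lee_fin.
    - by rewrite lee_fin.
  rewrite prodI; last by move=> i j; apply: measurable_mulmx => // *; exact: measurable_Rk_vec.
  rewrite prodI; last by move=> i j; exact: measurable_Rk_vec.
  have mA i j : measurable_fun setT (fun p : Rk k * Rk k => (Q *m Rk_vec p.1 + Rk_vec p.2) i j).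
    exact: measurable_addmx.
  have mB i j : measurable_fun setT (fun p : Rk k * Rk k => (Rk_vec p.2 - Q *m Rk_vec p.1) i j).
    rewrite (_ : (fun p => _) = (fun p : Rk k * Rk k => (Rk_vec p.2 + (- Q) *m Rk_vec p.1) i j)).
      exact: measurable_addmx.
    by apply/funext => p; rewrite mulNmx.
  apply: (etrans (swap (fun x _ => Q *m Rk_vec x) (fun _ y => Rk_vec y) (mQ1 Q) mv2)).
  transitivity (\int[mRk k]_y \int[mRk k]_x (g (Q *m Rk_vec x + Rk_vec y) * h (Rk_vec y))%:E)%E.
    apply: eq_integral => y _.
    apply: (etrans (shift (fun v => Q *m v) (fun=> Rk_vec y) (Q^T *m Rk_vec y) _ _)).
    - exact: mulmx_continuous.
    - exact: cst_continuous.
    - by apply: eq_integral => x _; rewrite mulmxDr mulmxA QQ' mul1mx.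
  apply: (etrans (esym (swap (fun x y => Q *m Rk_vec x + Rk_vec y) (fun _ y => Rk_vec y) mA mv2))).
  transitivity (\int[mRk k]_x \int[mRk k]_y (g (Rk_vec y) * h (Rk_vec y - Q *m Rk_vec x))%:E)%E.
    apply: eq_integral => x _.
    apply: (etrans (shift (fun v => Q *m Rk_vec x + v) id (- (Q *m Rk_vec x)) _ _)).
    - by under eq_fun do rewrite addrC; exact: addmx_continuous.
    - by move=> v; exact: cvg_id.
    - by apply: eq_integral => y _; rewrite addrC subrK.
  apply: (etrans (swap (fun _ y => Rk_vec y) (fun x y => Rk_vec y - Q *m Rk_vec x) mv2 mB)).
  apply: eq_integral => y _.
  apply: (etrans (shift (fun=> Rk_vec y) (fun v => Rk_vec y - Q *m v) (Q^T *m Rk_vec y) _ _)).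
  - exact: cst_continuous.
  - rewrite (_ : (fun v => _) = (fun v => (- Q) *m v + Rk_vec y)); first exact: caff.
    by apply/funext => v; rewrite mulNmx addrC.
  - apply: eq_integral => x _; congr (EFin (_ * _)).
    by rewrite mulmxDr mulmxA QQ' mul1mx opprD addrCA subrr addr0 hQ.
(* The Gaussian integral is finite and nonzero, so it can be cancelled even if the other factors are
   infinite. *)
move: e; rewrite IE; move: (\int[_]_z _)%E (\int[_]_z _)%E => A B /(congr1 (fun z => z * ((Num.sqrt pi ^+ k)^-1)%:E)%E).
by rewrite -!muleA -!EFinM mulfV ?gt_eqF// !mule1.
Qed.

End RkRotation.

(** * Polar coordinates *)

Section Radial.
Context {R : realType}.
Local Notation leb := (@lebesgue_measure R).
Local Notation Rk k := (ms_carrier (@Rk_space R k)).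
Local Notation mRk k := (ms_measure (@Rk_space R k)).

Lemma ge0_integral_even (f : R -> \bar R) : measurable_fun [set: R] f ->
  (forall x, 0 <= f x)%E -> (forall x, f (- x) = f x) ->
  (\int[leb]_x f x = 2%:E * \int[leb]_(x in `]0%R, +oo[) f x)%E.
Proof.
move=> mf f0 fN.
rewrite -(setUv `]-oo, 0%R]%classic) ge0_integral_setU//; last 3 first.
- exact: measurableC.
- by rewrite setUv.
- exact/disj_setPCl.
rewrite setCitvl /= -integral_itv_bndo_bndc; last exact: measurable_funTS.
rewrite mule_natl mule2n; congr (_ + _)%E.
rewrite ge0_integral_opp//; last exact: measurable_funTS.
rewrite (_ : [set x | _] = `]0%R, +oo[%classic); first by apply: eq_integral => x _; rewrite fN.
by apply/seteqP; split=> x; rewrite /= !in_itv/= andbT oppr_lt0.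
Qed.

Lemma sqrt_sum_cont (r : R) : continuous (fun y : R => Num.sqrt (r ^+ 2 + y ^+ 2)).
Proof.
move=> y; apply: (@continuous_comp _ _ _ (fun y : R => r ^+ 2 + y ^+ 2) Num.sqrt).
  by apply: cvgD; [exact: cvg_cst|exact: exprn_continuous].
exact: sqrt_continuous.
Qed.

Lemma radial_half_line (phi : R -> R) (r : R) : 0 < r -> continuous phi ->
  (forall s, 0 <= phi s) ->
  (\int[leb]_(y in `]0%R, +oo[) (phi (Num.sqrt (r ^+ 2 + y ^+ 2)))%:E =
   \int[leb]_(s in `]r, +oo[) (phi s * (s * (s ^+ 2 - r ^+ 2) `^ (2^-1 - 1)))%:E)%E.
Proof.
move=> r0 cphi phi0.
pose N (y : R) := Num.sqrt (r ^+ 2 + y ^+ 2).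
pose dN (y : R) := y / N y.
pose g (s : R) := phi s * (s * (s ^+ 2 - r ^+ 2) `^ (2^-1 - 1)).
have p0 y : 0 < r ^+ 2 + y ^+ 2 by rewrite ltr_wpDr ?sqr_ge0// exprn_gt0.
have N0 y : 0 < N y by rewrite sqrtr_gt0.
have N2 y : N y ^+ 2 = r ^+ 2 + y ^+ 2 by rewrite sqr_sqrtr// ltW.
have cN : continuous N by exact: sqrt_sum_cont.
have der (y : R) : y \in `[0%R, +oo[ -> is_derive y 1 N (dN y).
  move=> _.
  have h1 : is_derive y 1 (cst (r ^+ 2) + id ^+ 2 : R -> R) (2 * y).
    by apply: is_derive_eq; rewrite add0r expr1 /GRing.scale/= mulr1.
  have h2 := is_derive1_sqrt (p0 y).
  have h := @is_derive1_comp R Num.sqrt (cst (r ^+ 2) + id ^+ 2) y _ _ h2 h1.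
  rewrite (_ : N = Num.sqrt \o (cst (r ^+ 2) + id ^+ 2 : R -> R))//.
  by apply: (is_derive_eq h); rewrite /dN /GRing.scale /= -[Num.sqrt _]/(N y); field; rewrite gt_eqF.
have N0r : N 0 = r by rewrite /N expr0n addr0 sqrtr_sqr gtr0_norm.
have := @ge0_integral_subst_oy R N dN g 0%R der.
rewrite N0r -/g => ->.
- apply: eq_integral => y; rewrite inE/= in_itv/= andbT => y0.
  rewrite /g /dN N2 -/(N y) (_ : r ^+ 2 + y ^+ 2 - r ^+ 2 = y ^+ 2); last by ring.
  rewrite (_ : 2^-1 - 1 = - 2^-1); last by field.
  rewrite powRN powR12_sqrt ?sqr_ge0// sqrtr_sqr gtr0_norm//; congr EFin.
  by field; rewrite !gt_eqF.
- move=> y _; apply: cvgM; first exact: cvg_id.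
  by apply: cvgV; [rewrite gt_eqF|exact: cN].
- by move=> y; rewrite in_itv/= andbT => y0; rewrite divr_gt0.
- move=> M; exists (`|M| + 1); first by rewrite ltr_wpDl.
  apply: (@lt_le_trans _ _ (Num.sqrt ((`|M| + 1) ^+ 2))).
    by rewrite sqrtr_sqr ger0_norm ?addr_ge0// (le_lt_trans (ler_norm _))// ltrDl.
  by rewrite ler_wsqrtr// lerDr sqr_ge0.
- move=> s; rewrite in_itv/= andbT => rs; apply: cvgM; first exact: cphi.
  apply: cvgM; first exact: cvg_id.
  apply: (@continuous_comp _ _ _ (fun s : R => s ^+ 2 - r ^+ 2) (fun u : R => u `^ (2^-1 - 1))).
    by apply: cvgB; [exact: exprn_continuous|exact: cvg_cst].
  by apply: powR_cont; nra.
- move=> s; rewrite in_itv/= andbT => rs.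
  by rewrite mulr_ge0// mulr_ge0 ?powR_ge0// ltW// (lt_trans r0).
Qed.

(** The substitution is [u = y^2 / L^2]. This is the integral over one coordinate in the induction
    for polar coordinates. *)
Lemma beta_half (a L : R) : 0 < L ->
  (\int[leb]_(y in `]0%R, L[) ((L ^+ 2 - y ^+ 2) `^ (a - 1))%:E =
   (2^-1 * L `^ (2 * a - 1))%:E * BetaE 2^-1 a)%E.
Proof.
move=> L0; pose phi (y : R) := L ^- 2 * y ^+ 2.
pose dphi (y : R) := L ^- 2 * (2 * y).
have L2 : 0 < L ^- 2 by rewrite invr_gt0 exprn_gt0.
have der (y : R) : y \in `[0, L] -> is_derive y 1 phi (dphi y).
  move=> _; rewrite (_ : phi = L ^- 2 \*: (id ^+ 2))//.
  by apply: is_derive_eq; rewrite /dphi /GRing.scale/= expr1 mulr1.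
apply: (BetaE_subst L0 _ der).
- by rewrite mulr_gt0// powR_gt0.
- by move=> y _; apply: cvgM; [exact: cvg_cst|apply: cvgM; [exact: cvg_cst|exact: cvg_id]].
- by move=> y; rewrite in_itv/= => /andP[y0 _]; rewrite /dphi !mulr_gt0.
- by rewrite /phi expr0n mulr0.
- by rewrite /phi mulVf// expf_neq0// gt_eqF.
- apply: measurable_funTS.
  have mB : measurable_fun [set: R] (fun y : R => L ^+ 2 - y ^+ 2).
    by apply: measurable_funB; [exact: measurable_cst|exact: measurable_funX].
  exact: (measurableT_comp (@measurable_powR R (a - 1)) mB).
move=> y y0 yL.
have e1 : 0 < L ^+ 2 - y ^+ 2 by nra.
have -> : 1 - phi y = L ^- 2 * (L ^+ 2 - y ^+ 2).
  by rewrite /phi; field; rewrite gt_eqF.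
have -> : dphi y = 2 * expR (ln y - (ln L + ln L)).
  by rewrite /dphi expRD expRN expRD !lnK ?posrE//; field; rewrite gt_eqF.
rewrite /phi !powR_expR ?mulr_gt0 ?exprn_gt0//.
rewrite !lnM ?posrE ?exprn_gt0// !lnV ?posrE ?exprn_gt0// !lnXn// !mulr2n.
move: (ln L) (ln y) (ln (L ^+ 2 - y ^+ 2)) => l Y A.
have halves (x1 x2 x3 x4 : R) : (1 + 1)^-1 * x1 * (x2 * x3 * ((1 + 1) * x4)) = x1 * x2 * x3 * x4.
  by field.
by rewrite halves -!expRD; congr expR; field.
Qed.

End Radial.

Section RadialFormula.
Context {R : realType}.
Local Notation leb := (@lebesgue_measure R).
Local Notation Rk k := (ms_carrier (@Rk_space R k)).
Local Notation mRk k := (ms_measure (@Rk_space R k)).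

(** The area of the unit sphere of R^k, written so that the factor [2 / Gamma] of [EK_integral]
    splits off. *)
Definition radial_const (k : nat) : R := pi `^ (k%:R / 2) * (2 / Gamma (k%:R / 2)).

Lemma Gamma_half : Gamma 2^-1 = Num.sqrt pi :> R.
Proof. by rewrite -[LHS]/(fine (GammaE 2^-1)) GammaE_half. Qed.

Lemma radial_const1 : radial_const 1 = 2.
Proof.
rewrite /radial_const mul1r powR12_sqrt ?pi_ge0// Gamma_half; field.
by rewrite gt_eqF// sqrtr_gt0 pi_gt0.
Qed.

Lemma radial_constS k : (0 < k)%N ->
  ((radial_const k)%:E * BetaE 2^-1 (k%:R / 2) = (radial_const k.+1)%:E :> \bar R)%E.
Proof.
move=> k0; have ok : Gamma_convergent (k%:R / 2 : R) by rewrite -(prednK k0); exact: Gamma_convergent_half.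
have ok1 : Gamma_convergent (2^-1 : R) by rewrite -[2^-1]mul1r; exact: (Gamma_convergent_half 0).
have [okS ->] := Gamma_convergentD ok1 ok.
have e : k.+1%:R / 2 = 2^-1 + k%:R / 2 :> R by rewrite -natr1; field.
rewrite -EFinM; congr EFin; rewrite /radial_const e.
rewrite [in RHS]powRD; last by rewrite (gt_eqF (pi_gt0 R)) implybT.
rewrite powR12_sqrt ?pi_ge0// -Gamma_half.
move: ok.2 okS.2; move: (Gamma (k%:R / 2)) (Gamma (2^-1 + _)) (Gamma 2^-1) (pi `^ _).
move=> A B C E A0 B0; field.
by rewrite !gt_eqF.
Qed.

Lemma measurable_radial k (phi : R -> R) (r : R) : continuous phi ->
  measurable_fun setT (fun z : Rk k =>
    (phi (Num.sqrt (r ^+ 2 + dotp (Rk_vec z) (Rk_vec z))))%:E).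
Proof.
move=> cphi; apply/measurable_EFinP.
apply: (@measurable_cont_Rk R k (fun v => phi (Num.sqrt (r ^+ 2 + dotp v v)))) => v.
have h1 : {for v, continuous (fun v : 'cV[R]_k => r ^+ 2 + dotp v v)}.
  exact: (cvgD (cvg_cst _) (@dotp_continuous R k v)).
have h2 := @continuous_comp _ _ _ (fun v : 'cV[R]_k => r ^+ 2 + dotp v v) Num.sqrt v h1 (@sqrt_continuous R _).
exact: (@continuous_comp _ _ _ _ phi v h2 (cphi _)).
Qed.

Lemma ge0_integral_radialS k (phi : R -> R) (r : R) : continuous phi ->
  (forall s, 0 <= phi s) ->
  (\int[mRk k.+1]_z (phi (Num.sqrt (r ^+ 2 + dotp (Rk_vec z) (Rk_vec z))))%:E =
   2%:E * \int[leb]_(y in `]0%R, +oo[) \int[mRk k]_z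
     (phi (Num.sqrt (Num.sqrt (r ^+ 2 + y ^+ 2) ^+ 2 + dotp (Rk_vec z) (Rk_vec z))))%:E)%E.
Proof.
move=> cphi phi0.
have mS := @measurable_radial k.+1 phi r cphi.
have S0 (z : Rk k.+1) : (0 <= (phi (Num.sqrt (r ^+ 2 + dotp (Rk_vec z) (Rk_vec z))))%:E)%E.
  by rewrite lee_fin.
have sec (y : R) (z : Rk k) :
    r ^+ 2 + dotp (Rk_vec ((y, z) : Rk k.+1)) (Rk_vec ((y, z) : Rk k.+1)) =
    Num.sqrt (r ^+ 2 + y ^+ 2) ^+ 2 + dotp (Rk_vec z) (Rk_vec z).
  by rewrite sqr_sqrtr ?addr_ge0 ?sqr_ge0//= dotp_col_mx addrA.
rewrite ge0_integral_RkS// ge0_integral_even.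
- apply: (congr1 (fun x => 2%:E * x)%E); apply: eq_integral => y _.
  by apply: eq_integral => z _; rewrite sec.
- exact: (measurable_fun_RkS mS S0).
- by move=> y; apply: integral_ge0 => z _.
- by move=> y; apply: eq_integral => z _; rewrite !sec sqrrN.
Qed.

(** Induction on [k] with [r] general: the first coordinate [y] is absorbed into the radius, which
    becomes [sqrt (r^2 + y^2)], and the induction hypothesis handles the other coordinates. After an
    exchange the integral in [y] runs up to [sqrt (s^2 - r^2)] and is a Beta integral. No measure on
    the sphere enters, and the kernel of the Erdelyi-Kober integral appears directly. *)
Lemma ge0_integral_radial k (phi : R -> R) (r : R) : (0 < k)%N -> 0 < r ->
  continuous phi -> (forall s, 0 <= phi s) ->
  (\int[mRk k]_z (phi (Num.sqrt (r ^+ 2 + dotp (Rk_vec z) (Rk_vec z))))%:E =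
   (radial_const k)%:E * \int[leb]_(s in `]r, +oo[)
      (phi s * (s * (s ^+ 2 - r ^+ 2) `^ (k%:R / 2 - 1)))%:E)%E.
Proof.
case: k => // k _ r0 cphi phi0.
elim: k r r0 => [|k ih] r r0.
  rewrite ge0_integral_radialS// radial_const1; congr (_ * _)%E.
  rewrite mul1r -radial_half_line//.
  apply: eq_integral => y _; rewrite integral_Rk0 /dotp big_ord0 addr0.
  by rewrite sqrtr_sqr ger0_norm// sqrtr_ge0.
rewrite ge0_integral_radialS//.
set a : R := k.+1%:R / 2 in ih *.
pose N (y : R) := Num.sqrt (r ^+ 2 + y ^+ 2).
have p0 y : 0 < r ^+ 2 + y ^+ 2 by rewrite ltr_wpDr ?sqr_ge0// exprn_gt0.
have N0 y : 0 < N y by rewrite sqrtr_gt0.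
have N2 y : N y ^+ 2 = r ^+ 2 + y ^+ 2 by rewrite sqr_sqrtr// ltW.
pose D : set (measurableTypeR R * measurableTypeR R) := [set p | 0 < p.1 /\ N p.1 < p.2].
pose kap (p : measurableTypeR R * measurableTypeR R) : \bar R :=
  (phi p.2 * (p.2 * (p.2 ^+ 2 - (r ^+ 2 + p.1 ^+ 2)) `^ (a - 1)))%:E.
have m1 : measurable_fun setT (fst : measurableTypeR R * measurableTypeR R -> R) by exact: measurable_fst.
have m2 : measurable_fun setT (snd : measurableTypeR R * measurableTypeR R -> R) by exact: measurable_snd.
have mD : measurable D.
  rewrite (_ : D = (fst @^-1` `]0%R, +oo[%classic) `&`
     ((fun p => p.2 - N p.1) @^-1` `]0%R, +oo[%classic)).
    apply: measurableI; rewrite -[X in measurable X]setTI.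
      by apply: measurable_fst => //; exact: measurable_itv.
    have mB : measurable_fun setT (fun p : measurableTypeR R * measurableTypeR R => (p.2 - N p.1) : measurableTypeR R).
      apply: measurable_funB => //.
      have mN : measurable_fun [set: R] N by apply: continuous_measurable_fun; exact: sqrt_sum_cont.
      exact: (measurableT_comp mN m1).
    by apply: mB => //; exact: measurable_itv.
  by apply/seteqP; split => -[x y]; rewrite /D/= !in_itv/= !andbT subr_gt0.
have mkap : measurable_fun D kap.
  apply: measurable_funTS; apply/measurable_EFinP; apply: measurable_funM.
    exact: (measurableT_comp (continuous_measurable_fun cphi) m2).
  apply: measurable_funM => //.
  have mB : measurable_fun setT (fun p : measurableTypeR R * measurableTypeR R => p.2 ^+ 2 - (r ^+ 2 + p.1 ^+ 2)).
    apply: measurable_funB; first exact: measurable_funX.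
    by apply: measurable_funD; [exact: measurable_cst|exact: measurable_funX].
  exact: (measurableT_comp (@measurable_powR R (a - 1)) mB).
have kap0 p : D p -> (0 <= kap p)%E.
  move=> [_ Np]; rewrite lee_fin mulr_ge0// mulr_ge0 ?powR_ge0//.
  by rewrite ltW// (lt_trans (N0 p.1)).
have toD (c : R) (u v : R -> \bar R) : (forall z, c < z -> u z = v z) ->
    (forall z, ~ (c < z) -> u z = 0%E) -> (\int[leb]_z u z = \int[leb]_(z in `]c, +oo[) v z)%E.
  move=> uv u0; rewrite [RHS]integral_mkcond; apply: eq_integral => z _.
  rewrite patchE; case: ifPn => [|/negP]; rewrite inE/= in_itv/= andbT => tz.
    exact: uv.
  exact: u0.
have rc0 j : 0 <= radial_const j.+1.
  by rewrite mulr_ge0 ?powR_ge0// divr_ge0// ltW//; have [] := @Gamma_convergent_half R j.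
have ihE y : 0 < y ->
    (\int[mRk k.+1]_z (phi (Num.sqrt (N y ^+ 2 + dotp (Rk_vec z) (Rk_vec z))))%:E =
     (radial_const k.+1)%:E * \int[leb]_(s in [set s | D (y, s)]) kap (y, s))%E.
  move=> y0; rewrite (ih _ (N0 y)); apply: (congr1 (fun x => (radial_const k.+1)%:E * x)%E).
  have -> : [set s | D (y, s)] = `]N y, +oo[%classic.
    by apply/seteqP; split=> s; rewrite /D /= in_itv/= andbT // => -[].
  by apply: eq_integral => s _; rewrite /kap N2.
pose FF (y : measurableTypeR R) := (\int[leb]_(s in [set s | D (y, s)]) kap (y, s))%E.
have mF : measurable_fun [set: R] FF.
  pose kap' := (kap \_ D)%E.
  have mk' : measurable_fun setT kap' by apply/(measurable_restrictT _ _).1.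
  have k'0 p : (0 <= kap' p)%E by exact: erestrict_ge0.
  rewrite (_ : FF = (fun y => \int[leb]_s kap' (y, s))%E).
    exact: (measurable_fun_fubini_tonelli_F kap' mk' k'0).
  apply/funext => y; rewrite /FF integral_mkcond; apply: eq_integral => s _.
  rewrite /kap' !patchE; congr (if _ then _ else _).
transitivity (2%:E * ((radial_const k.+1)%:E *
    \int[leb]_(y in `]0%R, +oo[) FF y))%E.
  apply: (congr1 (fun x => 2%:E * x)%E); rewrite -ge0_integralZl//.
  - by apply: eq_integral => y; rewrite inE/= in_itv/= andbT => y0; rewrite -/(N y) ihE.
  - exact: measurable_funTS.
  - by move=> y _; apply: integral_ge0 => s Ds; exact: kap0.
  - by rewrite lee_fin.
have FT : (\int[leb]_(y in `]0%R, +oo[) FF y = \int[leb]_y FF y)%E.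
  apply/esym/toD => // y y0; rewrite /FF; have -> : [set s | D (y, s)] = set0 by apply/seteqP; split=> // s [].
  by rewrite integral_set0.
rewrite FT (tonelli_on mD mkap kap0).
pose L (s : R) := Num.sqrt (s ^+ 2 - r ^+ 2).
have inner s : r < s -> (\int[leb]_(y in [set y | D (y, s)]) kap (y, s) =
    (2^-1 * (phi s * (s * (s ^+ 2 - r ^+ 2) `^ (k.+2%:R / 2 - 1))))%:E * BetaE 2^-1 a)%E.
  move=> rs; have s0 : 0 < s by exact: lt_trans rs.
  have q0 : 0 < s ^+ 2 - r ^+ 2 by nra.
  have L0 : 0 < L s by rewrite sqrtr_gt0.
  have L2 : L s ^+ 2 = s ^+ 2 - r ^+ 2 by rewrite sqr_sqrtr// ltW.
  have -> : [set y | D (y, s)] = `]0, L s[%classic.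
    apply/seteqP; split=> y; rewrite /D /= in_itv/=.
      move=> [y0 Ns]; rewrite y0 /=.
      have : N y ^+ 2 < s ^+ 2 by rewrite ltr_pXn2r ?nnegrE ?(ltW (N0 y)) ?(ltW s0).
      rewrite N2 => h; rewrite -(@ltr_pXn2r _ 2) ?nnegrE ?(ltW L0) ?(ltW y0)// L2; lra.
    move=> /andP[y0 yL]; split=> //.
    have : y ^+ 2 < L s ^+ 2 by rewrite ltr_pXn2r ?nnegrE ?(ltW y0) ?(ltW L0).
    rewrite L2 => h; rewrite -(@ltr_pXn2r _ 2) ?nnegrE ?(ltW (N0 y)) ?(ltW s0)// N2; lra.
  transitivity (\int[leb]_(y in `]0%R, L s[) ((phi s * s)%:E * ((L s ^+ 2 - y ^+ 2) `^ (a - 1))%:E))%E.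
    apply: eq_integral => y _; rewrite /kap -EFinM L2 /=; congr EFin.
    by rewrite mulrA opprD addrA.
  rewrite ge0_integralZl//; last 3 first.
  - apply/measurable_EFinP; apply: measurable_funTS.
    have mB : measurable_fun [set: R] (fun y : R => L s ^+ 2 - y ^+ 2).
      by apply: measurable_funB; [exact: measurable_cst|exact: measurable_funX].
    exact: (measurableT_comp (@measurable_powR R (a - 1)) mB).
  - by move=> y _; rewrite lee_fin powR_ge0.
  - by rewrite lee_fin mulr_ge0// ltW.
  rewrite beta_half// muleA -EFinM; congr (_%:E * _)%E.
  have -> : L s `^ (2 * a - 1) = (s ^+ 2 - r ^+ 2) `^ (k.+2%:R / 2 - 1).
    rewrite -L2 -(powR_mulrn _ (ltW L0)) -powRrM; congr (_ `^ _).
    by rewrite /a -[k.+2%:R]natr1; field.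
  by ring.
rewrite (toD r _ (fun s => (2^-1 * (phi s * (s * (s ^+ 2 - r ^+ 2) `^ (k.+2%:R / 2 - 1))))%:E * BetaE 2^-1 a)%E)//; last first.
  move=> s rs; have -> : [set y | D (y, s)] = set0.
    apply/seteqP; split=> // y [/= y0 Ns]; apply: rs; apply: le_lt_trans Ns.
    rewrite -(@ler_pXn2r _ 2) ?nnegrE ?(ltW (N0 y)) ?(ltW r0)// N2.
    by rewrite lerDl sqr_ge0.
  by rewrite integral_set0.
have B0 : (0 <= BetaE 2^-1 a)%E by rewrite ltW// BetaE_gt0.
have mg : measurable_fun `]r, +oo[ (fun s => phi s * (s * (s ^+ 2 - r ^+ 2) `^ (k.+2%:R / 2 - 1))).
  apply: measurable_funTS; apply: measurable_funM; first exact: continuous_measurable_fun.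
  apply: measurable_funM => //.
  have mB : measurable_fun [set: R] (fun s : R => s ^+ 2 - r ^+ 2).
    by apply: measurable_funB; [exact: measurable_funX|exact: measurable_cst].
  exact: (measurableT_comp (@measurable_powR R (k.+2%:R / 2 - 1)) mB).
have g0 s : `]r, +oo[%classic s -> 0 <= phi s * (s * (s ^+ 2 - r ^+ 2) `^ (k.+2%:R / 2 - 1)).
  rewrite /= in_itv/= andbT => rs; rewrite mulr_ge0// mulr_ge0 ?powR_ge0//.
  by rewrite ltW// (lt_trans r0).
rewrite ge0_integralZr//; last 2 first.
- by apply/measurable_EFinP; apply: measurable_funM => //; exact: measurable_cst.
- by move=> s rs; rewrite lee_fin mulr_ge0// g0.
transitivity (2%:E * ((radial_const k.+1)%:E * ((2^-1)%:E * (\int[leb]_(s in `]r, +oo[)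
    (phi s * (s * (s ^+ 2 - r ^+ 2) `^ (k.+2%:R / 2 - 1)))%:E) * BetaE 2^-1 a)))%E.
  apply: (congr1 (fun x => 2%:E * ((radial_const k.+1)%:E * (x * BetaE 2^-1 a)))%E).
  by rewrite -ge0_integralZl//; exact/measurable_EFinP.
rewrite -(@radial_constS k.+1)// -/a; set I := (\int[leb]_(_ in _) _)%E.
rewrite -[RHS]muleA [in RHS](muleC (BetaE _ _)).
rewrite [in LHS]muleCA; congr (_ * _)%E.
by rewrite !muleA -EFinM mulfV// mul1e.
Qed.

End RadialFormula.

(** * Decay at infinity *)

Section Decay.
Context {R : realType}.
Local Notation leb := (@lebesgue_measure R).

Lemma powRN_cvg0 (q : R) : 0 < q -> x `^ (- q) @[x --> +oo] --> (0 : R).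
Proof.
move=> q0; apply/cvgrPdist_lt => e e0; near=> x.
have x0 : 0 < x by near: x; exact: nbhs_pinfty_gt.
rewrite sub0r normrN ger0_norm ?powR_ge0// powR_expR//.
rewrite -[ltRHS]lnK ?posrE// ltr_expR mulNr ltrNl -ltr_pdivrMl//.
rewrite -ltr_expR lnK ?posrE//; near: x.
Unshelve. all: end_near. Qed.

Lemma integral_powR_oy (p c : R) : 1 < p -> 0 < c ->
  (\int[leb]_(x in `]c, +oo[) (x `^ (- p))%:E < +oo)%E.
Proof.
move=> p1 c0.
have p0 : 0 < p - 1 by lra.
have mp : measurable_fun [set: R] (fun x : R => x `^ (- p)) by exact: measurable_powR.
rewrite integral_itv_obnd_cbnd; last by apply/measurable_EFinP; exact: measurable_funTS.
pose P (x : R) := - ((p - 1)^-1 * x `^ (- (p - 1))).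
have der (x : R) : 0 < x -> is_derive x 1 P (x `^ (- p)).
  move=> x0; have h := is_derive1_powR (- (p - 1)) x0.
  rewrite (_ : P = - ((p - 1)^-1 \*: (fun x => x `^ (- (p - 1)))))//.
  apply: is_derive_eq; rewrite /GRing.scale/= mulrA -mulNr mulrN opprK mulVf ?mul1r ?gt_eqF//.
  by congr (_ `^ _); ring.
have cP (x : R) : 0 < x -> {for x, continuous P}.
  by move=> x0; have [h _] := der x x0; apply/differentiable_continuous/derivable1_diffP.
rewrite (@ge0_continuous_FTC2y R (fun x : R => x `^ (- p)) P c 0).
- by rewrite -EFinB ltry.
- by move=> x _; exact: powR_ge0.
- apply: continuous_in_subspaceT => x; rewrite inE/= in_itv/= andbT => cx.
  by apply: powR_cont; exact: lt_le_trans cx.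
- rewrite -oppr0; apply: cvgN; rewrite -(mulr0 (p - 1)^-1); apply: cvgM; first exact: cvg_cst.
  exact: powRN_cvg0.
- by move=> x cx; have [] := der x (lt_trans c0 cx).
- by apply: cvg_at_right_filter; exact: cP.
- move=> x; rewrite in_itv/= andbT => cx; have h := der x (lt_trans c0 cx).
  by rewrite derive1E derive_val.
Qed.

(** The ray is cut at [R1]. Below it [phi] is bounded and the possible singularity of the weight at
    [r] is integrable; above it the weight is [O(s^(2al - 1))], which leaves the power
    [-(mu - 2al + 1)], below [-1]. *)
Lemma decay_integrable (al mu K B S : R) (phi : R -> R) :
  Gamma_convergent al -> 0 < al -> 2 * al < mu -> 0 < S ->
  (forall x : R, 0 < x -> {for x, continuous phi}) ->
  (forall s, `|phi s| <= B) -> (forall s, S <= s -> `|phi s| <= K * s `^ (- mu)) ->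
  forall r : R, 0 < r ->
  leb.-integrable `]r, +oo[ (EFin \o (fun s => phi s * (s * (s ^+ 2 - r ^+ 2) `^ (al - 1)))).
Proof.
move=> okal al0 almu S0 cphi Bphi Kphi r r0.
pose w s := s * (s ^+ 2 - r ^+ 2) `^ (al - 1).
pose R1 := Num.max S (2 * r).
have R1S : S <= R1 by rewrite le_max lexx.
have R1r : 2 * r <= R1 by rewrite le_max lexx orbT.
have R10 : 0 < R1 by exact: lt_le_trans R1S.
have rR1 : r < R1 by lra.
have mw (D : set R) : measurable_fun D w.
  apply: measurable_funTS; apply: measurable_funM => //.
  have mB : measurable_fun [set: R] (fun s : R => s ^+ 2 - r ^+ 2).
    by apply: measurable_funB; [exact: measurable_funX|exact: measurable_cst].
  exact: (measurableT_comp (@measurable_powR R (al - 1)) mB).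
have mphi : measurable_fun `]r, +oo[ phi by apply: continuous_measurable_oy => //; exact: ltW.
have w0 s : r < s -> 0 <= w s.
  by move=> rs; rewrite mulr_ge0 ?powR_ge0// ltW// (lt_trans r0).
have B0 : 0 <= B by exact: le_trans (Bphi 0).
have i1 : leb.-integrable `]r, R1[ (EFin \o w).
  apply/integrableP; split; first by apply/measurable_EFinP; exact: mw.
  (* For [a = 1] and [p = 0] the kernel reduces to the weight, whose integral is thus a multiple of
     the finite number [B(al, 1)]. *)
  have e : (\int[leb]_(y in `]r, R1[) `|(EFin \o w) y| =
      \int[leb]_(y in `]r, R1[) (EK_kernel 1 al 0 r (y, R1))%:E)%E.
    apply: eq_integral => y; rewrite inE/= in_itv/= => /andP[ry _].
    have y0 : 0 < y by exact: lt_trans ry.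
    rewrite ger0_norm ?w0// /EK_kernel /= subr0 powRr1 ?(ltW y0)// subrr powRr0 mulr1.
    by rewrite mulrC.
  rewrite e EK_kernel_integral0//.
  have ok1 : Gamma_convergent (1 : R).
    by have := @Gamma_convergent_half R 1; rewrite mulfV.
  have [_ ->] := Gamma_convergentD okal ok1.
  by rewrite -EFinM ltry.
have i1' : leb.-integrable `]r, R1[ (EFin \o (fun s => phi s * w s)).
  apply: (@dominated_integrable _ _ _ w B) => //.
    apply: measurable_funM; last exact: mw.
    apply: measurable_funS mphi => //.
    by apply: subset_itvl.
  by move=> s _; rewrite normrM ler_wpM2r.
pose p := mu - 2 * al + 1.
have p1 : 1 < p by rewrite /p; lra.
have ip : leb.-integrable `[R1, +oo[ (EFin \o (fun x => x `^ (- p))).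
  have mp : measurable_fun [set: R] (fun x : R => x `^ (- p)) by exact: measurable_powR.
  apply/integrableP; split; first by apply/measurable_EFinP; exact: measurable_funTS.
  have e : (\int[leb]_(y in `[R1, +oo[) `|(EFin \o (fun x : R => x `^ (- p))%R) y| =
      \int[leb]_(y in `[R1, +oo[) (y `^ (- p))%:E)%E.
    by apply: eq_integral => y _; rewrite /= ger0_norm// powR_ge0.
  rewrite e -integral_itv_obnd_cbnd; first exact: integral_powR_oy.
  by apply/measurable_EFinP; exact: measurable_funTS.
(* For [al >= 1] the bound [s^2 - r^2 <= s^2] suffices and uses the summand 1. For [al < 1] the
   power is decreasing, and [s >= 2 r] gives [s^2 - r^2 >= (3/4) s^2]. *)
pose C := 1 + (3 / 4) `^ (al - 1).
have i2 : leb.-integrable `[R1, +oo[ (EFin \o (fun s => phi s * w s)).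
  apply: (@dominated_integrable _ _ _ (fun x => x `^ (- p)) (K * C)) => //.
    apply: measurable_funM; last exact: mw.
    apply: measurable_funS mphi => //.
    by apply: subset_itvr; rewrite bnd_simp.
  move=> s; rewrite /= in_itv/= andbT => R1s.
  have s0 : 0 < s by exact: lt_le_trans R1s.
  have rs : r < s by exact: lt_le_trans R1s.
  have q0 : 0 < s ^+ 2 - r ^+ 2 by nra.
  have ws : w s <= C * s `^ (2 * al - 1).
    have -> : s `^ (2 * al - 1) = s * (s ^+ 2) `^ (al - 1).
      rewrite -[s ^+ 2](powR_mulrn _ (ltW s0)) -powRrM -{2}[s]powRr1 ?(ltW s0)//.
      rewrite -powRD ?(lt0r_neq0 s0) ?implybT//; congr (_ `^ _); ring.
    rewrite /w mulrCA ler_wpM2l ?(ltW s0)//.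
    have s20 : 0 <= s ^+ 2 by exact: sqr_ge0.
    have [a1|a1] := leP 1 al.
      apply: (@le_trans _ _ ((s ^+ 2) `^ (al - 1))).
        by apply: ge0_ler_powR; rewrite ?nnegrE ?subr_ge0 ?(ltW q0)//; nra.
      by rewrite /C mulrDl mul1r lerDl mulr_ge0 ?powR_ge0.
    apply: (@le_trans _ _ ((3 / 4 * s ^+ 2) `^ (al - 1))).
      rewrite (_ : al - 1 = - (1 - al)); last by ring.
      rewrite !powRN lef_pV2 ?posrE ?powR_gt0// ?mulr_gt0 ?exprn_gt0//.
      apply: ge0_ler_powR; rewrite ?nnegrE; [lra|lra|exact: ltW|nra].
    rewrite powRM ?s20 ?divr_ge0// /C [leRHS]mulrDl; apply: ler_wpDl => //.
    by rewrite mul1r powR_ge0.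
  rewrite normrM (ger0_norm (w0 _ rs)) (ger0_norm (powR_ge0 _ _)).
  apply: (@le_trans _ _ (K * s `^ (- mu) * (C * s `^ (2 * al - 1)))).
    apply: ler_pM => //; first exact: w0.
    by apply: Kphi; exact: le_trans R1s.
  rewrite mulrACA -powRD ?(lt0r_neq0 s0) ?implybT//.
  by rewrite (_ : - mu + (2 * al - 1) = - p) ?lexx// /p; ring.
have U : `]r, +oo[%classic = `]r, R1[%classic `|` `[R1, +oo[%classic :> set R.
  by rewrite -itv_bndbnd_setU// bnd_simp ltW.
have mw' : measurable_fun `]r, +oo[ (fun s => phi s * w s) by exact: measurable_funM.
apply/integrableP; split; first exact/measurable_EFinP.
rewrite U ge0_integral_setU//.
- by apply: lte_add_pinfty; [case/integrableP : i1'|case/integrableP : i2].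
- by rewrite -U; apply: measurableT_comp => //; exact/measurable_EFinP.
- apply/disj_setPRL => x /=; rewrite !in_itv/= andbT => h1 /andP[_ h2].
  by move: h1; rewrite leNgt h2.
Qed.

End Decay.

(** * The rotation group *)

Section SOMeasure.
Context {R : realType} {n : nat}.
Implicit Types g h : 'M[R]_n.

Lemma SO_trmx g : SO g -> SO g^T.
Proof. by move=> [gg dg]; split; rewrite ?trmxK ?det_tr//; exact: mulmx1C. Qed.

Lemma SO_trmx_mul g : SO g -> g^T *m g = 1%:M.
Proof. by case=> gg _; exact: mulmx1C. Qed.

Let coord (i j : 'I_n) : measurable_fun setT (fun g : @mxBorel R n => (g : 'M[R]_n) i j).
Proof. exact: measurable_mxBorel_coord. Qed.

Lemma measurable_det : measurable_fun setT (fun g : @mxBorel R n => \det (g : 'M[R]_n)).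
Proof.
rewrite /determinant; apply: measurable_sum => s; apply: measurable_funM.
  exact: measurable_cst.
by apply: measurable_prod => i _; exact: coord.
Qed.

Lemma measurable_SO : measurable (SO : set (@mxBorel R n)).
Proof.
have mtr i j : measurable_fun setT (fun g : @mxBorel R n => (g : 'M[R]_n)^T i j).
  by under eq_fun do rewrite mxE; exact: coord.
have mgg i j : measurable_fun setT (fun g : @mxBorel R n => ((g : 'M[R]_n) *m (g : 'M[R]_n)^T) i j).
  exact: measurable_mulmx.
rewrite (_ : SO = (\bigcap_(ij in [set: 'I_n * 'I_n])
   ((fun g : @mxBorel R n => ((g : 'M[R]_n) *m (g : 'M[R]_n)^T) ij.1 ij.2) @^-1` [set (1%:M : 'M[R]_n) ij.1 ij.2])) `&`
   ((fun g : @mxBorel R n => \det (g : 'M[R]_n)) @^-1` [set 1])).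
  apply: measurableI.
    apply: fin_bigcap_measurable => // -[i j] _.
    by rewrite -[X in measurable X]setTI; apply: mgg.
  by rewrite -[X in measurable X]setTI; apply: measurable_det.
apply/seteqP; split=> g /= [h1 h2]; split=> //; first by move=> [i j] _ /=; rewrite h1.
by apply/matrixP => i j; exact: (h1 (i, j)).
Qed.

Variable P : probability (@mxBorel R n) R.
Hypothesis HP : is_Haar_SO P.

Let PSO : P SO = 1%E. Proof. by case: HP. Qed.

Lemma integral_SO_setT (F : @mxBorel R n -> \bar R) : measurable_fun setT F ->
  (forall g, 0 <= F g)%E -> (\int[P]_(g in SO) F g = \int[P]_g F g)%E.
Proof.
move=> mF F0; have mSC : measurable (~` (SO : set (@mxBorel R n))) by apply: measurableC; exact: measurable_SO.
have PC : P (~` SO) = 0%E.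
  by rewrite probability_setC ?PSO ?subee//; exact: measurable_SO.
rewrite [RHS](@ge0_negligible_integral _ _ R P _ (~` SO))//.
by rewrite setDE setTI setCK.
Qed.

Lemma integral_SO_mull (h : 'M[R]_n) (F : 'M[R]_n -> \bar R) : SO h ->
  measurable_fun setT (F : @mxBorel R n -> \bar R) -> (forall g, 0 <= F g)%E ->
  (\int[P]_g F (h *m g) = \int[P]_g F g)%E.
Proof.
move=> Sh mF F0.
pose L (g : @mxBorel R n) : @mxBorel R n := h *m (g : 'M[R]_n).
have mL : measurable_fun setT L.
  apply: measurable_mxBorel; apply: measurable_mulmx => i j; first exact: measurable_cst.
  exact: coord.
have := @ge0_integral_pushforward _ _ _ _ R L mL P setT F measurableT mF.
move=> /(_ (fun y _ => F0 y)) e.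
transitivity (\int[pushforward P L]_g F g)%E; first exact/esym.
apply: eq_measure_integral => A mA _.
(* The preimage of [A] under multiplication by [h] is its image under [h^T], and invariance is
   stated for images. *)
have [_ /(_ h^T A (SO_trmx Sh) mA) e2] := HP.
apply: (etrans _ e2); congr (P _); apply/seteqP; split=> g /=.
  by move=> Lg; exists (L g) => //; rewrite /L mulmxA SO_trmx_mul// mul1mx.
by move=> [a Aa <-]; rewrite /L mulmxA; case: Sh => -> _; rewrite mul1mx.
Qed.

(* The measure is only assumed left invariant; integrating phi (x^T y v) over
   both x and y shows that the integrals of phi (g v) and phi (g^T v) agree. *)
Lemma integral_SO_mulr (phi : 'cV[R]_n -> R) (h : 'M[R]_n) (v : 'cV[R]_n) : SO h ->
  continuous phi -> (forall v, 0 <= phi v) ->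
  (\int[P]_g (phi (g *m (h *m v)))%:E = \int[P]_g (phi (g *m v))%:E)%E.
Proof.
move=> Sh cphi phi0.
pose Psi (v : 'cV[R]_n) : \bar R := (\int[P]_g (phi (g^T *m v))%:E)%E.
have mtr i j : measurable_fun setT (fun g : @mxBorel R n => (g : 'M[R]_n)^T i j).
  by under eq_fun do rewrite mxE; exact: coord.
have mg (v' : 'cV[R]_n) : measurable_fun setT (fun g : @mxBorel R n => (phi ((g : 'M[R]_n) *m v'))%:E).
  apply/measurable_EFinP; apply: measurable_continuous_mx => //.
  by apply: measurable_mulmx => i j; [exact: coord|exact: measurable_cst].
have mgt (v' : 'cV[R]_n) : measurable_fun setT (fun g : @mxBorel R n => (phi ((g : 'M[R]_n)^T *m v'))%:E).
  apply/measurable_EFinP; apply: measurable_continuous_mx => //.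
  by apply: measurable_mulmx => i j; [exact: mtr|exact: measurable_cst].
have PsiE (v' : 'cV[R]_n) k : SO k -> Psi (k *m v') = Psi v'.
  move=> Sk; rewrite /Psi -(@integral_SO_mull k^T (fun g => (phi (g^T *m v'))%:E) (SO_trmx Sk) (mgt v')); last first.
    by move=> g; rewrite lee_fin.
  by apply: eq_integral => g _; rewrite trmx_mul trmxK mulmxA.
have toPsi (v' : 'cV[R]_n) : (\int[P]_g (phi (g *m v'))%:E = Psi v')%E.
  pose W (p : @mxBorel R n * @mxBorel R n) := (phi ((p.1 : 'M[R]_n)^T *m ((p.2 : 'M[R]_n) *m v')))%:E.
  have mW : measurable_fun setT W.
    apply/measurable_EFinP; apply: measurable_continuous_mx => //.
    apply: measurable_mulmx => i j; first exact: (measurableT_comp (mtr i j) measurable_fst).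
    have mgv : measurable_fun setT (fun g : @mxBorel R n => ((g : 'M[R]_n) *m v') i j).
      by apply: measurable_mulmx => i' j'; [exact: coord|exact: measurable_cst].
    exact: (measurableT_comp mgv measurable_snd).
  have W0 p : (0 <= W p)%E by rewrite lee_fin.
  have sw := @fubini_tonelli _ _ _ _ R P P W mW W0.
  have c1 (c : \bar R) : (0 <= c)%E -> (\int[P]_(g in SO) c = c)%E.
    move=> c0; rewrite -[X in integral _ _ X]/(cst c) integral_cst; last exact: measurable_SO.
    by rewrite [X in (_ * X)%E](_ : _ = 1%E) ?mule1//.
  have m1 := @measurable_fun_fubini_tonelli_F _ _ _ _ R P W mW W0.
  have m2 := @measurable_fun_fubini_tonelli_G _ _ _ _ R P W mW W0.
  pose Fx (x : @mxBorel R n) := (\int[P]_y W (x, y))%E.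
  pose Fy (y : @mxBorel R n) := (\int[P]_x W (x, y))%E.
  have Fx0 x : (0 <= Fx x)%E by apply: integral_ge0 => y _; exact: W0.
  have Fy0 y : (0 <= Fy y)%E by apply: integral_ge0 => x _; exact: W0.
  have e1 : (\int[P]_(g in SO) Fx g = \int[P]_g Fx g)%E := integral_SO_setT m1 Fx0.
  have e2 : (\int[P]_(g in SO) Fy g = \int[P]_g Fy g)%E := integral_SO_setT m2 Fy0.
  have L0 : (0 <= \int[P]_g (phi (g *m v'))%:E)%E by apply: integral_ge0 => g _; rewrite lee_fin.
  have R0 : (0 <= Psi v')%E by apply: integral_ge0 => g _; rewrite lee_fin.
  (* Both outer integrals are restricted to [SO], because the inner ones are evaluated by left
     invariance, which requires [x] and [y] to be rotations. *)
  apply: (etrans (esym (c1 _ L0))); apply: (etrans _ (c1 _ R0)).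
  transitivity (\int[P]_(g in SO) Fx g)%E.
    apply: eq_integral => x; rewrite inE => Sx.
    have := @integral_SO_mull x^T (fun g => (phi (g *m v'))%:E) (SO_trmx Sx) (mg v').
    move=> <-; last by move=> g; rewrite lee_fin.
    by apply: eq_integral => y _; rewrite /W/= mulmxA.
  apply: (etrans e1); apply: (etrans sw); apply: (etrans (esym e2)).
  apply: eq_integral => y; rewrite inE => Sy.
  exact: (PsiE v' y Sy).
by rewrite !toPsi PsiE.
Qed.

End SOMeasure.

(** * Transitivity of SO(n) on the unit sphere *)

Section Rotations.
Context {R : realType}.

Lemma dotp_eq0 n (u : 'cV[R]_n) : dotp u u = 0 -> u = 0.
Proof.
move=> uu; apply/matrixP => i j; rewrite ord1 mxE.
have /eqP := uu; rewrite psumr_eq0; last by move=> l _; rewrite -expr2 sqr_ge0.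
by move=> /allP /(_ i (mem_index_enum _)); rewrite -expr2 sqrf_eq0 => /eqP.
Qed.

Lemma dotpC n (u v : 'cV[R]_n) : dotp u v = dotp v u.
Proof. by apply: eq_bigr => i _; rewrite mulrC. Qed.

Lemma dotpBl n (u v w : 'cV[R]_n) : dotp (u - v) w = dotp u w - dotp v w.
Proof. by rewrite -sumrB; apply: eq_bigr => i _; rewrite !mxE mulrBl. Qed.

Lemma dotp_stdvec n i (hi : (i < n)%N) (u : 'cV[R]_n) : dotp (stdvec i) u = u (Ordinal hi) 0.
Proof.
rewrite /dotp (bigD1 (Ordinal hi))//= mxE eqxx mul1r big1 ?addr0// => j ji.
by rewrite mxE (_ : (j == i :> nat) = false) ?mul0r//; apply/negbTE.
Qed.

Definition householder n (u : 'cV[R]_n) : 'M[R]_n := 1%:M - (2 / dotp u u) *: (u *m u^T).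

Lemma mul_householder n (u v : 'cV[R]_n) :
  householder u *m v = v - (2 / dotp u u * dotp u v) *: u.
Proof.
rewrite mulmxBl mul1mx -scalemxAl -mulmxA [u^T *m v]mx11_scalar -dotp_mulmx.
by rewrite mul_mx_scalar scalerA.
Qed.

Lemma trmx_householder n (u : 'cV[R]_n) : (householder u)^T = householder u.
Proof. by rewrite linearB/= linearZ/= trmx1 trmx_mul trmxK. Qed.

Lemma householder_involutive n (u : 'cV[R]_n) : u != 0 -> householder u *m householder u = 1%:M.
Proof.
move=> u0; have uu0 : dotp u u != 0 by apply: contra_neq u0; exact: dotp_eq0.
rewrite {2}/householder mulmxBr mulmx1 -scalemxAr mulmxA mul_householder.
rewrite divfK// scaler_nat mulr2n opprD addrA subrr sub0r mulNmx scalerN opprK.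
by rewrite /householder subrK.
Qed.

Lemma orthogonal_det n (h : 'M[R]_n) : h *m h^T = 1%:M -> \det h = 1 \/ \det h = -1.
Proof.
move=> hh; have : \det h ^+ 2 = 1 by rewrite expr2 -{2}det_tr -det_mulmx hh det1.
by move=> /eqP; rewrite sqrf_eq1 => /orP[] /eqP ->; [left|right].
Qed.

(** For distinct unit vectors [e] and [w], the reflection along [u = e - w] carries [e] to [w],
    because [dotp u u = 2 * dotp u e]. Its determinant may have to be corrected. *)
Lemma SO_transitive n (w : 'cV[R]_n) : (1 < n)%N -> dotp w w = 1 ->
  exists2 h : 'M[R]_n, SO h & h *m stdvec n.-1 = w.
Proof.
move=> n1 ww; have n0 : (n.-1 < n)%N by rewrite prednK// ltnW.
pose e : 'cV[R]_n := stdvec n.-1.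
have ee : dotp e e = 1 by rewrite dotp_stdvec mxE eqxx.
have [H HH He] : exists2 H : 'M[R]_n, H *m H^T = 1%:M & H *m e = w.
  have [ew|ew] := eqVneq e w; first by exists 1%:M; rewrite ?trmx1 ?mulmx1 ?mul1mx.
  exists (householder (e - w)).
    by rewrite trmx_householder householder_involutive// subr_eq0.
  have uu : dotp (e - w) (e - w) = 2 - 2 * dotp e w.
    rewrite dotpBl !(dotpC _ (e - w)) !dotpBl ee ww (dotpC w e); ring.
  have ue : dotp (e - w) e = 1 - dotp e w by rewrite dotpBl ee (dotpC w e).
  have u0 : dotp (e - w) (e - w) != 0.
    by apply: contra_neq ew => /dotp_eq0/eqP; rewrite subr_eq0 => /eqP.
  rewrite mul_householder ue (_ : 2 / _ * _ = 1).
    by rewrite scale1r opprB addrCA subrr addr0.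
  by rewrite uu in u0 *; field; move: u0; apply: contra_neq => h; lra.
have [dH|dH] := orthogonal_det HH; first by exists H.
(* Changing the sign of e_1 corrects the determinant and keeps e_n, as 1 < n. *)
have n00 : (0 < n)%N by exact: ltnW.
pose f : 'cV[R]_n := stdvec 0.
have ff : dotp f f = 1 by rewrite dotp_stdvec mxE.
have f0 : f != 0.
  by apply/eqP => f0; move: ff; rewrite f0 /dotp big1 => [/eqP|i _]; rewrite ?mxE ?mul0r// eq_sym oner_eq0.
pose D : 'M[R]_n := diag_mx (\row_i (if i == Ordinal n00 then -1 else 1)).
have DD : D *m D^T = 1%:M.
  rewrite tr_diag_mx mulmx_diag -[RHS]diag_const_mx; congr diag_mx.
  by apply/rowP => i; rewrite !mxE; case: ifP; rewrite ?mulrNN mulr1.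
have dD : \det D = -1.
  rewrite det_diag (bigD1 (Ordinal n00))//= mxE eqxx big1 ?mulr1// => i i0.
  by rewrite mxE (negbTE i0).
have De : D *m e = e.
  apply/matrixP => i j; rewrite mul_diag_mx !mxE; case: eqP => [->/=|]; rewrite ?mul1r//.
  by rewrite (_ : (0 == n.-1) = false) ?mulr0//; apply/negbTE; rewrite eq_sym -lt0n; lia.
exists (H *m D); last by rewrite -mulmxA De.
split; last by rewrite det_mulmx dH dD mulrNN mulr1.
by rewrite trmx_mul mulmxA -(mulmxA H) DD mulmx1.
Qed.

End Rotations.

(** * Orthonormal frames of rotated coordinate planes *)

Section Frames.
Context {R : realType}.
Variables (n k : nat).
Hypothesis kn : (k <= n.-1)%N.

Let kn' : (k <= n)%N. Proof. exact: leq_trans (leq_pred _). Qed.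

Definition coord_mx : 'M[R]_(n, k) := pid_mx k.

Lemma coord_mxTK : coord_mx^T *m coord_mx = 1%:M.
Proof.
rewrite /coord_mx tr_pid_mx pid_mx_id// -[RHS]pid_mx_1.
by [].
Qed.

Lemma coord_mx_stdvec : coord_mx^T *m (stdvec n.-1 : 'cV[R]_n) = 0.
Proof.
apply/matrixP => i j; rewrite !mxE big1// => l _; rewrite !mxE.
case: eqP => [li|]; last by rewrite andFb mul0r.
have -> : (l == n.-1 :> nat) = false; last by rewrite mulr0.
by apply/negbTE; rewrite li neq_ltn (leq_trans (ltn_ord i) kn).
Qed.

Lemma coord_mx_col (i : 'I_k) : col i coord_mx = stdvec i :> 'cV[R]_n.
Proof. by apply/matrixP => l j; rewrite !mxE; case: eqP => // ->; rewrite ltn_ord. Qed.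

Lemma coord_mx_mul (y : 'cV[R]_k) : coord_mx *m y = \sum_i y i 0 *: col i coord_mx.
Proof.
apply/matrixP => i j; rewrite ord1 mxE summxE; apply: eq_bigr => l _.
by rewrite !mxE mulrC.
Qed.

Lemma mem_rot_space (g : 'M[R]_n) (v : 'cV[R]_n) :
  v \in rot_space k g <-> exists y : 'cV[R]_k, v = (g *m coord_mx) *m y.
Proof.
split.
  move=> /memv_imgP[u uU ->]; rewrite lfunE/=.
  suff [y ->] : exists y : 'cV[R]_k, u = coord_mx *m y by exists y; rewrite mulmxA.
  move: uU; rewrite /coord_space; set X := map _ _ => uX.
  have sX : size X == k by rewrite size_map size_iota.
  have uE := @coord_span _ _ _ (Tuple sX) u uX.
  exists (\col_i coord (Tuple sX) i u); rewrite {1}uE coord_mx_mul.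
  apply: eq_bigr => i _; rewrite mxE coord_mx_col; congr (_ *: _).
  by rewrite /X (nth_map 0%N) ?size_iota// nth_iota.
move=> [y ->]; rewrite -mulmxA; apply/memv_imgP; exists (coord_mx *m y); last by rewrite lfunE.
rewrite coord_mx_mul.
apply: memv_suml => i _; apply: memvZ; rewrite coord_mx_col.
by apply: memv_span; apply/mapP; exists (i : nat) => //; rewrite mem_iota ltn_ord.
Qed.

(* The frame chosen by onframe differs from g e_1, ..., g e_k by a matrix of O(k). *)
Lemma onframeP (g : 'M[R]_n) : SO g ->
  exists2 Q : 'M[R]_k, Q^T *m Q = 1%:M & onframe k (rot_space k g) = (g *m coord_mx) *m Q.
Proof.
move=> Sg; set B := onframe k _; set A := g *m coord_mx.
have AA : A^T *m A = 1%:M.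
  by rewrite /A trmx_mul mulmxA -(mulmxA _ g^T) SO_trmx_mul// mulmx1 coord_mxTK.
have [BB BP] : B^T *m B = 1%:M /\ forall v, v \in rot_space k g <-> exists y : 'cV[R]_k, v = B *m y.
  (* The frame [A] meets the specification, so [xget] does not return its default 0. *)
  by rewrite /B /onframe; case: xgetP => [M -> //|/(_ A) []]; split=> // v; exact: mem_rot_space.
(* [A *m A^T] is the orthogonal projection onto the rotated plane, which contains the columns of
   [B]. *)
have AAB : A *m (A^T *m B) = B.
  apply/matrixP => i j.
  have /BP/mem_rot_space[y By] : exists y : 'cV[R]_k, col j B = B *m y by exists (delta_mx j 0); rewrite colE.
  have : col j (A *m (A^T *m B)) = col j B.
    by rewrite !colE -!mulmxA -colE By -/A (mulmxA A^T) AA mul1mx mulmxA.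
  by move=> /matrixP /(_ i 0); rewrite !mxE.
exists (A^T *m B); last by rewrite AAB.
by rewrite trmx_mul trmxK -mulmxA AAB.
Qed.

(** The change of basis [Q] drops out of the projection, and [g e_n] is orthogonal to the plane
    because [k <= n - 1]; only [x] is projected. *)
Lemma perp_rot_space (g : 'M[R]_n) (x : 'cV[R]_n) (r : R) : SO g ->
  let A := g *m coord_mx in
  perp k (rot_space k g) (x + r *: (g *m stdvec n.-1)) =
  x + r *: (g *m stdvec n.-1) - A *m (A^T *m x).
Proof.
move=> Sg A; have [Q QQ BE] := onframeP Sg.
have QQ' : Q *m Q^T = 1%:M by exact: mulmx1C.
rewrite /perp BE -/A; congr (_ - _).
rewrite trmx_mul -!mulmxA (mulmxA Q) QQ' mul1mx mulmxDr -scalemxAr.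
by rewrite {2}/A trmx_mul -!mulmxA (mulmxA g^T) SO_trmx_mul// mul1mx coord_mx_stdvec scaler0 addr0.
Qed.

End Frames.

Section Planes.
Context {R : realType}.
Local Notation Rk k := (ms_carrier (@Rk_space R k)).
Local Notation mRk k := (ms_measure (@Rk_space R k)).

(** This is the definition of the integral, valid without integrability. With [max0_continuous], it
    carries identities from continuous nonnegative functions over to continuous ones. *)
Lemma integral_pos_neg d (T : measurableType d) (m : {measure set T -> \bar R}) (D : set T) (f : T -> R) :
  (\int[m]_(x in D) (f x)%:E = \int[m]_(x in D) (Num.max (f x) 0)%:E - \int[m]_(x in D) (Num.max (- f x) 0)%:E)%E.
Proof.
rewrite integralE; congr (_ - _)%E; apply: eq_integral => x _.
  by rewrite funeposE -EFin_max.
by rewrite funenegE -EFinN -EFin_max.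
Qed.

Lemma max0_continuous (T : topologicalType) (f : T -> R) : continuous f -> continuous (fun v => Num.max (f v) 0).
Proof. by move=> cf v; apply: continuous_max; [exact: cf|exact: cvg_cst]. Qed.

Lemma max0_ge0 (x : R) : 0 <= Num.max x 0.
Proof. by rewrite le_max lexx orbT. Qed.

Lemma integral_Rk_affine k (f : 'cV[R]_k -> R) (Q : 'M[R]_k) (c : 'cV[R]_k) :
  Q^T *m Q = 1%:M -> continuous f ->
  (\int[mRk k]_z (f (Q *m Rk_vec z + c))%:E = \int[mRk k]_z (f (Rk_vec z))%:E)%E.
Proof.
move=> QQ cf.
have H (g : 'cV[R]_k -> R) : continuous g -> (forall v, 0 <= g v) ->
    (\int[mRk k]_z (g (Q *m Rk_vec z + c))%:E = \int[mRk k]_z (g (Rk_vec z))%:E)%E.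
  move=> cg g0.
  rewrite (@ge0_integral_Rk_rot R k (fun v => g (v + c)) Q QQ)//; last first.
    by move=> v; exact: (@continuous_comp 'cV[R]_k 'cV[R]_k R (fun v : 'cV[R]_k => v + c) g v (@addmx_continuous R k 1 c v) (cg _)).
  exact: ge0_integral_Rk_shift.
have cfN : continuous (fun v => - f v) by move=> v; exact: (cvgN (cf v)).
have e1 := H _ (max0_continuous cf) (fun v => max0_ge0 (f v)).
have e2 := H _ (max0_continuous cfN) (fun v => max0_ge0 (- f v)).
apply: (etrans (integral_pos_neg _ _ _)); apply: (etrans _ (esym (integral_pos_neg _ _ _))).
by congr (_ - _)%E; [exact: e1|exact: e2].
Qed.

(** The arbitrary frame and the projection of [x] off the plane amount to an isometry of the
    parameter space R^k, with linear part [Q] and translation [- A^T x]; neither changes the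
    integral. *)
Lemma kplane_transform_rot n k (kn : (k <= n.-1)%N) (f : 'cV[R]_n -> R)
    (g : 'M[R]_n) (x : 'cV[R]_n) (r : R) : continuous f -> SO g ->
  kplane_transform k f (rot_space k g) (perp k (rot_space k g) (x + r *: (g *m stdvec n.-1))) =
  int_Rk (fun y => f (x + g *m (r *: stdvec n.-1 + coord_mx n k *m y))).
Proof.
move=> cf Sg; rewrite perp_rot_space//; have [Q QQ BE] := onframeP kn Sg.
rewrite /kplane_transform /int_subspace BE /int_Rk /Rintegral; congr fine.
pose A := g *m (coord_mx n k : 'M[R]_(n, k)).
pose h (y : 'cV[R]_k) := f (x + g *m (r *: stdvec n.-1 + coord_mx n k *m y)).
rewrite -(@integral_Rk_affine k h Q (- (A^T *m x)) QQ).
  apply: eq_integral => z _ /=; congr (EFin (f _)).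
  rewrite mulmxDr mulmxDr mulmxN mulmxDr mulmxN -scalemxAr /A !mulmxA.
  rewrite -!addrA; congr (_ + (_ + _)).
  by rewrite addrC.
have caff : continuous (fun y : 'cV[R]_k => A *m y + (x + r *: (g *m stdvec n.-1))).
  by move=> y; exact: (cvgD (@mulmx_continuous _ _ _ _ A y) (cvg_cst _)).
rewrite (_ : h = f \o (fun y => A *m y + (x + r *: (g *m stdvec n.-1)))).
  by move=> y; exact: (@continuous_comp 'cV[R]_k 'cV[R]_n R _ f y (caff y) (cf _)).
apply/funext => y; rewrite /h/= mulmxDr -scalemxAr /A mulmxA addrA addrC.
by [].
Qed.

End Planes.

(** * Functions of order O(|x|^-mu) *)

Section Decaying.
Context {R : realType} {n : nat}.
Implicit Types (f : 'cV[R]_n -> R) (x v : 'cV[R]_n).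

Lemma enorm_ge0 x : 0 <= enorm x. Proof. exact: sqrtr_ge0. Qed.

Lemma sqr_enorm x : enorm x ^+ 2 = dotp x x.
Proof. by rewrite sqr_sqrtr// dotp_ge0. Qed.

Lemma coord_le_enorm x i : `|x i 0| <= enorm x.
Proof.
rewrite -sqrtr_sqr; apply: ler_wsqrtr; rewrite /dotp (bigD1 i)//= -expr2 lerDl.
by apply: sumr_ge0 => j _; rewrite -expr2 sqr_ge0.
Qed.

(** The inequality [|x + v|^2 >= |v|^2 / 2 - |x|^2] holds coordinatewise, the difference being the
    square [2 (a + b/2)^2]; this replaces the triangle inequality. *)
Lemma enormD_ge x v : 2 * enorm x <= enorm v -> enorm v / 2 <= enorm (x + v).
Proof.
move=> xv; have x0 := enorm_ge0 x; have v0 := enorm_ge0 v.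
rewrite -(@ler_pXn2r _ 2)// ?nnegrE ?divr_ge0 ?enorm_ge0//.
have h : 2^-1 * dotp v v - dotp x x <= dotp (x + v) (x + v).
  rewrite /dotp mulr_sumr -sumrB; apply: ler_sum => i _; rewrite !mxE.
  move: (x i 0) (v i 0) => a b.
  have e : (a + b) * (a + b) - (2^-1 * (b * b) - a * a) = 2 * (a + b / 2) ^+ 2 by field.
  by rewrite -subr_ge0 e mulr_ge0 ?sqr_ge0.
by move: h; rewrite -!sqr_enorm; nra.
Qed.

Lemma box_compact (M : R) : compact [set x : 'cV[R]_n | forall i, `|x i 0| <= M].
Proof.
rewrite (_ : [set x | _] = (fun v : 'rV[R]_n => v^T) @`
    [set v : 'rV[R]_n | forall i, `[- M, M]%classic (v 0 i)]).
  apply: continuous_compact.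
    have ct : continuous (fun v : 'rV[R]_n => v^T).
      apply: (@mx_continuous R 'rV[R]_n n 1) => i j; under eq_fun do rewrite mxE.
      exact: coord_continuous.
    exact: continuous_subspaceT.
  apply: (@rV_compact R n (fun=> `[- M, M]%classic)) => i; exact: segment_compact.
apply/seteqP; split=> [x hx|_ [v hv <-] i] /=.
  by exists x^T; rewrite ?trmxK// => i /=; rewrite mxE in_itv/= -ler_norml.
by have := hv i; rewrite mxE/= in_itv/= -ler_norml.
Qed.

Lemma C_mu_bounded (mu : R) f : 0 < mu -> C_mu mu f -> exists B, forall x, `|f x| <= B.
Proof.
move=> mu0 [cf [C [A [A0 fC]]]].
have /compact_bounded[M [_ /(_ (M + 1))]] := continuous_compact (continuous_subspaceT cf) (@box_compact A).
rewrite ltrDl ltr01 => /(_ isT) hM.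
exists (Num.max (M + 1) (`|C| * A `^ (- mu))) => x; rewrite le_max.
have [xA|] := boolP [forall i, `|x i 0| <= A].
  by apply/orP; left; apply: hM; exists x => // i; exact: (forallP xA).
rewrite negb_forall => /existsP[i]; rewrite -ltNge => iA; apply/orP; right.
have Ax : A <= enorm x by exact: le_trans (ltW iA) (coord_le_enorm x i).
apply: (le_trans (fC x Ax)); apply: (@le_trans _ _ (`|C| * enorm x `^ (- mu))).
  by rewrite ler_wpM2r ?powR_ge0 ?ler_norm.
have ex0 : 0 < enorm x by exact: lt_le_trans Ax.
rewrite ler_wpM2l// !powRN lef_pV2 ?posrE ?powR_gt0//.
by apply: ge0_ler_powR; rewrite ?nnegrE ?enorm_ge0// ltW.
Qed.

Lemma C_mu_small (mu : R) f (eps : R) : 0 < mu -> C_mu mu f -> 0 < eps ->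
  exists M, forall x, M <= enorm x -> `|f x| < eps.
Proof.
move=> mu0 [cf [C [A [A0 fC]]]] e0.
have C1 : 0 < `|C| + 1 by rewrite ltr_wpDl.
have /cvgrPdist_lt /(_ (eps / (`|C| + 1))) := powRN_cvg0 mu0.
rewrite divr_gt0// => /(_ isT)[M [_ hM]].
exists (Num.max A (M + 1)) => x; rewrite ge_max => /andP[Ax Mx].
have := hM (enorm x); rewrite sub0r normrN ger0_norm ?powR_ge0// => /(_ _)/wrap[].
  by apply: lt_le_trans Mx; rewrite ltrDl.
rewrite ltr_pdivlMr// => h; apply: le_lt_trans (fC x Ax) _; apply: le_lt_trans h.
by rewrite mulrC ler_wpM2l ?powR_ge0// (le_trans (ler_norm _))// lerDl.
Qed.

(** On a compact box continuity is uniform; outside it both values are below [eps / 2] by the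
    decay. *)
Lemma C_mu_unif (mu : R) f (eps : R) : 0 < mu -> C_mu mu f -> 0 < eps ->
  exists2 d : R, 0 < d & forall x v, enorm v < d -> `|f (x + v) - f x| < eps.
Proof.
move=> mu0 hf e0; have cf := hf.1.
have e20 : 0 < eps / 2 by rewrite divr_gt0.
have [M fM] := C_mu_small mu0 hf e20.
(* The margin 1, together with [d < 1], keeps [x + v] where [f] is small whenever [x] is outside the
   box. *)
have /compact_near_coveringP cov := @box_compact (M + 1).
pose Q (d : R) x := forall v, enorm v < d -> `|f (x + v) - f x| < eps.
have H : \forall d \near (0 : R)^'+, [set x : 'cV[R]_n | forall i, `|x i 0| <= M + 1] `<=` Q d.
  apply: cov => x _.
  have /cvgrPdist_lt /(_ _ e20) := cf x.
  move=> /nbhs_ballP[d /= d0 hd].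
  exists (ball x (d / 2), [set r | r < d / 2]) => /=.
    split; first by apply: nbhsx_ballx; rewrite divr_gt0.
    by apply: nbhs_right_lt; rewrite divr_gt0.
  move=> [y r] /= [xy rd] v vr.
  have h1 : `|f x - f y| < eps / 2.
    apply: hd; apply: (le_ball _ xy); lra.
  have h2 : `|f x - f (y + v)| < eps / 2.
    apply: hd; split=> // i j; rewrite /ball/= ord1 mxE.
    have [_ /(_ i 0)] := xy; rewrite /ball/= => h.
    have hv : `|v i 0| < d / 2 by apply: le_lt_trans (coord_le_enorm v i) _; lra.
    rewrite opprD addrA (le_lt_trans (ler_normB _ _))//; lra.
  rewrite (_ : _ - _ = (f x - f y) - (f x - f (y + v))); last by ring.
  by rewrite (le_lt_trans (ler_normB _ _))//; lra.
near (0 : R)^'+ => d; exists d; first by near: d; exact: nbhs_right_gt.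
have d1 : d < 1 by near: d; exact: nbhs_right_lt.
have Hd : [set x : 'cV[R]_n | forall i, `|x i 0| <= M + 1] `<=` Q d by near: d; exact: H.
move=> x v vd; have [xA|] := boolP [forall i, `|x i 0| <= M + 1].
  by apply: Hd => // i; exact: (forallP xA).
rewrite negb_forall => /existsP[i]; rewrite -ltNge => iA.
have f1 : `|f x| < eps / 2.
  by apply: fM; apply: le_trans (coord_le_enorm x i); lra.
have f2 : `|f (x + v)| < eps / 2.
  apply: fM; apply: le_trans (coord_le_enorm (x + v) i).
  have := coord_le_enorm v i; rewrite mxE => hv.
  have := lerB_normD (x i 0) (v i 0); lra.
by rewrite (le_lt_trans (ler_normB _ _))//; lra.
Unshelve. all: end_near. Qed.

Lemma C_mu_shift_decay (mu : R) f x : 0 < mu -> C_mu mu f ->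
  exists K S : R, [/\ 0 <= K, 0 < S & forall v, S <= enorm v -> `|f (x + v)| <= K * enorm v `^ (- mu)].
Proof.
move=> mu0 [cf [C [A [A0 fC]]]].
(* The term [2 * enorm x] ensures [|x + v| >= |v| / 2], and [2 * A] makes this at least [A]; the
   halving costs the factor [2^mu]. *)
exists (`|C| * 2 `^ mu), (2 * enorm x + 2 * A).
have x0 := enorm_ge0 x; split; [by rewrite mulr_ge0 ?powR_ge0|lra|] => v Sv.
have v0 := enorm_ge0 v.
have xv : enorm v / 2 <= enorm (x + v) by apply: enormD_ge; lra.
apply: le_trans (fC (x + v) _) _; first by lra.
apply: (@le_trans _ _ (`|C| * enorm (x + v) `^ (- mu))).
  by rewrite ler_wpM2r ?powR_ge0 ?ler_norm.
rewrite -mulrA ler_wpM2l// (_ : 2 `^ mu * _ = (enorm v / 2) `^ (- mu)).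
  have ev0 : 0 < enorm v / 2 by lra.
  have exv : 0 < enorm (x + v) by exact: lt_le_trans xv.
  rewrite !powRN lef_pV2 ?posrE ?powR_gt0//.
  by apply: ge0_ler_powR; rewrite ?nnegrE ?enorm_ge0// ?divr_ge0// ltW.
rewrite powRM ?invr_ge0// mulrC; congr (_ * _).
by rewrite -powR_inv1// -powRrM mulrNN mul1r.
Qed.

End Decaying.

(** * Spherical means *)

Section SphericalMean.
Context {R : realType} {n : nat}.
Variable P : probability (@mxBorel R n) R.
Hypothesis HP : is_Haar_SO P.

Lemma integral_SO_setT_signed (F : @mxBorel R n -> \bar R) : measurable_fun setT F ->
  (\int[P]_(g in SO) F g = \int[P]_g F g)%E.
Proof.
move=> mF; rewrite integralE [RHS]integralE; congr (_ - _)%E.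
  by apply: (integral_SO_setT HP) => //; exact: measurable_funepos.
by apply: (integral_SO_setT HP) => //; exact: measurable_funeneg.
Qed.

(** The bound is asked for on [SO] only, which carries [P]: lengths such as that of [g v] are
    controlled for rotations but not for arbitrary matrices. *)
Lemma bounded_on_SO (F : @mxBorel R n -> R) (c : R) : measurable_fun setT F ->
  (forall g, SO g -> `|F g| <= c) ->
  P.-integrable setT (EFin \o F) /\ `|\int[P]_g F g| <= c.
Proof.
move=> mF Fc.
have mE : measurable_fun setT (fun g => `|F g|%:E).
  by apply/measurable_EFinP; exact: measurableT_comp.
have le : (\int[P]_g `|F g|%:E <= c%:E)%E.
  rewrite -(integral_SO_setT HP mE)//.
  apply: (@le_trans _ _ (\int[P]_(g in SO) (cst c%:E g))%E).
    apply: ge0_le_integral => //.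
    - exact: measurable_SO.
    - exact: measurable_funTS.
  rewrite integral_cst; last exact: measurable_SO.
  have PSO := HP.1.
  by rewrite [X in (_ * X)%E](_ : _ = 1%E) ?mule1//.
have iF : P.-integrable setT (EFin \o F).
  apply/integrableP; split; first exact/measurable_EFinP.
  by apply: (le_lt_trans le); rewrite ltry.
split=> //; apply: (le_trans (le_normr_Rintegral measurableT iF)).
rewrite -lee_fin /Rintegral fineK//.
by have := integrable_fin_num measurableT (integrable_abse iF).
Qed.

Lemma measurable_act (f : 'cV[R]_n -> R) (x v : 'cV[R]_n) : continuous f ->
  measurable_fun setT (fun g : @mxBorel R n => f (x + (g : 'M[R]_n) *m v)).
Proof.
move=> cf; apply: measurable_continuous_mx => //.
apply: measurable_addmx => [i j|]; first exact: measurable_cst.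
by apply: measurable_mulmx => i j; [exact: measurable_mxBorel_coord|exact: measurable_cst].
Qed.

(** For Haar-distributed [g] the point [g e_n] is uniform on the unit sphere. Allowing every real
    [s] makes the mean continuous on the whole line, with value [f x] at 0. *)
Definition spherical_mean (f : 'cV[R]_n -> R) (x : 'cV[R]_n) (s : R) : R :=
  \int[P]_g f (x + (g : 'M[R]_n) *m (s *: stdvec n.-1)).

Lemma enorm_SO (g : 'M[R]_n) (v : 'cV[R]_n) : SO g -> enorm (g *m v) = enorm v.
Proof. by move=> Sg; rewrite /enorm dotp_orthogonal// SO_trmx_mul. Qed.

Hypothesis n1 : (1 < n)%N.

Lemma enorm_scale_stdvec (s : R) : enorm (s *: stdvec n.-1 : 'cV[R]_n) = `|s|.
Proof.
have n0 : (n.-1 < n)%N by rewrite prednK// ltnW.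
have e : dotp (s *: stdvec n.-1 : 'cV[R]_n) (s *: stdvec n.-1) = s ^+ 2 * dotp (stdvec n.-1 : 'cV[R]_n) (stdvec n.-1).
  by rewrite /dotp mulr_sumr; apply: eq_bigr => i _; rewrite !mxE; ring.
by rewrite /enorm e (dotp_stdvec n0) mxE eqxx mulr1 sqrtr_sqr.
Qed.

Section OneFunction.
Variables (f : 'cV[R]_n -> R) (B : R).
Hypotheses (cf : continuous f) (fB : forall v, `|f v| <= B).

Lemma integrable_act (x v : 'cV[R]_n) :
  P.-integrable setT (fun g : @mxBorel R n => (f (x + (g : 'M[R]_n) *m v))%:E).
Proof. by have [] := @bounded_on_SO _ B (measurable_act x v cf) (fun g _ => fB _). Qed.

Lemma spherical_mean_le (x : 'cV[R]_n) (s : R) : `|spherical_mean f x s| <= B.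
Proof. exact: (@bounded_on_SO _ B (measurable_act x (s *: stdvec n.-1) cf) (fun g _ => fB _)).2. Qed.

Lemma spherical_mean0 (x : 'cV[R]_n) : spherical_mean f x 0 = f x.
Proof.
rewrite /spherical_mean; under eq_Rintegral do rewrite scale0r mulmx0 addr0.
have e := @Rintegral_cst _ _ R P setT measurableT (f x).
apply: (etrans e); have -> : fine (P setT) = 1 by rewrite probability_setT.
by rewrite mulr1.
Qed.

(** Changing the radius from [s] to [t] moves each point by [|t - s|]. This gives continuity of the
    mean in the radius and, for [s = 0], its uniform convergence to [f]. *)
Lemma spherical_mean_unif (eps d : R) (x : 'cV[R]_n) (s t : R) :
  (forall x v, enorm v < d -> `|f (x + v) - f x| < eps) -> `|t - s| < d ->
  `|spherical_mean f x t - spherical_mean f x s| <= eps.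
Proof.
move=> H ts; rewrite /spherical_mean -RintegralB//; try exact: integrable_act.
have mF := measurable_funB (measurable_act x (t *: stdvec n.-1) cf) (measurable_act x (s *: stdvec n.-1) cf).
suff h : forall g, SO g -> `|f (x + g *m (t *: stdvec n.-1)) - f (x + g *m (s *: stdvec n.-1))| <= eps.
  exact: (bounded_on_SO mF h).2.
move=> g Sg; rewrite (_ : x + g *m (t *: _) =
    x + g *m (s *: stdvec n.-1) + g *m ((t - s) *: stdvec n.-1)).
  by apply/ltW/H; rewrite enorm_SO// enorm_scale_stdvec.
by rewrite -addrA -mulmxDr -scalerDl; congr (_ + g *m (_ *: _)); ring.
Qed.

Lemma spherical_mean_decay (mu K S : R) (x : 'cV[R]_n) :
  (forall v, S <= enorm v -> `|f (x + v)| <= K * enorm v `^ (- mu)) -> 0 < S ->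
  forall s, S <= s -> `|spherical_mean f x s| <= K * s `^ (- mu).
Proof.
move=> H S0 s Ss; have s0 : 0 <= s by apply: le_trans Ss; exact: ltW.
suff h : forall g, SO g -> `|f (x + g *m (s *: stdvec n.-1))| <= K * s `^ (- mu).
  exact: (bounded_on_SO (measurable_act x _ cf) h).2.
move=> g Sg; have e : enorm (g *m (s *: stdvec n.-1)) = s by rewrite enorm_SO// enorm_scale_stdvec ger0_norm.
by rewrite -{2}e; apply: H; rewrite e.
Qed.

(** By transitivity [w = h (|w| e_n)] for a rotation [h], which is then absorbed on the right of
    [g]. *)
Lemma integral_SO_rot (x w : 'cV[R]_n) : 0 < dotp w w ->
  (\int[P]_g (f (x + (g : 'M[R]_n) *m w))%:E = (spherical_mean f x (enorm w))%:E)%E.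
Proof.
move=> w0; have ew0 : 0 < enorm w by rewrite sqrtr_gt0.
have ww : dotp ((enorm w)^-1 *: w) ((enorm w)^-1 *: w) = 1.
  have -> : dotp ((enorm w)^-1 *: w) ((enorm w)^-1 *: w) = (enorm w)^-1 ^+ 2 * dotp w w.
    by rewrite /dotp mulr_sumr; apply: eq_bigr => i _; rewrite !mxE; ring.
  by rewrite -sqr_enorm exprVn mulVf// sqrf_eq0 gt_eqF.
have [h Sh hw] := SO_transitive n1 ww.
have wE : w = h *m (enorm w *: stdvec n.-1).
  by rewrite -scalemxAr hw scalerA mulfV ?scale1r// gt_eqF.
have key (q : 'cV[R]_n -> R) : continuous q -> (forall v, 0 <= q v) ->
    (\int[P]_g (q (x + (g : 'M[R]_n) *m w))%:E =
     \int[P]_g (q (x + (g : 'M[R]_n) *m (enorm w *: stdvec n.-1)))%:E)%E.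
  move=> cq q0; rewrite {1}wE.
  apply: (@integral_SO_mulr _ _ _ HP (fun v => q (x + v)) h _ Sh) => // v.
  apply: (@continuous_comp 'cV[R]_n 'cV[R]_n R (fun v : 'cV[R]_n => x + v) q v); last exact: cq.
  exact: (cvgD (cvg_cst _) cvg_id).
have cfN : continuous (fun v : 'cV[R]_n => - f v) by move=> v; exact: (cvgN (@cf v)).
have e1 := key _ (max0_continuous cf) (fun v => max0_ge0 (f v)).
have e2 := key _ (max0_continuous cfN) (fun v => max0_ge0 (- f v)).
rewrite /spherical_mean /Rintegral fineK; last first.
  by apply: integrable_fin_num => //; exact: integrable_act.
apply: (etrans (integral_pos_neg _ _ _)); apply: (etrans _ (esym (integral_pos_neg _ _ _))).
by congr (_ - _)%E; [exact: e1|exact: e2].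
Qed.

End OneFunction.

Lemma spherical_mean_continuous (mu : R) (f : 'cV[R]_n -> R) (x : 'cV[R]_n) : 0 < mu ->
  C_mu mu f -> continuous (spherical_mean f x).
Proof.
move=> mu0 hf s; have [B fB] := C_mu_bounded mu0 hf.
apply/cvgrPdist_le => eps e0; have [d d0 H] := C_mu_unif mu0 hf e0.
near=> t; apply: (@spherical_mean_unif f B hf.1 fB _ d) => //.
Unshelve. all: end_near. Qed.

End SphericalMean.

Section Averages.
Context {R : realType}.
Local Notation leb := (@lebesgue_measure R).
Local Notation Rk k := (ms_carrier (@Rk_space R k)).
Local Notation mRk k := (ms_measure (@Rk_space R k)).

(** The k-plane transform is real-valued by [fine], which gives 0 where the integral over a plane is
    infinite; an integrable function is finite almost everywhere, so the average over SO(n) is not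
    affected. *)
Lemma integral_fine d (T : measurableType d) (m : {measure set T -> \bar R}) (D : set T)
    (I : T -> \bar R) : measurable D -> m.-integrable D I ->
  (\int[m]_(x in D) (fine (I x))%:E = \int[m]_(x in D) I x)%E.
Proof.
move=> mD iI; have mI := measurable_int _ iI.
apply: ae_eq_integral => //.
  by apply/measurable_EFinP; apply: (measurableT_comp (fine_measurable measurableT) mI).
by have := integrable_ae mD iI; apply: filterS => x Ix Dx; rewrite fineK// Ix.
Qed.

Lemma integral_radial k (M : R -> R) (r : R) : (0 < k)%N -> 0 < r -> continuous M ->
  leb.-integrable `]r, +oo[ (EFin \o (fun s => M s * (s * (s ^+ 2 - r ^+ 2) `^ (k%:R / 2 - 1)))) ->
  (\int[mRk k]_z (M (Num.sqrt (r ^+ 2 + dotp (Rk_vec z) (Rk_vec z))))%:E =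
   (radial_const k * \int[leb]_(s in `]r, +oo[) (M s * (s * (s ^+ 2 - r ^+ 2) `^ (k%:R / 2 - 1))))%:E)%E.
Proof.
move=> k0 r0 cM; pose w (s : R) := s * (s ^+ 2 - r ^+ 2) `^ (k%:R / 2 - 1).
change (leb.-integrable `]r, +oo[ (EFin \o (fun s => M s * w s)) ->
  (\int[mRk k]_z (M (Num.sqrt (r ^+ 2 + dotp (Rk_vec z) (Rk_vec z))))%:E =
   (radial_const k * \int[leb]_(s in `]r, +oo[) (M s * w s))%:E)%E) => iM.
have mD : measurable (`]r, +oo[%classic : set (measurableTypeR R)) by exact: measurable_itv.
have cMN : continuous (fun s : R => - M s) by move=> v; exact: (cvgN (cM v)).
have w0 s : r < s -> 0 <= w s by move=> rs; rewrite mulr_ge0 ?powR_ge0// ltW// (lt_trans r0).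
have part (h : R -> R) : continuous h ->
    leb.-integrable `]r, +oo[ (EFin \o (fun s => h s * w s)) ->
    (\int[mRk k]_z (Num.max (h (Num.sqrt (r ^+ 2 + dotp (Rk_vec z) (Rk_vec z)))) 0)%:E =
     (radial_const k)%:E * \int[leb]_(s in `]r, +oo[) (Num.max (h s * w s) 0)%:E /\
     \int[leb]_(s in `]r, +oo[) (Num.max (h s * w s) 0)%:E \is a fin_num)%E.
  move=> ch ih; split.
    rewrite (@ge0_integral_radial R k (fun s => Num.max (h s) 0) r k0 r0 (max0_continuous ch))//.
      congr (_ * _)%E; apply: eq_integral => s; rewrite inE/= in_itv/= andbT => rs.
      by rewrite -/(w s) maxr_pMl ?w0// mul0r.
    by move=> s; exact: max0_ge0.
  have := integrable_fin_num mD (integrable_funepos mD ih); congr (_ \is a fin_num).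
  by apply: eq_integral => s _; rewrite funeposE -EFin_max.
have [e1 f1] := part _ cM iM.
have iMN : leb.-integrable `]r, +oo[ (EFin \o (fun s => - M s * w s)).
  have := integrableN iM; congr (_.-integrable _ _).
  by apply/funext => s /=; rewrite mulNr EFinN.
have [e2 f2] := part _ cMN iMN.
apply: (etrans (integral_pos_neg _ _ _)).
have f2' : (\int[leb]_(s in `]r, +oo[) (Num.max (- (M s * w s)) 0)%:E)%E \is a fin_num.
  by under eq_integral do rewrite -mulNr.
rewrite EFinM /Rintegral fineK; last exact: (integrable_fin_num mD iM).
rewrite [in RHS]integral_pos_neg muleBr//; last by rewrite fin_num_adde_defl// fin_numN.
rewrite e1 e2; congr (_ - _ * _)%E.
by apply: eq_integral => s _; rewrite mulNr.
Qed.

End Averages.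

(** * The shifted dual Radon transform as an Erdelyi-Kober integral *)

Section ShiftedDual.
Context {R : realType}.
Local Notation leb := (@lebesgue_measure R).
Local Notation Rk k := (ms_carrier (@Rk_space R k)).
Local Notation mRk k := (ms_measure (@Rk_space R k)).
Variables (n k : nat) (mu : R) (P : probability (@mxBorel R n) R).
Hypotheses (kn : (k <= n.-1)%N) (k0 : (0 < k)%N) (HP : is_Haar_SO P).

Let n1 : (1 < n)%N. Proof. by move: kn k0; clear; lia. Qed.

Lemma C_mu_norm (f : 'cV[R]_n -> R) : C_mu mu f -> C_mu mu (fun v => `|f v|).
Proof.
move=> [cf [C [A [A0 fC]]]]; split.
  by move=> v; exact: (@continuous_comp 'cV[R]_n R R f (fun y => `|y|) v (cf v) (@norm_continuous R R^o _)).
by exists C, A; split=> // v /fC; rewrite normr_id.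
Qed.

(** The order is left free for two uses: [al = k/2] gives convergence of the integral representing
    the dual transform, and [al = m + 1] that needed under the stronger decay. *)
Lemma spherical_mean_integrable (al r : R) (f : 'cV[R]_n -> R) (x : 'cV[R]_n) :
  Gamma_convergent al -> 0 < al -> 2 * al < mu -> 0 < r -> C_mu mu f ->
  leb.-integrable `]r, +oo[
    (EFin \o (fun s => spherical_mean P f x s * (s * (s ^+ 2 - r ^+ 2) `^ (al - 1)))).
Proof.
move=> okal al0 almu r0 hf; have mu0 : 0 < mu by lra.
have [B fB] := C_mu_bounded mu0 hf.
have [K [S [K0 S0 fK]]] := C_mu_shift_decay x mu0 hf.
apply: (@decay_integrable _ al mu K B S) => //.
- by move=> s _; exact: (spherical_mean_continuous HP n1 mu0 hf).
- by move=> s; exact: (spherical_mean_le HP hf.1 fB).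
- exact: (spherical_mean_decay HP n1 hf.1 fK S0).
Qed.

Lemma dotp_frame (r : R) (y : 'cV[R]_k) :
  dotp (r *: stdvec n.-1 + coord_mx n k *m y : 'cV[R]_n) (r *: stdvec n.-1 + coord_mx n k *m y) =
  r ^+ 2 + dotp y y.
Proof.
have n0 : (n.-1 < n)%N by rewrite prednK// ltnW.
have DD (u v : 'cV[R]_n) : dotp (u + v) (u + v) = dotp u u + 2 * dotp u v + dotp v v.
  rewrite /dotp mulr_sumr -!big_split; apply: eq_bigr => i _; rewrite /= !mxE; ring.
rewrite DD dotp_orthogonal; last exact: coord_mxTK.
have -> : dotp (r *: stdvec n.-1 : 'cV[R]_n) (r *: stdvec n.-1) = r ^+ 2.
  by rewrite -sqr_enorm enorm_scale_stdvec// real_normK// num_real.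
have -> : dotp (r *: stdvec n.-1 : 'cV[R]_n) (coord_mx n k *m y) = 0.
  rewrite dotpC dotp_mulmx trmx_mul -scalemxAr -mulmxA coord_mx_stdvec// mulmx0 scaler0.
  by rewrite mxE.
by rewrite mulr0 addr0.
Qed.

Hypothesis hmu : k%:R < mu.

(** For fixed [y] in R^k the vector [r e_n + y] has length [sqrt (r^2 + |y|^2)], so averaging over
    rotations first gives a spherical mean of that radius, a radial function of [y]. *)
Lemma shifted_dual_radial (f : 'cV[R]_n -> R) (x : 'cV[R]_n) (r : R) : C_mu mu f -> 0 < r ->
  shifted_dual k P (kplane_transform k f) x r = radial_const k *
  \int[leb]_(s in `]r, +oo[) (spherical_mean P f x s * (s * (s ^+ 2 - r ^+ 2) `^ (k%:R / 2 - 1))).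
Proof.
move=> hf r0; have kR : 0 < k%:R :> R by rewrite ltr0n.
have mu0 : 0 < mu by exact: lt_trans hmu.
have okk : Gamma_convergent (k%:R / 2 : R) by rewrite -(prednK k0); exact: Gamma_convergent_half.
have k20 : 0 < k%:R / 2 :> R by rewrite divr_gt0.
have k2mu : 2 * (k%:R / 2) < mu by rewrite mulrCA mulfV ?mulr1// lt0r_neq0.
pose w (y : 'cV[R]_k) : 'cV[R]_n := r *: stdvec n.-1 + coord_mx n k *m y.
have W (h : 'cV[R]_n -> R) : C_mu mu h ->
    (\int[mRk k]_z \int[P]_g (h (x + (g : 'M[R]_n) *m w (Rk_vec z)))%:E =
     (radial_const k * \int[leb]_(s in `]r, +oo[)
        (spherical_mean P h x s * (s * (s ^+ 2 - r ^+ 2) `^ (k%:R / 2 - 1))))%:E)%E.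
  move=> hh; have [B hB] := C_mu_bounded mu0 hh.
  rewrite -integral_radial//; last 2 first.
  - exact: (spherical_mean_continuous HP n1 mu0 hh).
  - exact: spherical_mean_integrable.
  apply: eq_integral => z _; rewrite (integral_SO_rot HP n1 hh.1 hB).
    by rewrite /enorm dotp_frame.
  by rewrite dotp_frame ltr_wpDr ?dotp_ge0// exprn_gt0.
pose Wf (h : 'cV[R]_n -> R) (p : @mxBorel R n * Rk k) := (h (x + (p.1 : 'M[R]_n) *m w (Rk_vec p.2)))%:E.
have mW (h : 'cV[R]_n -> R) : continuous h -> measurable_fun setT (Wf h).
  move=> ch; apply/measurable_EFinP; apply: measurable_continuous_mx => //.
  apply: measurable_addmx; first by move=> i j; exact: measurable_cst.
  apply: measurable_mulmx => i j.
    exact: (measurableT_comp (@measurable_mxBorel_coord R n i j) measurable_fst).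
  have mw i' j' : measurable_fun setT (fun z : Rk k => w (Rk_vec z) i' j').
    apply: measurable_addmx; first by move=> *; exact: measurable_cst.
    apply: measurable_mulmx => *; [exact: measurable_cst|exact: measurable_Rk_vec].
  exact: (measurableT_comp (mw i j) measurable_snd).
(* The computation [W] applied to [|f|], which decays at the same rate, shows that the double
   integral converges absolutely. *)
have iW : (P \x mRk k)%E.-integrable setT (Wf f).
  apply/(@integrable21ltyP _ _ _ _ R P (mRk k) (Wf f) (mW _ hf.1)).
  by rewrite (W _ (C_mu_norm hf)) ltry.
pose I (g : @mxBorel R n) := (\int[mRk k]_z Wf f (g, z))%E.
have mI : measurable_fun setT I := measurable_fubini_F iW.
have iI : P.-integrable setT I := integrable_fubini_F iW.
have mSO := @measurable_SO R n.
have e1 : (\int[P]_(g in (SO : set (@mxBorel R n)))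
    (kplane_transform k f (rot_space k g) (perp k (rot_space k g) (x + r *: ((g : 'M[R]_n) *m stdvec n.-1))))%:E =
    \int[P]_(g in (SO : set (@mxBorel R n))) (fine (I g))%:E)%E.
  by apply: eq_integral => g; rewrite inE => Sg; rewrite kplane_transform_rot//; exact: hf.1.
have e2 := integral_fine mSO (integrableS measurableT mSO (@subsetT _ _) iI).
have e3 := integral_SO_setT_signed HP mI.
exact: (congr1 fine (etrans e1 (etrans e2 (etrans e3 (etrans (Fubini iW) (W _ hf)))))).
Qed.

End ShiftedDual.

Section Inversion.
Context {R : realType}.
Local Notation leb := (@lebesgue_measure R).
Variables (n k : nat) (mu : R) (P : probability (@mxBorel R n) R).
Hypotheses (kn : (k <= n.-1)%N) (k0 : (0 < k)%N) (HP : is_Haar_SO P) (hmu : k%:R < mu).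
Variables (f : 'cV[R]_n -> R) (x : 'cV[R]_n).
Hypothesis hf : C_mu mu f.

Let a : R := k%:R / 2.
Let F : R -> R := shifted_dual k P (kplane_transform k f) x.
Let G (s : R) : R := pi `^ a * spherical_mean P f x s.

Let n1 : (1 < n)%N. Proof. by move: kn k0; clear; lia. Qed.
Let mu0 : 0 < mu. Proof. by apply: lt_trans hmu; rewrite ltr0n. Qed.

Let cG (s : R) : {for s, continuous G}.
Proof. by apply: cvgM; [exact: cvg_cst|exact: (spherical_mean_continuous HP n1 mu0 hf)]. Qed.

Lemma shifted_dual_EK_inverse : EK_inverse a F G.
Proof.
have okk : Gamma_convergent a by rewrite /a -(prednK k0); exact: Gamma_convergent_half.
have a0 : 0 < a by rewrite divr_gt0// ltr0n.
have a2 : 2 * a < mu by rewrite mulrCA mulfV ?mulr1// lt0r_neq0.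
have iM t : 0 < t -> leb.-integrable `]t, +oo[
    (EFin \o (fun s => spherical_mean P f x s * (s * (s ^+ 2 - t ^+ 2) `^ (a - 1)))).
  by move=> t0; exact: (@spherical_mean_integrable R n k mu P).
have GE t s : EK_integrand a G t s =
    pi `^ a * (spherical_mean P f x s * (s * (s ^+ 2 - t ^+ 2) `^ (a - 1))).
  by rewrite EK_integrandE /G; ring.
split=> [t _|t t0|t t0]; first exact: cG.
  have mD : measurable (`]t, +oo[%classic : set (measurableTypeR R)) by exact: measurable_itv.
  have := integrableZl mD (pi `^ a) (iM t t0).
  by congr (_.-integrable _ _); apply/funext => s; rewrite /= GE.
rewrite /F (shifted_dual_radial kn k0 HP hmu x hf t0) /EK_integral.
under eq_Rintegral do rewrite GE.
by rewrite RintegralZl//; [rewrite /radial_const mulrA (mulrC (2 / _))|exact: iM].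
Qed.

Lemma shifted_dual_EK_differentiable : EK_differentiable a F.
Proof.
exists G; split; first exact: shifted_dual_EK_inverse.
by move=> G' hG'; exact: (EK_inverse_unique k0 shifted_dual_EK_inverse hG').
Qed.

Lemma EK_derivativeE (t : R) : 0 < t -> EK_derivative a F t = G t.
Proof.
move=> t0; rewrite /EK_derivative; case: xgetP => [G' _ hG'|/(_ G) []].
  exact: (EK_inverse_unique k0 shifted_dual_EK_inverse hG').
exact: shifted_dual_EK_inverse.
Qed.

(** The case [al = m + 1] of the integrability of spherical means: then [al - 1 = m], and the
    hypothesis reads [2 * al < mu]. *)
Lemma iter_int_converges_decay : 2 + 2 * (k./2)%:R < mu ->
  iter_int_converges (fun s => s ^+ 2) (fun s => 2 * s) k./2 G.
Proof.
set m := k./2 => hm t t0.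
have ok : Gamma_convergent (m.+1%:R : R).
  have := @Gamma_convergent_half R (m.*2.+1); rewrite (_ : _ / _ = m.+1%:R)//.
  by rewrite -doubleS -mul2n natrM mulrAC mulfV// mul1r.
have m2 : 2 * m.+1%:R < mu by rewrite -natr1; move: hm; lra.
have iM := @spherical_mean_integrable R n k mu P kn k0 HP _ t f x ok (ltr0Sn _ _) m2 t0 hf.
have mD : measurable (`]t, +oo[%classic : set (measurableTypeR R)) by exact: measurable_itv.
have := integrableZl mD (2 * pi `^ a) iM; apply: eq_integrable => // s; rewrite inE/= in_itv/= andbT => ts.
rewrite (_ : m.+1%:R - 1 = m%:R); last by rewrite -(natr1 m) addrK.
rewrite powR_mulrn; last by rewrite subr_ge0; nra.
by rewrite -EFinM /G; congr EFin; ring.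
Qed.

End Inversion.

Theorem theorem3p4 (R : realType) (n k : nat) (hk : (1 <= k <= n.-1)%N)
    (mu : R) (hmu : k%:R < mu)
    (P : probability (@mxBorel R n) R) (hP : is_Haar_SO P)
    (f : 'cV[R]_n -> R) (hf : C_mu mu f) :
  let m : nat := k./2 in
  let a : R := k%:R / 2 in
  let F (x : 'cV[R]_n) : R -> R := shifted_dual k P (kplane_transform k f) x in
  let DF (x : 'cV[R]_n) : R -> R := EK_derivative a (F x) in
  [/\ (* f is recovered, uniformly on R^n *)
      (forall x, EK_differentiable a (F x)) /\
      (forall eps : R, 0 < eps -> \forall t \near 0^'+,
         forall x, `|pi `^ (- a) * DF x t - f x| < eps),
      (* (i) *)
      ~~ odd k -> forall x,
        iter_derivable oppD k./2 (F x) /\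
        forall t, 0 < t -> DF x t = iter k./2 oppD (F x) t,
      (* (ii) *)
      forall x,
        let G (s : R) : R := s ^- (2 * m + 2) * F x s in
        let psi : R -> R := EK_integral (1 - a + m%:R) G in
        let H (t : R) : R := t ^+ k * psi t in
        [/\ EK_converges (1 - a + m%:R) G,
            iter_derivable oppD m.+1 H
          & forall t, 0 < t ->
              DF x t = t ^ (2 - k%:Z + 2 * m%:Z) * iter m.+1 oppD H t],
      (* the alternative formula in (ii) *)
      forall x,
        let G (s : R) : R := s ^- (k + 1) * F x s in
        let H (t : R) : R := t * EK_integral a G t in
        [/\ EK_converges a G,
            iter_derivable oppderive k H
          & forall t, 0 < t -> DF x t = 2 ^- k * iter k oppderive H t]
    & (* the formula under the stronger decay assumption *)
      2 + 2 * m%:R < mu -> forall x,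
        let H : R -> R := EK_integral (1 - a + m%:R) (F x) in
        [/\ EK_converges (1 - a + m%:R) (F x),
            iter_derivable oppD m.+1 H
          & forall t, 0 < t -> DF x t = iter m.+1 oppD H t]].
Proof.
have [k0 kn] : (0 < k)%N /\ (k <= n.-1)%N by case/andP: hk.
have mu0 : 0 < mu by apply: lt_trans hmu; rewrite ltr0n.
have n1 : (1 < n)%N by move: kn k0; clear; lia.
move=> m a F DF.
have DFE x t : 0 < t -> DF x t = pi `^ a * spherical_mean P f x t.
  exact: (EK_derivativeE kn k0 hP hmu x hf).
pose G x (s : R) := pi `^ a * spherical_mean P f x s.
have [cG [convG FE]] : (forall x t, 0 < t -> {for t, continuous (G x)}) /\
    (forall x, EK_converges a (G x)) /\ forall x t, 0 < t -> EK_integral a (G x) t = F x t.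
  have h x := shifted_dual_EK_inverse kn k0 hP hmu x hf.
  by split; [|split] => x; have [] := h x.
split.
- split; first by move=> x; exact: (shifted_dual_EK_differentiable kn k0 hP hmu x hf).
  move=> eps e0; have [B fB] := C_mu_bounded mu0 hf.
  (* The bound for differences of means is not strict, hence the halving. *)
  have e20 : 0 < eps / 2 by rewrite divr_gt0.
  have [d d0 H] := C_mu_unif mu0 hf e20.
  near=> t => x; have t0 : 0 < t by near: t; exact: nbhs_right_gt.
  have td : t < d by near: t; exact: nbhs_right_lt.
  rewrite DFE// mulrA -powRD; last by rewrite (gt_eqF (pi_gt0 R)) implybT.
  (* With [f x] read as the mean of radius 0, the estimate holds with one [d] for all [x]. *)
  rewrite addNr powRr0 mul1r -[f x](spherical_mean0 P f).
  apply: (@le_lt_trans _ _ (eps / 2)); last lra.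
  by apply: (@spherical_mean_unif _ _ P hP n1 f B hf.1 fB (eps / 2) d) => //; rewrite subr0 gtr0_norm.
- move=> ek x; have [iF iE] := EK_formula_even k0 (cG x) (convG x) (fun t h => esym (FE x t h)) ek.
  by split=> // t t0; rewrite DFE// -iE.
- move=> x Gx psi H; have [h1 h2 h3] := EK_formula_conj k0 (cG x) (convG x) (fun t h => esym (FE x t h)).
  by split=> // t t0; rewrite DFE// -h3.
- move=> x Gx H; have [h1 h2 h3] := EK_formula_alt k0 (cG x) (convG x) (fun t h => esym (FE x t h)).
  by split=> // t t0; rewrite DFE// -h3.
- move=> hm x H; have hd := iter_int_converges_decay kn k0 hP x hf hm.
  have [h1 h2 h3] := EK_formula_decay k0 (cG x) (convG x) (fun t h => esym (FE x t h)) hd.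
  by split=> // t t0; rewrite DFE// -h3.
Unshelve. all: end_near. Qed.
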